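(* Let $I$ be a countable set. (i) Let $A\subset I\times I$. For $i\in I$ let $S_i=\{(x,1,T_Ax): x\in \tilde U_i\}$, a compact open bisection of the groupoid $G(X_A,T_A)$, where $\tilde U_i$ is the set of terminal paths starting with $i$. Then the family $(S_i)_{i\in I}$, viewed as elements of $C^*(X_A,T_A)$, is a family of partial isometries which satisfies the Cuntz-Krieger relations (CK1)–(CK4) relative to $A$. In particular, every representation of $C^*(X_A,T_A)$ on a Hilbert space $\mathcal H$ provides a representation of these relations on $\mathcal H$. (ii) Conversely, let $A$ be a $(0,1)$-matrix indexed by $I\times I$ with no zero rows and let $(\underline S_i)_{i\in I}$ be a family of nonzero partial isometries on a Hilbert space $\mathcal H$ satisfying the Cuntz-Krieger relations (CK1)–(CK4) relative to $A$. Then there exists a unique representation of $C^*(X_A,T_A)$ on $\mathcal H$ sending the bisection $S_i$ to $\underline S_i$ for each $i\in I$.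
   Context: A subset $A\subset I\times I$ is identified with its characteristic function, a $(0,1)$-matrix; $A$ has no zero rows if for every $i\in I$ there is $j\in I$ with $(i,j)\in A$. Cuntz-Krieger relations for partial isometries $(S_i)_{i\in I}$, with $P_i=S_iS_i^*$, $Q_i=S_i^*S_i$: (CK1) the $Q_i$ commute; (CK2) the $P_i$ are pairwise orthogonal; (CK3) $P_jQ_i=A(i,j)P_j$ for all $(i,j)\in I\times I$; (CK4) for all finite subsets $E,F\subset I$ such that $A(E,F,i):=\prod_{j\in E}A(j,i)\prod_{k\in F}(1-A(k,i))$ is zero except for a finite number of $i\in I$, one has $\prod_{j\in E}Q_j\prod_{k\in F}(1-Q_k)=\sum_{i\in I}A(E,F,i)P_i$. The space $X_A$. For $i\in I$ let $A_i=\{j\in I:(j,i)\in A\}$. Let $\mathcal J_A\subset\mathcal P(I)=\{0,1\}^I$ be the set of cluster points of $(A_i)_{i\in I}$ as $i\to\infty$ in the discrete set $I$, for the product topology: $J\in\mathcal J_A$ iff for all finite $E\subset J$ and $F\subset I\setminus J$ there are infinitely many $i\in I$ with $E\subset A_i$ and $F\cap A_i=\emptyset$ (so $\mathcal J_A=\emptyset$ if $I$ is finite). A finite path of length $r\ge0$ is $\alpha=(i_0,\dots,i_{r-1})\in I^r$ with $(i_k,i_{k+1})\in A$ for all $k$. $X_A$ is the set of terminal paths: a terminal path is either an infinite path $(i_0,i_1,\dots)$ with $(i_k,i_{k+1})\in A$ for all $k$, or a pair $(i_0,\dots,i_{r-1};J)$, $r\ge 0$, where $(i_0,\dots,i_{r-1})$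 is a finite path, $J\in\mathcal J_A$, and $i_{r-1}\in J$ if $r\geq 1$ (for $r=0$ it is written $(\emptyset;J)$). For a terminal path $x$ of length $\ge r$ put $I_r(x)=A_{i_r}$ if $x$ has length $>r$ ($i_r$ its entry of index $r$) and $I_r(x)=J$ if $x=(i_0,\dots,i_{r-1};J)$. $X_A$ has the coarsest topology for which all the sets $Z(\alpha)=\{x: x \text{ starts with }\alpha\}$ and $\{x\in Z(\alpha): j\in I_r(x)\}$ are open and closed ($\alpha$ a finite path of length $r\ge0$, $j\in I$); it is a compact, totally disconnected, second countable Hausdorff space. $T_A$ is the shift, defined on the set of terminal paths of length $\ge1$ by removing the first entry; it is a local homeomorphism from an open subset of $X_A$ onto an open subset. For a local homeomorphism $T$ from an open subset of a Hausdorff, second countable, locally compact space $X$ onto an open subset of $X$, $T^n$ is the $n$-fold composition on its natural domain, and $G(X,T)=\{(x,m-n,y): m,n\in\mathbf N, x\in\mathrm{dom}(T^m),y\in\mathrm{dom}(T^n),T^mx=T^ny\}$ with product $(x,k,y)(y,l,z)=(x,k+l,z)$, inverse $(x,k,y)^{-1}=(y,-k,x)$, and basic open sets $\{(x,m-n,y):(x,y)\in U\times V,T^mx=T^ny\}$ with $U,V$ open and $T^m|_U,T^n|_V$ injective. It is a Hausdorff étale locally compact groupoid; $C^*(X,T)=C^*(G(X,T))$ (full and reduced coincide). A compact open bisection is identified with its characteristic function in $C_c(G(X,T))\subset C^*(X,T)$. Representations are nondegenerate $*$-representations. *)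

(* Defs.v *)
From HB Require Import structures.
From mathcomp Require Import all_boot all_order all_algebra.
From mathcomp Require Import finmap complex.
From mathcomp Require Import all_classical all_reals all_analysis.

Set Implicit Arguments.
Unset Strict Implicit.
Unset Printing Implicit Defensive.

Import Order.TTheory GRing.Theory Num.Theory.
Import numFieldNormedType.Exports.

Local Open Scope classical_set_scope.
Local Open Scope ring_scope.

(* The complex numbers, declared at type [numClosedFieldType] so that the
   topology of the modulus is found by inference. *)
Definition Cplx (R : realType) : numClosedFieldType := R[i].

(* The inner product is linear in its first argument. *)
Record hilbertSpace (R : realType) := HilbertSpace {
  hilbert_sort :> completeNormedModType (Cplx R);
  inner : {dot hilbert_sort for Num.conj};
  inner_norm : forall x : hilbert_sort, `|x| ^+ 2 = inner x x
}.

Record bop (R : realType) (H : hilbertSpace R) := BOp {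
  bop_fun :> H -> H;
  bop_linear : linear bop_fun;
  bop_continuous : continuous bop_fun
}.

Section BoundedOperators.
Variables (R : realType) (H : hilbertSpace R).
Implicit Types S T U : bop H.

Lemma bop_ext S T : (forall x, S x = T x) -> S = T.
Proof.
case: S T => [f lf cf] [g lg cg] /= /funext fg; subst g.
by rewrite (Prop_irrelevance lf lg) (Prop_irrelevance cf cg).
Qed.

HB.instance Definition _ := gen_eqMixin (bop H).
HB.instance Definition _ := gen_choiceMixin (bop H).

Fact bop_zero_linear : linear (fun _ : H => 0 : H).
Proof. by move=> a x y; rewrite scaler0 addr0. Qed.
Fact bop_zero_continuous : continuous (fun _ : H => 0 : H).
Proof. by move=> x; exact: cvg_cst. Qed.
Definition bop_zero := BOp bop_zero_linear bop_zero_continuous.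

Fact bop_one_linear : linear (fun x : H => x).
Proof. by []. Qed.
Fact bop_one_continuous : continuous (fun x : H => x).
Proof. by move=> x; exact: cvg_id. Qed.
Definition bop_one := BOp bop_one_linear bop_one_continuous.

Fact bop_opp_linear T : linear (fun x => - T x).
Proof. by move=> a x y; rewrite bop_linear opprD scalerN. Qed.
Fact bop_opp_continuous T : continuous (fun x => - T x).
Proof. by move=> x; apply: cvgN; exact: bop_continuous. Qed.
Definition bop_opp T := BOp (@bop_opp_linear T) (@bop_opp_continuous T).

Fact bop_add_linear S T : linear (fun x => S x + T x).
Proof. by move=> a x y; rewrite !bop_linear scalerDr addrACA. Qed.
Fact bop_add_continuous S T : continuous (fun x => S x + T x).
Proof. by move=> x; apply: cvgD; exact: bop_continuous. Qed.
Definition bop_add S T := BOp (@bop_add_linear S T) (@bop_add_continuous S T).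

Fact bop_scale_linear (a : Cplx R) T : linear (fun x => a *: T x).
Proof. by move=> b x y; rewrite bop_linear scalerDr !scalerA mulrC. Qed.
Fact bop_scale_continuous (a : Cplx R) T : continuous (fun x => a *: T x).
Proof. by move=> x; apply: cvgZr; exact: bop_continuous. Qed.
Definition bop_scale a T :=
  BOp (@bop_scale_linear a T) (@bop_scale_continuous a T).

Fact bop_mul_linear S T : linear (fun x => S (T x)).
Proof. by move=> a x y; rewrite !bop_linear. Qed.
Fact bop_mul_continuous S T : continuous (fun x => S (T x)).
Proof.
by move=> x; apply: (@continuous_comp _ _ _ T S); exact: bop_continuous.
Qed.
Definition bop_mul S T := BOp (@bop_mul_linear S T) (@bop_mul_continuous S T).

Fact bop_addA : associative bop_add.
Proof. by move=> S T U; apply: bop_ext => x /=; rewrite addrA. Qed.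
Fact bop_addC : commutative bop_add.
Proof. by move=> S T; apply: bop_ext => x /=; rewrite addrC. Qed.
Fact bop_add0 : left_id bop_zero bop_add.
Proof. by move=> S; apply: bop_ext => x /=; rewrite add0r. Qed.
Fact bop_addN : left_inverse bop_zero bop_opp bop_add.
Proof. by move=> S; apply: bop_ext => x /=; rewrite addNr. Qed.

HB.instance Definition _ :=
  GRing.isZmodule.Build (bop H) bop_addA bop_addC bop_add0 bop_addN.

Fact bop_mulA : associative bop_mul.
Proof. by move=> S T U; apply: bop_ext. Qed.
Fact bop_mul1l : left_id bop_one bop_mul.
Proof. by move=> S; apply: bop_ext. Qed.
Fact bop_mul1r : right_id bop_one bop_mul.
Proof. by move=> S; apply: bop_ext. Qed.
Fact bop_mulDl : left_distributive bop_mul +%R.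
Proof. by move=> S T U; apply: bop_ext. Qed.
Fact bop_mulDr : right_distributive bop_mul +%R.
Proof.
move=> S T U; apply: bop_ext => x /=.
by rewrite -[T x in LHS]scale1r bop_linear scale1r.
Qed.

HB.instance Definition _ := GRing.Zmodule_isPzRing.Build (bop H)
  bop_mulA bop_mul1l bop_mul1r bop_mulDl bop_mulDr.

Fact bop_scaleA a b T : bop_scale a (bop_scale b T) = bop_scale (a * b) T.
Proof. by apply: bop_ext => x /=; rewrite scalerA. Qed.
Fact bop_scale1 : left_id 1 bop_scale.
Proof. by move=> T; apply: bop_ext => x /=; rewrite scale1r. Qed.
Fact bop_scaleDr : right_distributive bop_scale +%R.
Proof. by move=> a S T; apply: bop_ext => x /=; rewrite scalerDr. Qed.
Fact bop_scaleDl T : {morph bop_scale^~ T : a b / a + b}.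
Proof. by move=> a b; apply: bop_ext => x /=; rewrite scalerDl. Qed.

HB.instance Definition _ := GRing.Zmodule_isLmodule.Build (Cplx R) (bop H)
  bop_scaleA bop_scale1 bop_scaleDr bop_scaleDl.

(* The adjoint, chosen by its defining property; it exists and is unique by
   the Riesz representation theorem, so the default value is never used. *)
Definition adjoint T : bop H :=
  xget 0 [set S : bop H | forall x y, inner H (T x) y = inner H x (S y)].

(* The span of the vectors [T x], [T \in L], is dense in [H]. *)
Definition nondegenerate (L : set (bop H)) :=
  closure [set w : H | exists2 s : seq (bop H * H),
    (forall p, p \in s -> L p.1) & w = \sum_(p <- s) p.1 p.2] = [set: H].

End BoundedOperators.

(* [0 = 1] is allowed, so that the zero algebra is not excluded. *)
HB.mixin Record isCstarAlgebra (R : realType) B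
    of CompleteNormedModule (Cplx R) B := {
  cone : B;
  cmul : B -> B -> B;
  star : B -> B;
  cmulA : associative cmul;
  cmul1l : left_id cone cmul;
  cmul1r : right_id cone cmul;
  cmulDl : left_distributive cmul +%R;
  cmulDr : right_distributive cmul +%R;
  cmulZl : forall (a : Cplx R) (x y : B), cmul (a *: x) y = a *: cmul x y;
  cmulZr : forall (a : Cplx R) (x y : B), cmul x (a *: y) = a *: cmul x y;
  starP : forall (a : Cplx R) (x y : B),
    star (a *: x + y) = Num.conj a *: star x + star y;
  starM : forall x y : B, star (cmul x y) = cmul (star y) (star x);
  starK : involutive star;
  cnormM : forall x y : B, `|cmul x y| <= `|x| * `|y|;
  cstar_norm : forall x : B, `|cmul (star x) x| = `|x| ^+ 2
}.

#[short(type="cstarAlgType")]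
HB.structure Definition CstarAlgebra (R : realType) :=
  {B of CompleteNormedModule (Cplx R) B & isCstarAlgebra R B}.

(* An alias of [B] carrying its ring structure: a type cannot be at the same
   time a normed module and a ring of the library without being a number
   domain. *)
Definition cstar_ring (R : realType) (B : cstarAlgType R) : Type := B.

HB.instance Definition _ (R : realType) (B : cstarAlgType R) :=
  GRing.Zmodule.on (cstar_ring B).
HB.instance Definition _ (R : realType) (B : cstarAlgType R) :=
  GRing.Zmodule_isPzRing.Build (cstar_ring B)
    (@cmulA R B) (@cmul1l R B) (@cmul1r R B) (@cmulDl R B) (@cmulDr R B).

Record is_cstar_rep (R : realType) (B : cstarAlgType R) (H : hilbertSpace R)
    (rho : B -> bop H) : Prop := IsCstarRep {
  cstar_rep_linear : linear rho;
  cstar_repM : {morph rho : x y / cmul x y >-> x * y};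
  cstar_rep_star : {morph rho : x / star x >-> adjoint x};
  cstar_rep_nondegenerate : nondegenerate (range rho)
}.

Section CuntzKrieger.
Variables (B : pzRingType) (st : B -> B).

Definition partial_isometry (s : B) := s * st s * s = s.

Variables (I : countType) (A : rel I).

Definition AEF (E F : {fset I}) (i : I) : nat :=
  (\prod_(j <- E) A j i * \prod_(k <- F) (1 - A k i))%N.

Variable S : I -> B.

Local Notation P i := (S i * st (S i)).
Local Notation Q i := (st (S i) * S i).

(* The sum in the last relation is over the finite set of the [i : I] whose
   summand is nonzero; by the first relation the order of the factors in the
   products is immaterial. *)
Record cuntz_krieger : Prop := CuntzKrieger {
  CK1 : forall i j, Q i * Q j = Q j * Q i;
  CK2 : forall i j, i != j -> P i * P j = 0;
  CK3 : forall i j, P j * Q i = P j *+ A i j;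
  CK4 : forall E F : {fset I}, finite_set [set i | AEF E F i != 0%N] ->
    \prod_(j <- E) Q j * \prod_(k <- F) (1 - Q k) =
    \sum_(i \in [set: I]) (P i *+ AEF E F i)
}.

End CuntzKrieger.

(* [T x = None] means that [x] is outside the domain of [T]. *)
Section Groupoid.
Variables (X : topologicalType) (T : X -> option X).

Definition piter (n : nat) (x : X) : option X := iter n (obind T) (Some x).

(* [DRGroupoid x k y _] is the arrow [(x, k, y)], with range [x] and
   source [y]. *)
Record drGroupoid := DRGroupoid {
  rg : X;
  deg : int;
  sr : X;
  drGroupoidP : exists m n z,
    [/\ deg = m%:Z - n%:Z, piter m rg = Some z & piter n sr = Some z]
}.

HB.instance Definition _ := gen_eqMixin drGroupoid.
HB.instance Definition _ := gen_choiceMixin drGroupoid.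

(* [T ^ m] is defined and injective on [U]. *)
Definition injective_iter (m : nat) (U : set X) :=
  (forall x, U x -> piter m x <> None) /\ set_inj U (piter m).

Definition dr_basic : set (set drGroupoid) :=
  [set W | exists U V m n,
    [/\ open U, open V, injective_iter m U, injective_iter n V &
    W = [set g | [/\ U (rg g), V (sr g), deg g = m%:Z - n%:Z &
                     piter m (rg g) = piter n (sr g)]]]].

HB.instance Definition _ := isSubBaseTopological.Build drGroupoid dr_basic id.

Fact dr_inv_subproof (g : drGroupoid) : exists m n z,
  [/\ - deg g = m%:Z - n%:Z, piter m (sr g) = Some z & piter n (rg g) = Some z].
Proof.
have [m [n [z [e1 e2 e3]]]] := drGroupoidP g.
by exists n, m, z; split=> //; rewrite e1 opprB.
Qed.

Definition dr_inv (g : drGroupoid) : drGroupoid :=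
  DRGroupoid (dr_inv_subproof g).

Definition is_product (a b c : drGroupoid) :=
  [/\ sr a = rg b, rg c = rg a, sr c = sr b & deg c = deg a + deg b].

Definition bisection (W : set drGroupoid) := set_inj W rg /\ set_inj W sr.

Variable R : realType.

Definition Cc : set (drGroupoid -> Cplx R) :=
  [set f | continuous f /\
    exists2 K : set drGroupoid, compact K & forall g, ~ K g -> f g = 0].

(* For [f] and [g] in [Cc] only finitely many terms of the sum are nonzero,
   the groupoid being etale. *)
Definition convolution (f g : drGroupoid -> Cplx R) : drGroupoid -> Cplx R :=
  fun c => \sum_(p \in [set p | is_product p.1 p.2 c]) (f p.1 * g p.2).

Definition Cc_star (f : drGroupoid -> Cplx R) : drGroupoid -> Cplx R :=
  fun g => Num.conj (f (dr_inv g)).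

(* Nondegenerate *-representations of [Cc]; the values of [p] outside [Cc] are
   irrelevant. *)
Record is_Cc_rep (H : hilbertSpace R) (p : (drGroupoid -> Cplx R) -> bop H) :
    Prop := IsCcRep {
  Cc_rep_linear : forall a f g, Cc f -> Cc g ->
    p (fun c => a * f c + g c) = a *: p f + p g;
  Cc_repM : forall f g, Cc f -> Cc g -> p (convolution f g) = p f * p g;
  Cc_rep_star : forall f, Cc f -> p (Cc_star f) = adjoint (p f);
  Cc_rep_nondegenerate : nondegenerate (p @` Cc)
}.

(* [B], together with [iota : Cc -> B], is the full C*-algebra of the groupoid:
   the completion of the convolution *-algebra [Cc] for the norm
   [sup_p ||p f||], [p] ranging over the nondegenerate *-representations
   of [Cc]. The last two fields say that [`|iota f|] is this supremum.
   As [B] has a unit, this covers the case where [X] is compact, the unit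
   of [B] being then the image of the characteristic function of [X]. *)
Record is_groupoid_cstar (B : cstarAlgType R)
    (iota : (drGroupoid -> Cplx R) -> B) : Prop := IsGroupoidCstar {
  gcstar_linear : forall a f g, Cc f -> Cc g ->
    iota (fun c => a * f c + g c) = a *: iota f + iota g;
  gcstarM : forall f g, Cc f -> Cc g ->
    iota (convolution f g) = cmul (iota f) (iota g);
  gcstar_star : forall f, Cc f -> iota (Cc_star f) = star (iota f);
  gcstar_dense : closure (iota @` Cc) = [set: B];
  gcstar_norm_ub : forall f, Cc f ->
    forall (H : hilbertSpace R) (p : (drGroupoid -> Cplx R) -> bop H),
    is_Cc_rep p -> forall v, `|p f v| <= `|iota f| * `|v|;
  gcstar_norm_lub : forall f, Cc f -> forall M : Cplx R, 0 <= M ->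
    (forall (H : hilbertSpace R) (p : (drGroupoid -> Cplx R) -> bop H),
      is_Cc_rep p -> forall v, `|p f v| <= M * `|v|) ->
    `|iota f| <= M
}.

End Groupoid.

Section TerminalPaths.
Variables (I : countType) (A : rel I).

Definition column (i : I) : set I := [set j | A j i].

Definition cluster_set (J : set I) := forall E F : {fset I},
  [set` E] `<=` J -> [set` F] `<=` ~` J ->
  infinite_set [set i | [set` E] `<=` column i /\ [set` F] `&` column i = set0].

Inductive prepath :=
| InfinitePath of (nat -> I)
| FinitePath of seq I & set I.

Definition finite_path (s : seq I) := sorted A s.

Definition terminal (x : prepath) : Prop :=
  match x with
  | InfinitePath f => forall k, A (f k) (f k.+1)
  | FinitePath s J => [/\ finite_path s, cluster_set J &
      if s is i :: s' then J (last i s') else True]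
  end.

Record terminalPath := TerminalPath {
  tpath :> prepath;
  tpathP : terminal tpath
}.

HB.instance Definition _ := gen_eqMixin terminalPath.
HB.instance Definition _ := gen_choiceMixin terminalPath.

(* [None] beyond the end of the path *)
Definition entry (x : terminalPath) (k : nat) : option I :=
  match tpath x with
  | InfinitePath f => Some (f k)
  | FinitePath s _ => onth s k
  end.

Definition starts_with (s : seq I) (x : terminalPath) :=
  forall k, (k < size s)%N -> entry x k = onth s k.

(* Only meaningful for [x] of length at least [r]. *)
Definition Iset (r : nat) (x : terminalPath) : set I :=
  match tpath x with
  | InfinitePath f => column (f r)
  | FinitePath s J => if onth s r is Some i then column i else J
  end.

Definition Zset (s : seq I) : set terminalPath := [set x | starts_with s x].

Definition Zset_at (s : seq I) (j : I) : set terminalPath :=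
  [set x | starts_with s x /\ Iset (size s) x j].

Definition tp_subbase : set (set terminalPath) :=
  [set W | exists2 s, finite_path s &
    [\/ W = Zset s, W = ~` Zset s |
        exists j, W = Zset_at s j \/ W = ~` Zset_at s j]].

HB.instance Definition _ := isSubBaseTopological.Build terminalPath
  tp_subbase id.

Definition pretail (x : prepath) : prepath :=
  match x with
  | InfinitePath f => InfinitePath (fun k => f k.+1)
  | FinitePath s J => FinitePath (behead s) J
  end.

Fact pretail_terminal (x : terminalPath) : terminal (pretail x).
Proof.
case: x => -[f|[|i [|j s]] J] //=.
  by case=> _ JJ _; split.
by case=> /andP[_ ? ? ?]; split.
Qed.

Definition path_shift (x : terminalPath) : option terminalPath :=
  if entry x 0 is Some _ then Some (TerminalPath (pretail_terminal x))
  else None.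

(* The set of the arrows [(x, 1, T_A x)], where [x] starts with [i]. *)
Definition Sset (i : I) : set (drGroupoid path_shift) :=
  [set g | [/\ starts_with [:: i] (rg g), deg g = 1 &
               path_shift (rg g) = Some (sr g)]].

End TerminalPaths.

Arguments path_shift {I} A x.
Arguments Sset {I} A i.

(* Main.v *)
Require Import Defs.
From HB Require Import structures.
From mathcomp Require Import all_boot all_order all_algebra.
From mathcomp Require Import finmap complex.
From mathcomp Require Import all_classical all_reals all_analysis.
From mathcomp Require Import ring lra zify.

Set Implicit Arguments.
Unset Strict Implicit.
Unset Printing Implicit Defensive.

Import Order.TTheory GRing.Theory Num.Theory.
Import numFieldNormedType.Exports.

Local Open Scope classical_set_scope.
Local Open Scope ring_scope.

(* Every compactly supported function on the groupoid is a finite sum of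
   functions carried by the compact open bisections [{(s z, |s| - |t|, t z)}],
   [s] and [t] finite paths; these multiply like the products [S_s h S_t^*],
   with [h] in [C(X_A)]. The relations of part (i) thus become pointwise
   identities between indicators of clopen subsets of [X_A].

   For (ii), the projections [u_s Q_j u_s^*] and [u_s u_s^*] commute, and by
   (CK4) a finite product of them and of their complements is nonzero only if
   the corresponding clopen sets meet: refined along all the generators, it
   determines a terminal path. They therefore define a representation [phi] of
   [C(X_A)] with which the [u_i] are covariant, and
   [S_s h S_t^* |-> u_s phi(h) u_t^*] is a representation of the convolution
   algebra, which extends to the C*-algebra by density. Uniqueness holds
   because *-representations of C*-algebras are contractive. *)

(** An arrow [(s z, |s| - |t|, t z)] has many such expressions: the words [s i], [t i] at [z] and
    the words [s], [t] at [i z] give the same one. Reduced pairs, whose words do not end in the same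
    letter, remove the ambiguity: their bisections partition the groupoid into clopen sets, so that
    a function with compact support has finitely many well-defined coefficients. Products leave the
    reduced pairs, and consistency there is the identity [phi (push i h) = u_i phi(h) u_i^*]. [phi]
    is built without spectral theory. The generators of the topology are enumerated, the first [n]
    of them cut the space into atoms carrying orthogonal projections, and [phi h] is a limit of
    Riemann sums, which converge because [h] oscillates little on fine atoms. This needs a point in
    the atom of every nonzero projection, and the obstacle is the finite paths [(s; J)]: a family of
    signs may stop at [s], and (CK4) is what makes the remaining set [J] a cluster point. The
    passage from the convolution algebra to the C*-algebra needs no further estimate, since its norm
    dominates every representation by definition. *)

Section RealNorm.
Variable R : realType.
Local Notation C := (Cplx R).

Definition toC (x : R) : C := x%:C%C.
Definition reC (z : C) : R := complex.Re z.

Lemma toCK x : reC (toC x) = x. Proof. by []. Qed.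
Lemma toCD x y : toC (x + y) = toC x + toC y.
Proof. by rewrite /toC; simpc. Qed.
Lemma toCM x y : toC (x * y) = toC x * toC y.
Proof. by rewrite /toC; simpc. Qed.
Lemma toCN x : toC (- x) = - toC x.
Proof. by rewrite /toC; simpc. Qed.
Lemma toC0 : toC 0 = 0. Proof. by []. Qed.
Lemma toC1 : toC 1 = 1. Proof. by []. Qed.
Lemma toCX x n : toC (x ^+ n) = toC x ^+ n.
Proof. by elim: n => [//|n IH]; rewrite !exprS toCM IH. Qed.
Lemma ler_toC x y : (toC x <= toC y) = (x <= y). Proof. exact: lecR. Qed.
Lemma ltr_toC x y : (toC x < toC y) = (x < y). Proof. exact: ltcR. Qed.
Lemma toC_inj : injective toC. Proof. by move=> x y []. Qed.
Lemma conj_toC x : Num.conj (toC x) = toC x.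
Proof. by rewrite /toC; apply: conjc_real. Qed.
Lemma norm_toC x : `|toC x| = toC `|x|.
Proof. by rewrite /toC normc_def /= expr0n /= addr0 sqrtr_sqr. Qed.
Lemma reCD x y : reC (x + y) = reC x + reC y. Proof. by case: x y => [a b] []. Qed.
Lemma reCN x : reC (- x) = - reC x. Proof. by case: x. Qed.
Lemma reCB x y : reC (x - y) = reC x - reC y. Proof. by rewrite reCD reCN. Qed.
Lemma reC_conj x : reC (Num.conj x) = reC x.
Proof. by case: x. Qed.
Lemma reC_toCM a x : reC (toC a * x) = a * reC x.
Proof. by case: x => u v /=; rewrite /toC /reC /= mul0r subr0. Qed.
Lemma toC_reC x : 0 <= x -> toC (reC x) = x.
Proof. by move=> x0; apply: RRe_real; rewrite ger0_real. Qed.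

(** Norms over [Cplx R] take their values in [Cplx R] itself; brought back to the totally ordered
    field [R], they are open to infima and to real arithmetic. *)
Definition nrm (V : normedZmodType C) (x : V) : R := reC `|x|.

Lemma ler_add_smallM (x y K : R) : 0 <= K ->
  (forall d, 0 < d -> x <= y + d * K) -> x <= y.
Proof.
move=> K0 h; apply/ler_addgt0Pr => e e0.
(* The division is by [K + 1] because [K] may be [0]. *)
have K1 : 0 < K + 1 by rewrite ltr_wpDl.
apply: le_trans (h _ (divr_gt0 e0 K1)) _.
by rewrite lerD2l mulrAC ler_pdivrMr // ler_pM2l // lerDl.
Qed.

Section NormedZmod.
Variable V : normedZmodType C.
Implicit Types x y : V.
Lemma nrmE x : `|x| = toC (nrm x). Proof. by rewrite /nrm toC_reC. Qed.
Lemma nrm_ge0 x : 0 <= nrm x. Proof. by rewrite -ler_toC -nrmE toC0. Qed.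
Lemma nrm0 : nrm (0 : V) = 0. Proof. by rewrite /nrm normr0. Qed.
Lemma nrm_eq0 x : nrm x = 0 -> x = 0.
Proof. by move=> h; apply/normr0_eq0; rewrite nrmE h. Qed.
Lemma nrmN x : nrm (- x) = nrm x. Proof. by rewrite /nrm normrN. Qed.
Lemma nrmD x y : nrm (x + y) <= nrm x + nrm y.
Proof. by rewrite -ler_toC toCD -!nrmE ler_normD. Qed.
Lemma nrm_distC x y : nrm (x - y) = nrm (y - x).
Proof. by rewrite /nrm distrC. Qed.
Lemma nrmB x y : nrm (x - y) <= nrm x + nrm y.
Proof. by rewrite -(nrmN y) nrmD. Qed.
Lemma nrm_dist z x y : nrm (x - y) <= nrm (x - z) + nrm (z - y).
Proof. by rewrite -[x - y](subrKA z) nrmD. Qed.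
Lemma nrm_small x : (forall e : R, 0 < e -> nrm x <= e) -> x = 0.
Proof.
move=> h; apply: nrm_eq0; apply/eqP; rewrite eq_le nrm_ge0 andbT.
by apply/ler_addgt0Pl => e e0; rewrite addr0 h.
Qed.
(** The form in which density arguments end: [d] is the precision of an approximation, [K] gathers
    fixed quantities such as the norm of a vector. *)
Lemma nrm_eqM x y K : 0 <= K -> (forall d, 0 < d -> nrm (x - y) <= d * K) ->
  x = y.
Proof.
move=> K0 h; apply/eqP; rewrite -subr_eq0; apply/eqP/nrm_eq0/le_anti.
rewrite nrm_ge0 andbT; apply: ler_add_smallM K0 _ => d d0.
by rewrite add0r; exact: h.
Qed.

End NormedZmod.

Lemma nrmM (a b : C) : nrm (a * b) = nrm a * nrm b.
Proof. by apply: toC_inj; rewrite toCM -!nrmE normrM. Qed.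
Lemma nrm_conj (a : C) : nrm (Num.conj a) = nrm a.
Proof. by rewrite /nrm norm_conjC. Qed.
Lemma nrm_toC x : nrm (toC x) = `|x|.
Proof. by rewrite /nrm norm_toC. Qed.
Lemma conj_mulC (a : C) : Num.conj a * a = toC (nrm a ^+ 2).
Proof. by rewrite mulrC -normCK nrmE toCX. Qed.
Lemma reC_le (a : C) : reC a <= nrm a.
Proof.
apply: (le_trans (ler_norm _)).
by rewrite -ler_toC -nrmE; exact: (@normc_ge_Re R a).
Qed.
Lemma nrmZ (V : normedModType C) (a : C) (x : V) : nrm (a *: x) = nrm a * nrm x.
Proof. by apply: toC_inj; rewrite toCM -!nrmE normrZ. Qed.

Section Topology.
Variable V : pseudoMetricNormedZmodType C.

Lemma nbhs_nrmP (x : V) (A : set V) :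
  nbhs x A <-> exists2 e : R, 0 < e & forall y, nrm (y - x) < e -> A y.
Proof.
rewrite -nbhs_ballE; split.
  case=> e /= e0 h; exists (reC e); first by rewrite -ltr_toC toC_reC // ltW.
  move=> y hy; apply: h; rewrite -ball_normE /ball_ /= distrC nrmE.
  by rewrite -(toC_reC (ltW e0)) ltr_toC.
case=> e e0 h; exists (toC e); first by rewrite /= -toC0 ltr_toC.
move=> y; rewrite -ball_normE /ball_ /= distrC nrmE ltr_toC; exact: h.
Qed.

Lemma cvg_nrmP (T : Type) (F : set_system T) (FF : Filter F) (f : T -> V) l :
  f x @[x --> F] --> l <->
  forall e : R, 0 < e -> \forall x \near F, nrm (f x - l) < e.
Proof.
split=> [h e e0|h A /nbhs_nrmP[e e0 hA]].
  by apply: (h [set y | nrm (y - l) < e]); apply/nbhs_nrmP; exists e.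
by apply: filterS (h e e0) => x /= hx; exact: hA.
Qed.

Lemma cvgn_nrmP (u : nat -> V) (l : V) : u n @[n --> \oo] --> l <->
  forall e : R, 0 < e -> exists N, forall n, (N <= n)%N -> nrm (u n - l) < e.
Proof.
split=> [h e e0|h].
  have [N _ hN] := (cvg_nrmP _ u l).1 h e e0.
  by exists N => n; exact: hN.
by apply/(cvg_nrmP _ u l) => e /h[N hN]; exists N => // n /=; exact: hN.
Qed.

Lemma cvgn_nrm_unique (u : nat -> V) (a b : V) :
  (u n @[n --> \oo] --> a) -> (u n @[n --> \oo] --> b) -> a = b.
Proof.
move=> /cvgn_nrmP ha /cvgn_nrmP hb; apply/eqP; rewrite -subr_eq0; apply/eqP.
apply: nrm_small => e e0.
have e2 : 0 < e / 2 by rewrite divr_gt0.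
have [N hN] := ha _ e2; have [M hM] := hb _ e2.
apply: (le_trans (nrm_dist (u (N + M)%N) _ _)); rewrite nrm_distC.
rewrite [e]splitr lerD //; apply/ltW.
  by apply: hN; rewrite leq_addr.
by apply: hM; rewrite leq_addl.
Qed.

End Topology.

Lemma complete_nrm (V : completeNormedModType C) (u : nat -> V) :
  (forall e : R, 0 < e -> exists N, forall m n, (N <= m)%N -> (m <= n)%N ->
      nrm (u n - u m) < e) ->
  exists l : V, u n @[n --> \oo] --> l.
Proof.
move=> h; apply/cvg_ex; apply: cauchy_cvg.
apply: cauchy_exP => e e0.
have e0' : 0 < reC e by rewrite -ltr_toC toC_reC // ltW.
have [N hN] := h _ e0'; exists (u N); exists N => // n /= Nn.
by rewrite -ball_normE /ball_ /= distrC nrmE -(toC_reC (ltW e0)) ltr_toC hN.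
Qed.

Lemma continuous_nrmP (X : topologicalType) (V : pseudoMetricNormedZmodType C)
    (f : X -> V) x :
  {for x, continuous f} <->
  forall e : R, 0 < e -> \forall y \near x, nrm (f y - f x) < e.
Proof. exact: cvg_nrmP. Qed.

(** This root witnesses the positivity of [M^2 - |h|^2]; continuity keeps it inside the algebra of
    continuous functions, where a representation can be applied to it. *)
Lemma sqrt_sub_nrm_continuous (X : topologicalType) (h : X -> C) (M : R) :
  continuous h -> continuous (fun x => toC (Num.sqrt (M ^+ 2 - nrm (h x) ^+ 2))).
Proof.
move=> hc x; have nc : nrm (h y) @[y --> x] --> nrm (h x).
  apply/cvgrPdist_lt => e e0; have /continuous_nrmP/(_ _ e0) := hc x.
  apply: filterS => y; apply: le_lt_trans; rewrite ler_norml lerBlDr lerNl.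
  rewrite opprB lerBlDr; apply/andP; split.
    by have := nrmD (h y - h x) (h x); rewrite subrK.
  by have := nrmD (h x - h y) (h y); rewrite subrK nrm_distC.
have dc : {for x, continuous (fun y => M ^+ 2 - nrm (h y) ^+ 2)}.
  apply: (@cvgB _ R^o _ _ _ (fun=> M ^+ 2) (fun y => nrm (h y) ^+ 2)).
    by apply: (@cvg_cst R^o).
  by under eq_fun do rewrite expr2; rewrite expr2; exact: cvgM.
apply/continuous_nrmP => e e0.
have /cvgrPdist_lt/(_ e e0) := continuous_comp dc (@sqrt_continuous R _).
by apply: filterS => y; rewrite -toCN -toCD nrm_toC distrC.
Qed.

End RealNorm.

(** * Hilbert space geometry and bounded operators *)

Section Hilbert.
Variables (R : realType) (H : hilbertSpace R).
Implicit Types (x y z : H) (S T : bop H).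

Lemma innerC x y : inner H x y = Num.conj (inner H y x).
Proof. by rewrite hermC expr0 mul1r. Qed.
Lemma innerDl x y z : inner H (x + y) z = inner H x z + inner H y z.
Proof. exact: linearDl. Qed.
Lemma innerZl a x z : inner H (a *: x) z = a * inner H x z.
Proof. exact: linearZl_LR. Qed.
Lemma innerNl x z : inner H (- x) z = - inner H x z.
Proof. exact: linearNl. Qed.
Lemma innerDr x y z : inner H z (x + y) = inner H z x + inner H z y.
Proof. exact: linearDr. Qed.
Lemma innerNr x z : inner H z (- x) = - inner H z x.
Proof. exact: linearNr. Qed.
Lemma innerZr a x z : inner H z (a *: x) = Num.conj a * inner H z x.
Proof. by rewrite linearZr_LR. Qed.
Lemma inner0l x : inner H 0 x = 0. Proof. exact: linear0l. Qed.
Lemma inner0r x : inner H x 0 = 0. Proof. exact: linear0r. Qed.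

Lemma inner_nrm x : inner H x x = toC (nrm x ^+ 2).
Proof. by rewrite -inner_norm nrmE toCX. Qed.

Lemma nrm_sqrD x y :
  nrm (x + y) ^+ 2 = nrm x ^+ 2 + nrm y ^+ 2 + 2 * reC (inner H x y).
Proof.
have := inner_nrm (x + y); rewrite innerDl !innerDr !inner_nrm (innerC y x).
move=> /(congr1 (@reC R)); rewrite !reCD reC_conj !toCK => <-.
by rewrite mulr_natl mulr2n; ring.
Qed.

Lemma nrm_sqrZ a x : nrm (a *: x) ^+ 2 = nrm a ^+ 2 * nrm x ^+ 2.
Proof. by rewrite nrmZ exprMn. Qed.

Lemma parallelogram x y :
  nrm (x - y) ^+ 2 = 2 * nrm x ^+ 2 + 2 * nrm y ^+ 2 - nrm (x + y) ^+ 2.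
Proof. by rewrite !nrm_sqrD nrmN innerNr reCN; ring. Qed.

Lemma inner_small x : (forall y, inner H y x = 0) -> x = 0.
Proof.
move=> h; apply: nrm_eq0; have := h x; rewrite inner_nrm => /(@toC_inj R _ 0).
by move/eqP; rewrite expf_eq0 /= => /eqP.
Qed.

Lemma inner_inj x y : (forall z, inner H z x = inner H z y) -> x = y.
Proof.
move=> h; apply/eqP; rewrite -subr_eq0; apply/eqP; apply: inner_small => z.
by rewrite innerDr innerNr h subrr.
Qed.

(* Expand [|x - t (x,y) y|^2 >= 0] with [t = 1/|y|^2]. *)
Lemma cauchy_schwarz x y : nrm (inner H x y) <= nrm x * nrm y.
Proof.
have [->|y0] := eqVneq y 0; first by rewrite inner0r !nrm0 mulr0.
have ny : 0 < nrm y.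
  by rewrite lt_def nrm_ge0 andbT; apply: contra y0 => /eqP/nrm_eq0 ->.
set c := inner H x y.
have := sqr_ge0 (nrm (toC (nrm y ^+ 2) *: x - c *: y)).
rewrite nrm_sqrD nrmN !nrm_sqrZ innerNr innerZl innerZr -/c reCN.
rewrite [X in reC X](_ : _ = toC (nrm y ^+ 2 * nrm c ^+ 2)); last first.
  by rewrite conj_mulC toCM.
rewrite toCK nrm_toC ger0_norm ?sqr_ge0 // => h.
rewrite -ler_sqr ?nnegrE ?mulr_ge0 ?nrm_ge0 // exprMn.
have y2 : 0 < nrm y ^+ 2 by rewrite exprn_gt0.
rewrite -(ler_pM2l y2).
move: h; set a := nrm y ^+ 2 in y2 *; set b := nrm x ^+ 2; set d := nrm c ^+ 2.
move=> h; rewrite -subr_ge0; apply: le_trans h _.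
by rewrite le_eqVlt; apply/orP; left; apply/eqP; ring.
Qed.

Lemma bopZ T a x : T (a *: x) = a *: T x.
Proof.
have T0 : T 0 = 0.
  have := bop_linear T 1 0 0; rewrite !scale1r addr0 => /eqP.
  by rewrite -subr_eq0 opprD addrA subrr sub0r oppr_eq0 => /eqP.
by have := bop_linear T a x 0; rewrite !addr0 T0 addr0.
Qed.
Lemma bop0 T : T 0 = 0. Proof. by have := bopZ T 0 0; rewrite !scale0r. Qed.
Lemma bopD T x y : T (x + y) = T x + T y.
Proof. by have := bop_linear T 1 x y; rewrite !scale1r. Qed.
Lemma bopN T x : T (- x) = - T x. Proof. by rewrite -scaleN1r bopZ scaleN1r. Qed.
Lemma bopB T x y : T (x - y) = T x - T y. Proof. by rewrite bopD bopN. Qed.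
Lemma bop_sum T J (r : seq J) (P : pred J) (F : J -> H) :
  T (\sum_(i <- r | P i) F i) = \sum_(i <- r | P i) T (F i).
Proof. by apply: big_morph; [exact: bopD | exact: bop0]. Qed.

Lemma bopDE S T x : (S + T) x = S x + T x. Proof. by []. Qed.
Lemma bopME S T x : (S * T) x = S (T x). Proof. by []. Qed.
Lemma bopNE T x : (- T) x = - T x. Proof. by []. Qed.
Lemma bopBE S T x : (S - T) x = S x - T x. Proof. by []. Qed.
Lemma bopZE a T x : (a *: T) x = a *: T x. Proof. by []. Qed.
Lemma bop1E x : (1 : bop H) x = x. Proof. by []. Qed.
Lemma bop0E x : (0 : bop H) x = 0. Proof. by []. Qed.
Lemma bop_sumE J (r : seq J) (P : pred J) (F : J -> bop H) x :
  (\sum_(i <- r | P i) F i) x = \sum_(i <- r | P i) F i x.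
Proof. by apply: (big_morph (fun T : bop H => T x)). Qed.

Lemma bop_scaleAl a S T : (a *: S) * T = a *: (S * T).
Proof. by apply: bop_ext. Qed.
Lemma bop_scaleAr a S T : S * (a *: T) = a *: (S * T).
Proof. by apply: bop_ext => x; exact: bopZ. Qed.

Lemma linear_continuous_nrm (f : H -> H) (M : R) : linear f ->
  (forall x, nrm (f x) <= M * nrm x) -> continuous f.
Proof.
move=> lf hM x; apply/continuous_nrmP => e e0; apply/nbhs_nrmP.
have M0 : 0 < `|M| + 1 by rewrite ltr_wpDl.
exists (e / (`|M| + 1)); first by rewrite divr_gt0.
move=> y; rewrite ltr_pdivlMr // => hy.
have fB : f y - f x = f (y - x).
  by have := lf (-1) x y; rewrite !scaleN1r [- x + y]addrC [- f x + _]addrC.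
rewrite fB; apply: le_lt_trans (hM _) _; apply: le_lt_trans hy.
rewrite mulrC ler_wpM2l ?nrm_ge0 //.
by rewrite (le_trans (ler_norm _)) // lerDl.
Qed.

Definition bop_of_bounded (f : H -> H) (lf : linear f) (M : R)
    (hM : forall x, nrm (f x) <= M * nrm x) : bop H :=
  BOp lf (linear_continuous_nrm lf hM).

Lemma bop_bounded T : exists2 M : R, 0 < M & forall x, nrm (T x) <= M * nrm x.
Proof.
have /continuous_nrmP/(_ 1 ltr01) := @bop_continuous _ _ T 0.
case/nbhs_nrmP => e e0 he; exists (2 / e); first by rewrite divr_gt0.
move=> x; have [->|x0] := eqVneq x 0; first by rewrite bop0 !nrm0 mulr0.
have nx : 0 < nrm x.
  by rewrite lt_def nrm_ge0 andbT; apply: contra x0 => /eqP/nrm_eq0 ->.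
(* The vector rescaled by this factor has norm [e / 2], inside the ball where [T] stays below [1];
   hence the bound [2 / e]. *)
have t0 : 0 < e / (2 * nrm x) by rewrite divr_gt0 // mulr_gt0.
have := he (toC (e / (2 * nrm x)) *: x).
rewrite subr0 bop0 subr0 bopZ !nrmZ nrm_toC (ger0_norm (ltW t0)).
have -> : e / (2 * nrm x) * nrm x = e / 2 by field; rewrite gt_eqF.
move=> /(_ _)/ltW h.
have : e / (2 * nrm x) * nrm (T x) <= 1.
  by apply: h; rewrite ltr_pdivrMr // ltr_pMr // ltr1n.
rewrite -ler_pdivlMl ?divr_gt0 ?mulr_gt0 // mulr1 invf_div.
by move=> /le_trans; apply; rewrite mulrAC.
Qed.

End Hilbert.

(** * Riesz representation, adjoints and limits of operators *)

Section Riesz.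
Variables (R : realType) (H : hilbertSpace R).
Local Notation C := (Cplx R).

Lemma invS_small (e : R) : 0 < e -> exists N, forall n, (N <= n)%N ->
  n.+1%:R^-1 < e.
Proof.
move=> e0; exists (Num.truncn e^-1) => n Nn.
rewrite invf_plt ?posrE ?ltr0Sn //.
have := truncnS_gt e^-1 => /lt_le_trans; apply.
by rewrite ler_nat.
Qed.

(* The representing vector minimises [|x|^2 - 2 Re (phi x)]. *)
Lemma riesz (phi : H -> C) (M : R) :
  (forall a x y, phi (a *: x + y) = a * phi x + phi y) ->
  0 <= M -> (forall x, nrm (phi x) <= M * nrm x) ->
  exists z, forall x, phi x = inner H x z.
Proof.
move=> plin M0 pM.
have pD x y : phi (x + y) = phi x + phi y.
  by have := plin 1 x y; rewrite scale1r mul1r.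
have p0 : phi 0 = 0.
  by have := pD 0 0; rewrite addr0 => /esym/eqP; rewrite -subr_eq0 addrK => /eqP.
have pZ a x : phi (a *: x) = a * phi x.
  by have := plin a x 0; rewrite !addr0 p0 addr0.
pose J x := nrm x ^+ 2 - 2 * reC (phi x).
have JD x w : J (x + w) =
    J x + nrm w ^+ 2 + 2 * reC (inner H x w) - 2 * reC (phi w).
  by rewrite /J nrm_sqrD pD reCD; ring.
(* Completing the square: [J x >= (|x| - M)^2 - M^2]. *)
have Jlb x : - M ^+ 2 <= J x.
  rewrite /J; have := le_trans (reC_le _) (pM x); have := sqr_ge0 (nrm x - M).
  by nra.
have hinf : has_inf (range J).
  split; first by exists (J 0), 0.
  by exists (- M ^+ 2) => _ [x _ <-].
set d := inf (range J).
have dJ x : d <= J x.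
  by apply: ge_inf; [exact: hinf.2 | exists x].
have /choice[u hu] n : exists x, J x < d + n.+1%:R^-1.
  have n0 : 0 < n.+1%:R^-1 :> R by rewrite invr_gt0.
  by have [_ [x _ <-] hx] := inf_adherent n0 hinf; exists x.
(* [J] is at least [d] at the midpoint of [x] and [y]; by the parallelogram law this bounds
   [|x - y|], so that minimising sequences are Cauchy. *)
have par x y : nrm (x - y) ^+ 2 <= 2 * (J x - d) + 2 * (J y - d).
  have := dJ (toC (2^-1) *: (x + y)).
  rewrite {1}/J nrm_sqrZ nrm_toC pZ reC_toCM ger0_norm ?invr_ge0 // pD reCD.
  rewrite parallelogram /J; set a := nrm (x + y) ^+ 2; set b := reC _.
  by set c := reC _ => h; lra.
have [z hz] : exists z : H, u n @[n --> \oo] --> z.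
  apply: complete_nrm => e e0.
  have [|N hN] := @invS_small (e ^+ 2 / 4); first by rewrite divr_gt0 ?exprn_gt0.
  exists N => m n Nm mn.
  rewrite -ltr_sqr ?nnegrE ?nrm_ge0 ?ltW //.
  apply: le_lt_trans (par _ _) _.
  move: (hu n) (hu m) (hN m Nm) (hN n (leq_trans Nm mn)).
  move: (J (u n)) (J (u m)) (e ^+ 2) (m.+1%:R^-1) (n.+1%:R^-1) => a b k p q.
  by lra.
clearbody d J; exists z => w.
have W0 : 0 < nrm w ^+ 2 + 1 by rewrite ltr_wpDl ?sqr_ge0.
(* Approximate stationarity of [u n]: moving it by [s * conj c] times [w], with
   [s = 1 / (|w|^2 + 1)], lowers [J] by at least [s |c|^2], while [J (u n)] exceeds the infimum by
   less than [1 / (n + 1)]. *)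
have key n : nrm (phi w - inner H w (u n)) ^+ 2 <= (nrm w ^+ 2 + 1) * n.+1%:R^-1.
  set c := phi w - inner H w (u n); pose s := (nrm w ^+ 2 + 1)^-1.
  have s0 : 0 < s by rewrite invr_gt0.
  have := le_trans (dJ (u n + (toC s * Num.conj c) *: w)) (lexx _).
  rewrite JD nrm_sqrZ nrmM nrm_toC nrm_conj (ger0_norm (ltW s0)) pZ.
  rewrite innerC reC_conj innerZl.
  have -> (a b : R) (x y : C) : a + b + 2 * reC x - 2 * reC y =
      a + (b - 2 * reC (y - x)) by rewrite reCB; ring.
  have -> : reC (toC s * Num.conj c * phi w - toC s * Num.conj c * inner H w (u n)) =
      s * nrm c ^+ 2 by rewrite -mulrBr -mulrA conj_mulC reC_toCM toCK.
  rewrite -ler_pdivrMl // -/s exprMn => h.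
  have s1 : s * nrm w ^+ 2 <= 1 by rewrite mulrC ler_pdivrMr ?mul1r ?lerDl.
  have := ler_wpM2l (mulr_ge0 (ltW s0) (sqr_ge0 (nrm c))) s1.
  by move: (hu n) h; move: (_.+1%:R^-1) => v; lra.
apply: (@nrm_eqM _ _ _ _ (1 + nrm w)) => [|e e0]; first by rewrite addr_ge0 ?nrm_ge0.
have [N hN] := (cvgn_nrmP u z).1 hz _ e0.
have [|N' hN'] := @invS_small (e ^+ 2 / (nrm w ^+ 2 + 1)).
  by rewrite divr_gt0 ?exprn_gt0.
have uz := hN _ (leq_addr N' N).
rewrite (le_trans (nrm_dist (inner H w (u (N + N')%N)) _ _)) // mulrDr mulr1 lerD //.
  rewrite -ler_sqr ?nnegrE ?nrm_ge0 ?(ltW e0) // (le_trans (key _)) //.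
  by rewrite mulrC -ler_pdivlMr // ltW // hN' // leq_addl.
rewrite -innerNr -innerDr (le_trans (cauchy_schwarz _ _)) // mulrC.
by rewrite ler_wpM2r ?nrm_ge0 // ltW.
Qed.

Lemma adjoint_exists (T : bop H) :
  exists S : bop H, forall x y, inner H (T x) y = inner H x (S y).
Proof.
have [M M0 hM] := bop_bounded T.
have /choice[f hf] y : exists z, forall x, inner H (T x) y = inner H x z.
  apply: (@riesz _ (M * nrm y)).
  - by move=> a x x'; rewrite bop_linear innerDl innerZl.
  - by rewrite mulr_ge0 ?nrm_ge0 // ltW.
  move=> x; apply: le_trans (cauchy_schwarz _ _) _.
  by rewrite mulrAC ler_wpM2r ?nrm_ge0.
have lf : linear f.
  move=> a x y; apply: inner_inj => z.
  by rewrite -hf innerDr innerZr !hf innerDr innerZr.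
suff bf x : nrm (f x) <= M * nrm x by exists (bop_of_bounded lf bf).
have [->|fx0] := eqVneq (nrm (f x)) 0; first by rewrite mulr_ge0 ?nrm_ge0 // ltW.
have fp : 0 < nrm (f x) by rewrite lt_def fx0 nrm_ge0.
rewrite -(ler_pM2r fp) -expr2.
have := inner_nrm (f x); rewrite -hf => e.
have : nrm (inner H (T (f x)) x) = nrm (f x) ^+ 2.
  by rewrite e nrm_toC ger0_norm ?sqr_ge0.
move=> <-; apply: le_trans (cauchy_schwarz _ _) _.
rewrite mulrAC ler_wpM2r ?nrm_ge0 //.
Qed.

Implicit Types (x y : H) (S T : bop H).

Lemma adjointP T x y : inner H (T x) y = inner H x (adjoint T y).
Proof.
have [S hS] := adjoint_exists T.
rewrite /adjoint; case: xgetP => [_ _ -> //|].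
by move=> /(_ S).
Qed.

Lemma adjointPl T x y : inner H (adjoint T x) y = inner H x (T y).
Proof. by rewrite innerC -adjointP -innerC. Qed.

Lemma adjoint_unique S T :
  (forall x y, inner H (T x) y = inner H x (S y)) -> adjoint T = S.
Proof.
by move=> h; apply: bop_ext => y; apply: inner_inj => z; rewrite -adjointP h.
Qed.

Lemma adjointK : involutive (@adjoint R H).
Proof. by move=> T; apply: adjoint_unique => x y; rewrite adjointPl. Qed.
Lemma adjointM S T : adjoint (S * T) = adjoint T * adjoint S.
Proof. by apply: adjoint_unique => x y; rewrite !bopME !adjointP. Qed.
Lemma adjointD S T : adjoint (S + T) = adjoint S + adjoint T.
Proof.
by apply: adjoint_unique => x y; rewrite !bopDE innerDl innerDr !adjointP.
Qed.
Lemma adjointZ a T : adjoint (a *: T) = Num.conj a *: adjoint T.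
Proof.
apply: adjoint_unique => x y.
by rewrite !bopZE innerZl innerZr conjCK adjointP.
Qed.
Lemma adjoint1 : adjoint (1 : bop H) = 1.
Proof. exact: adjoint_unique. Qed.
Lemma adjoint0 : adjoint (0 : bop H) = 0.
Proof. by apply: adjoint_unique => x y; rewrite !bop0E inner0l inner0r. Qed.
Lemma adjointN T : adjoint (- T) = - adjoint T.
Proof.
by apply: adjoint_unique => x y; rewrite !bopNE innerNl innerNr adjointP.
Qed.
Lemma adjointB S T : adjoint (S - T) = adjoint S - adjoint T.
Proof. by rewrite adjointD adjointN. Qed.
Lemma adjoint_sum J (r : seq J) (P : pred J) (F : J -> bop H) :
  adjoint (\sum_(i <- r | P i) F i) = \sum_(i <- r | P i) adjoint (F i).
Proof. exact: (big_morph _ adjointD adjoint0). Qed.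

Lemma nrm_sqr_adjoint T x :
  toC (nrm (T x) ^+ 2) = inner H ((adjoint T * T) x) x.
Proof. by rewrite -inner_nrm bopME adjointPl. Qed.

Lemma adjoint_bound T M : 0 <= M -> (forall x, nrm (T x) <= M * nrm x) ->
  forall x, nrm (adjoint T x) <= M * nrm x.
Proof.
move=> M0 hM x; set y := adjoint T x.
have [->|y0] := eqVneq (nrm y) 0; first by rewrite mulr_ge0 ?nrm_ge0.
have yp : 0 < nrm y by rewrite lt_def y0 nrm_ge0.
rewrite -(ler_pM2r yp) -expr2.
have := inner_nrm y; rewrite {2}/y -adjointP => e.
have : nrm (inner H (T y) x) = nrm y ^+ 2.
  by rewrite e nrm_toC ger0_norm ?sqr_ge0.
move=> <-; apply: le_trans (cauchy_schwarz _ _) _.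
by rewrite mulrAC ler_wpM2r ?nrm_ge0.
Qed.

Lemma bop_eqM S T : (forall d : R, 0 < d -> forall v, exists w : H,
    nrm (S v - w) <= d * nrm v /\ nrm (T v - w) <= d * nrm v) ->
  S = T.
Proof.
move=> h; apply: bop_ext => v.
apply: (@nrm_eqM _ _ _ _ (nrm v + nrm v)) => [|d /h/(_ v)[w [Sw Tw]]].
  by rewrite addr_ge0 ?nrm_ge0.
by rewrite (le_trans (nrm_dist w _ _)) // mulrDr lerD // nrm_distC.
Qed.

(** Completeness for the operator norm. That norm is never introduced as such; it appears as bounds
    proportional to [nrm v], uniform in [v]. *)
Lemma bop_lim (T : nat -> bop H) :
  (forall e : R, 0 < e -> exists N, forall m n, (N <= m)%N -> (N <= n)%N ->
     forall v, nrm (T m v - T n v) <= e * nrm v) ->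
  exists S : bop H, forall e : R, 0 < e -> exists N, forall n, (N <= n)%N ->
     forall v, nrm (S v - T n v) <= e * nrm v.
Proof.
move=> hT; have /choice[t ht] v : exists l : H, T n v @[n --> \oo] --> l.
  apply: complete_nrm => e e0.
  have v1 : 0 < nrm v + 1 by rewrite ltr_wpDl ?nrm_ge0.
  have [N hN] := hT _ (divr_gt0 e0 v1).
  exists N => m n Nm mn; apply: le_lt_trans (hN _ _ (leq_trans Nm mn) Nm v) _.
  by rewrite mulrAC ltr_pdivrMr // ltr_pM2l // ltrDl.
have hlim (e : R) : 0 < e -> exists N, forall n, (N <= n)%N ->
    forall v, nrm (t v - T n v) <= e * nrm v.
  move=> e0; have [N hN] := hT _ e0; exists N => n Nn v.
  apply/ler_addgt0Pl => d d0; have [M hM] := (cvgn_nrmP _ _).1 (ht v) d d0.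
  apply: (le_trans (nrm_dist (T (N + M)%N v) _ _)); rewrite lerD //.
    by rewrite nrm_distC; apply/ltW/hM; rewrite leq_addl.
  by apply: hN; rewrite // leq_addr.
have tl : linear t.
  move=> a x y; apply: cvgn_nrm_unique (ht _) _.
  have -> : (fun n => T n (a *: x + y)) = (fun n => a *: T n x + T n y).
    by apply/funext => n; rewrite bop_linear.
  by apply: cvgD (ht y); apply: cvgZl_tmp.
have [N hN] := hlim 1 ltr01; have [M M0 hM] := bop_bounded (T N).
have tb v : nrm (t v) <= (M + 1) * nrm v.
  rewrite -[t v](subrK (T N v)) (le_trans (nrmD _ _)) //.
  by rewrite mulrDl addrC lerD // hN.
by exists (bop_of_bounded tl tb) => e /hlim.
Qed.

End Riesz.

(** * Topologies given by a subbase *)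

Section Subbase.
Variables (T : choiceType) (D : set (set T)).
(** The open sets of the topology generated by [D], spelled out for an abstract [D] so that the two
    lemmas apply by conversion both to terminal paths and to the groupoid. *)
Local Notation sopen :=
  [set \bigcup_(B in E) B | E in subset^~ (finI_from D id)].

Lemma subbase_open (W : set T) : D W -> sopen W.
Proof.
move=> hW; exists [set W] => //; last by rewrite bigcup_set1.
move=> _ ->; exists [fset W]%fset; first by move=> V /fset1P ->; rewrite inE.
by apply/seteqP; split=> [x h|x h V /fset1P -> //]; apply: h; apply/fset1P.
Qed.

Lemma subbase_finI (W : set T) x : sopen W -> W x -> exists s : seq (set T),
  (forall V, V \in s -> D V /\ V x) /\
  (forall y, (forall V, V \in s -> V y) -> W y).
Proof.
case=> E EI <- [B EB Bx]; have [F FD BE] := EI _ EB.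
exists F; split=> [V VF|y hy].
  split; first by have := FD V VF; rewrite inE.
  by move: Bx; rewrite /= -BE; apply.
by exists B => //; rewrite /= -BE => V; exact: hy.
Qed.

End Subbase.

Lemma sat_seq (T : Type) (J : eqType) (F : set_system T) (FF : Filter F)
    (P : J -> set T) (s : seq J) :
  (forall j, j \in s -> F (P j)) -> F [set x | forall j, j \in s -> P j x].
Proof.
elim: s => [|j s IH] h; first by apply: filterS filterT => x.
have hj : F (P j) by apply: h; rewrite mem_head.
have hs : F [set x | forall j, j \in s -> P j x].
  by apply: IH => k ks; apply: h; rewrite in_cons ks orbT.
apply: filterS (filterI hj hs) => x [xj xs] k.
by rewrite in_cons => /orP[/eqP ->|/xs].
Qed.

(** * Generators of the topology, and terminal paths with prescribed membership in them *)

Section TerminalPathTopology.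
Variables (I : countType) (A : rel I).
Local Notation X := (terminalPath A).

Lemma tp_subbase_open (W : set X) : tp_subbase W -> open W.
Proof. exact: subbase_open. Qed.

Lemma terminalPath_inj (x y : X) : tpath x = tpath y -> x = y.
Proof.
by case: x y => [x px] [y py] /= e; subst y; rewrite (Prop_irrelevance px py).
Qed.

Lemma AEF_E (E F : {fset I}) i :
  AEF A E F i = all (fun j => A j i) E && all (fun k => ~~ A k i) F.
Proof.
have prodb (r : seq I) (b : I -> bool) : (\prod_(j <- r) b j)%N = all b r :> nat.
  by elim: r => [|j r IH]; rewrite ?big_nil // big_cons IH mulnb.
by rewrite /AEF prodb -mulnb -(prodb F); congr muln; apply: eq_bigr => k _; case: (A k i).
Qed.

(* [gen (s, None)] and [gen (s, Some j)] are the generators [Z(s)] and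
   [{x in Z(s) : j in I_r(x)}] of the topology. *)
Definition gen (g : seq I * option I) : set X :=
  if g.2 is Some j then Zset_at g.1 j else Zset g.1.

Lemma entry_path (x : X) k i j :
  entry x k = Some i -> entry x k.+1 = Some j -> A i j.
Proof.
case: x => -[f|s J] /= h; rewrite /entry /=; first by move=> [<-] [<-].
case: h => hs _ _; elim: s k hs => [|a s IH] [|k] //=.
  by case: s {IH} => [|b s] //= /andP[ab _] [<-] [<-].
by move=> /path_sorted; exact: IH.
Qed.

Lemma onth_lt (T : Type) (x0 : T) (s : seq T) k : (k < size s)%N ->
  onth s k = Some (nth x0 s k).
Proof. by elim: s k => [|a s IH] [|k] //=; exact: IH. Qed.

Lemma onth_some (T : Type) (s : seq T) k : (k < size s)%N ->
  exists a, onth s k = Some a.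
Proof. by case: s => [//|a s] /(onth_lt a); exists (nth a (a :: s) k). Qed.

Lemma starts_with_path s (x : X) : starts_with s x -> finite_path A s.
Proof.
move=> h; rewrite /finite_path; case: s h => [//|a s] h.
apply/(pathP a) => k ks.
have h1 := h k (ltnW ks); have h2 := h k.+1 ks.
rewrite (onth_lt a) in h1; last exact: ltnW.
rewrite (onth_lt a) // in h2.
exact: entry_path h1 h2.
Qed.

Lemma gen_clopen g : clopen (gen g).
Proof.
have [gp|gp] := boolP (finite_path A g.1).
  case: g gp => s [j|] /= sp; split; rewrite ?/gen /=.
  - by apply: tp_subbase_open; exists s => //; apply: Or33; exists j; left.
  - rewrite -openC; apply: tp_subbase_open; exists s => //; apply: Or33.
    by exists j; right.
  - by apply: tp_subbase_open; exists s => //; apply: Or31.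
  - by rewrite -openC; apply: tp_subbase_open; exists s => //; apply: Or32.
(* A word that is not a finite path does not index the subbase, but no terminal path starts with
   it. *)
suff -> : gen g = set0 by split; [exact: open0 | exact: closed0].
apply/seteqP; split=> // x; case: g gp => s [j|] /= /negP sp.
  by case=> /starts_with_path.
by move=> /starts_with_path.
Qed.

(** The subbase contains the complements of the generators too, so that neighbourhoods are
    controlled by agreement with [x] on finitely many generators. Neighbourhoods are used in this
    form only. *)
Lemma gen_nbhs x (W : set X) : nbhs x W ->
  exists s : seq (seq I * option I),
    forall y, (forall g, g \in s -> (gen g x <-> gen g y)) -> W y.
Proof.
rewrite nbhsE => -[U [Uo Ux] UW].
have [s [sx sU]] := subbase_finI Uo Ux.
suff [t ht] : exists t : seq (seq I * option I), forall y : X,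
    (forall g, g \in t -> (gen g x <-> gen g y)) -> forall V, V \in s -> V y.
  by exists t => y hy; apply/UW/sU; exact: ht.
elim: s sx {sU} => [|V s IH] sx; first by exists [::].
have [|t ht] := IH; first by move=> W' ws; apply: sx; rewrite in_cons ws orbT.
have [[w _ hw] Vx] := sx V (mem_head _ _).
have [g hg] : exists g, forall y, (gen g x <-> gen g y) -> V y.
  case: hw => [e|e|[j [] e]]; subst V.
  - by exists (w, None) => y [h _]; exact: h.
  - by exists (w, None) => y [_ h] /h.
  - by exists (w, Some j) => y [h _]; exact: h.
  - by exists (w, Some j) => y [_ h] /h.
exists (g :: t) => y hy V'; rewrite in_cons => /orP[/eqP ->|].
  by apply: hg; apply: hy; exact: mem_head.
by apply: ht => g' g't; apply: hy; rewrite in_cons g't orbT.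
Qed.

Lemma gen_continuous (T : topologicalType) (f : T -> X) x :
  (forall g, gen g (f x) -> \forall y \near x, gen g (f y)) ->
  (forall g, ~ gen g (f x) -> \forall y \near x, ~ gen g (f y)) ->
  {for x, continuous f}.
Proof.
move=> h1 h2 W /gen_nbhs[s hs].
have : nbhs x [set y | forall g, g \in s -> (gen g (f x) <-> gen g (f y))].
  apply: sat_seq => g _; have [gx|gx] := pselect (gen g (f x)).
    by apply: filterS (h1 g gx) => y.
  by apply: filterS (h2 g gx) => y; split.
by apply: filterS => y hy; exact: hs.
Qed.

(** Enumeration of the generators by natural numbers: their first [n] terms then define finer and
    finer finite partitions. A number that encodes nothing gives the trivial set. *)
Definition gen_at (n : nat) : set X :=
  if @choice.unpickle (seq I * option I)%type n is Some g then gen g else [set: X].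

Lemma gen_at_pickle g : gen_at (choice.pickle g) = gen g.
Proof. by rewrite /gen_at choice.pickleK. Qed.

(* The five conditions characterise the families [(gen g x)_g], [x : X]. *)
Record coherent (sg : seq I -> option I -> Prop) := Coherent {
  coh_nil : sg [::] None;
  coh_prefix : forall s i, sg (rcons s i) None -> sg s None;
  coh_uniq : forall s i j, sg (rcons s i) None -> sg (rcons s j) None -> i = j;
  coh_column : forall s i j, sg (rcons s i) None -> (sg s (Some j) <-> A j i);
  coh_last : forall s i, sg (rcons s i) None -> sg (rcons s i) (Some i);
  coh_at : forall s j, sg s (Some j) -> sg s None;
  coh_cluster : forall s (E F : {fset I}), sg s None ->
    (forall j, j \in E -> sg s (Some j)) ->
    (forall k, k \in F -> ~ sg s (Some k)) ->
    finite_set [set i | AEF A E F i != 0%N] -> exists i, sg (rcons s i) None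
}.

Section Realise.
Variables (sg : seq I -> option I -> Prop) (hs : coherent sg).

Lemma coh_take s n : sg s None -> sg (take n s) None.
Proof.
elim/last_ind: s => [//|s i IH] h; have [ns|sn] := leqP n (size s).
  by rewrite -cats1 takel_cat //; apply/IH/(coh_prefix hs h).
by rewrite take_oversize // size_rcons.
Qed.

Lemma coh_size_inj s t : sg s None -> sg t None -> size s = size t -> s = t.
Proof.
elim/last_ind: s t => [|s i IH] t; first by case: t.
case/lastP: t => [_ _|t j]; first by rewrite size_rcons.
rewrite !size_rcons => hi hj [e].
have est := IH t (coh_prefix hs hi) (coh_prefix hs hj) e; subst t.
by rewrite (coh_uniq hs hi hj).
Qed.

Lemma coh_rel s i j : sg (rcons (rcons s i) j) None -> A i j.
Proof.
by move=> h; have /(coh_column hs i h) := coh_last hs (coh_prefix hs h).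
Qed.

Lemma coh_path s : sg s None -> finite_path A s.
Proof.
elim/last_ind: s => [//|s j IH] h.
have := IH (coh_prefix hs h); case/lastP: s h {IH} => [//|s i] /coh_rel ij.
rewrite /finite_path; case: s => [|a s] /=; first by rewrite ij.
by rewrite !rcons_path last_rcons ij andbT.
Qed.

(** For a generator [(s, Some j)] two cases remain: no letter extends [s] and the set [J] decides,
    or a letter [i] extends it and the column of [i] decides. *)
Lemma realise_at (x : X) : (forall s, sg s None <-> starts_with s x) ->
  (forall s j, sg s None -> (forall i, ~ sg (rcons s i) None) ->
    (Iset (size s) x j <-> sg s (Some j))) ->
  (forall s i j, sg (rcons s i) None -> (Iset (size s) x j <-> A j i)) ->
  forall g, sg g.1 g.2 <-> gen g x.
Proof.
move=> h1 h2 h3 [s [j|]] /=; last exact: h1.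
rewrite /gen /Zset_at /=; split=> [hj|[/h1 hs0]].
  have hs0 := coh_at hs hj; split; first exact/h1.
  have [[i hi]|hn] := pselect (exists i, sg (rcons s i) None).
    by apply/(h3 _ _ j hi)/(coh_column hs j hi).
  by apply/h2 => // i hi; apply: hn; exists i.
have [[i hi]|hn] := pselect (exists i, sg (rcons s i) None).
  by move=> /(h3 _ _ j hi)/(coh_column hs j hi).
by move=> /h2; apply=> // i hi; apply: hn; exists i.
Qed.

(** The longest word [s] of the family ends a finite terminal path, with [J] the set of the [j] that
    the family accepts at [s]. Were [J] not a cluster point, finite sets [E] and [F] would leave
    finitely many [i], and [coh_cluster] would extend [s]. *)
Lemma realise_finite s : sg s None -> (forall i, ~ sg (rcons s i) None) ->
  exists x : X, forall g, sg g.1 g.2 <-> gen g x.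
Proof.
move=> h hn; pose J := [set j | sg s (Some j)].
have tJ : terminal A (FinitePath s J).
  split; first exact: coh_path.
    move=> E F EJ FJ fin.
    have [|||i] := @coh_cluster _ hs s E F h; last exact: hn.
    - by move=> j /EJ.
    - by move=> k /FJ.
    apply: sub_finite_set fin => i /=; rewrite AEF_E; case: andP => // -[hE hF] _.
    split=> [j jE|]; first exact: (allP hE).
    by rewrite -subset0 => k [kF]; apply/negP; exact: (allP hF).
  case/lastP: s @J h hn => [//|s i] J h _.
  by case: s @J h => [|a s] J h /=; rewrite ?last_rcons; exact: (coh_last hs h).
have ht t : sg t None -> (size t <= size s)%N /\ t = take (size t) s.
  move=> tn; have [ts|st] := leqP (size t) (size s).
    split=> //; apply: coh_size_inj => //; first exact: coh_take.
    by rewrite size_takel.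
  have es : take (size s) t = s.
    by apply: coh_size_inj; rewrite ?size_takel 1?ltnW //; exact: coh_take.
  have [a ea] := onth_some st.
  case: (hn a); have := coh_take (size s).+1 tn.
  by rewrite (take_nth a) // es; move: ea; rewrite (onth_lt a) // => -[->].
have hext t i : sg (rcons t i) None -> onth s (size t) = Some i.
  by move=> /ht[ts] e; rewrite -(cat_take_drop (size (rcons t i)) s) -e
    onth_cat size_rcons ltnSn -cats1 onth_cat ltnn subnn.
exists (TerminalPath tJ); apply: realise_at => [t|t j tn tmax|t i j tin].
- split=> [/ht[ts e] k kt|ht'].
    by rewrite /entry /= -(cat_take_drop (size t) s) -e onth_cat kt.
  have [ts|st] := leqP (size t) (size s).
    suff -> : t = take (size t) s by exact: coh_take.
    apply/eq_from_onth => k; have [kt|tk] := ltnP k (size t).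
      rewrite -ht' // /entry /= -{1}(cat_take_drop (size t) s) onth_cat.
      by rewrite size_takel // kt.
    by rewrite !onth_default // size_takel.
  have := ht' _ st; rewrite /entry /= onth_default //.
  by have [a ->] := onth_some st.
- have [ts e] := ht t tn; have {ts} : (size t == size s) || (size t < size s)%N.
    by rewrite -leq_eqVlt.
  case/orP=> [/eqP ts|ts].
    by rewrite /Iset /= ts onth_default // e ts take_size.
  have [a ea] := onth_some ts; case: (tmax a).
  have := coh_take (size t).+1 h.
  by rewrite (take_nth a) // -e; move: ea; rewrite (onth_lt a) // => -[->].
- by rewrite /Iset /= (hext _ _ tin).
Qed.

(** Letters are chosen one at a time; by [coh_size_inj] the words of the family are exactly the
    prefixes of the resulting sequence. *)
Lemma realise_infinite :
  (forall s, sg s None -> exists i, sg (rcons s i) None) ->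
  exists x : X, forall g, sg g.1 g.2 <-> gen g x.
Proof.
move=> hex; pose next (s : {s | sg s None}) : {s | sg s None} :=
  let: exist i hi := cid (hex (sval s) (svalP s)) in exist _ (rcons (sval s) i) hi.
pose w k := iter k next (exist _ [::] (coh_nil hs)).
pose f k := sval (cid (hex (sval (w k)) (svalP (w k)))).
have wE k : sval (w k) = mkseq f k.
  elim: k => [//|k IH]; rewrite mkseqS -IH [LHS]/= /next /f.
  by rewrite -/(w k); case: (cid _).
have sgf k : sg (mkseq f k) None by rewrite -wE; exact: (svalP (w k)).
have ht t : sg t None -> t = mkseq f (size t).
  by move=> tn; apply: coh_size_inj => //; rewrite size_mkseq.
have tf : terminal A (InfinitePath f).
  by move=> k; have := sgf k.+2; rewrite !mkseqS => /coh_rel.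
have fE k t : (k < t)%N -> onth (mkseq f t) k = Some (f k).
  by move=> kt; rewrite (onth_lt (f k)) ?size_mkseq // nth_mkseq.
exists (TerminalPath tf); apply: realise_at => [t|t j tn tmax|t i j tin].
- split=> [/ht e k kt|ht']; first by rewrite e fE // -{2}e.
  suff -> : t = mkseq f (size t) by [].
  apply/eq_from_onth => k; have [kt|tk] := ltnP k (size t).
    by rewrite -ht' // fE.
  by rewrite !onth_default // size_mkseq.
- by case: (tmax (f (size t))); rewrite {1}(ht t tn) -mkseqS.
- rewrite /Iset /=; have := ht _ tin; rewrite size_rcons mkseqS.
  by move=> /rcons_inj[_ ->].
Qed.

Lemma realise : exists x : X, forall g, sg g.1 g.2 <-> gen g x.
Proof.
have [[s [h hn]]|hn] :=
    pselect (exists s, sg s None /\ forall i, ~ sg (rcons s i) None).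
  exact: realise_finite h hn.
apply: realise_infinite => s h; apply: contrapT => hi; apply: hn.
by exists s; split=> // i si; apply: hi; exists i.
Qed.

End Realise.
End TerminalPathTopology.

(** * Compactness of the path space; adding and removing a first letter *)

Section TerminalPathSpace.
Variables (I : countType) (A : rel I).
Local Notation X := (terminalPath A).
Implicit Types (x y z : X) (s t : seq I).

Lemma starts_with_rcons s i x :
  starts_with (rcons s i) x <-> starts_with s x /\ entry x (size s) = Some i.
Proof.
split=> [h|[h1 h2] k].
  split=> [k ks|]; last first.
    by rewrite h ?size_rcons // -cats1 onth_cat ltnn subnn.
  by rewrite h ?size_rcons 1?ltnW // -cats1 onth_cat ks.
rewrite size_rcons ltnS leq_eqVlt -cats1 onth_cat => /orP[/eqP ->|ks].
  by rewrite ltnn subnn h2.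
by rewrite ks h1.
Qed.

Lemma starts_with_cons s i x :
  starts_with (i :: s) x <-> entry x 0 = Some i /\
    forall k, (k < size s)%N -> entry x k.+1 = onth s k.
Proof.
split=> [h|[h1 h2] [|k]] //=; last exact: h2.
by split=> [|k ks]; [exact: (h 0) | exact: (h k.+1)].
Qed.

Lemma Iset_entry x r i : entry x r = Some i -> Iset r x = column A i.
Proof. by case: x => -[f|s J] h; rewrite /entry /Iset /=; [case=> -> | move=> ->]. Qed.

(** Inside a path this is the transition condition; at its end it is the requirement that the last
    letter belong to [J]. *)
Lemma Iset_next x r i : entry x r = Some i -> Iset r.+1 x i.
Proof.
move=> hi; case e : (entry x r.+1) => [j|].
  by rewrite (Iset_entry e); exact: entry_path hi e.
case: x hi e => -[f|s J] h; rewrite /entry /Iset //= => hi e.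
rewrite e; case: h => _ _.
case: s hi e => [|a s] hi e; first by move: hi; rewrite onth0n.
have /eqP rs : r == size s.
  rewrite eqn_leq -[(r <= _)%N]ltnS; have := onthTE (a :: s) r; rewrite hi => <-.
  by have := onthNE s r; rewrite e => <-.
move: hi; rewrite rs (onth_lt a) // -[size s]/((size (a :: s)).-1) nth_last.
by move=> -[->].
Qed.

Lemma coherent_at x : coherent A (fun s o => gen (s, o) x).
Proof.
split=> //=.
- by move=> s i /starts_with_rcons[].
- by move=> s i j /starts_with_rcons[_ e] /starts_with_rcons[_]; rewrite e => -[].
- move=> s i j /starts_with_rcons[sx e].
  by rewrite /gen /= /Zset_at /= (Iset_entry e); split=> [[]|].
- move=> s i h; split=> //; rewrite /= size_rcons; apply: Iset_next.
  by case/starts_with_rcons: h.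
- by move=> s j [].
move=> s E F sx hE hF fin.
case e : (entry x (size s)) => [i|].
  by exists i; apply/starts_with_rcons.
(* Now [x] stops right after [s]. Its [J] contains [E], avoids [F] and is a cluster point, which
   makes the set in [fin] infinite. *)
exfalso; case: x e sx hE hF => -[f|t J] h; rewrite /entry //= => e sx hE hF.
have [_ cJ _] := h; apply: (cJ E F).
- by move=> j /hE[_]; rewrite /Iset /= e.
- by move=> k /hF hk Jk; apply: hk; split; rewrite // /Iset /= e.
apply: sub_finite_set fin => i /= [hE' hF']; rewrite AEF_E.
suff -> : all (fun j => A j i) E && all (fun k => ~~ A k i) F by [].
apply/andP; split; apply/allP => k kE; first exact: hE'.
by apply/negP => Aki; have : set0 k by rewrite -hF'.
Qed.

(** The generators that belong to an ultrafilter form a coherent family, and the path realising that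
    family is a limit. *)
Lemma terminalPath_compact : compact [set: X].
Proof.
rewrite compact_ultra => U UU _; pose sg s o := U (gen (A := A) (s, o)).
have Une W : U W -> W !=set0 by apply: filter_ex.
have Uc W : ~ U W -> U (~` W) by have [] := in_ultra_setVsetC W UU.
have csg : coherent A sg.
  split.
  - by apply: filterS filterT => x _; exact: coh_nil (coherent_at x).
  - by move=> s i; apply: filterS => x; apply: (coh_prefix (coherent_at x)).
  - move=> s i j hi hj; have [x [xi xj]] := Une _ (filterI hi hj).
    by apply: (@coh_uniq _ _ _ (coherent_at x) s).
  - move=> s i j hi; split=> [hj|ji].
      have [x [xi xj]] := Une _ (filterI hi hj).
      exact/(coh_column (coherent_at x) j xi).
    by apply: filterS hi => x xi; exact/(coh_column (coherent_at x) j xi).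
  - by move=> s i; apply: filterS => x; apply: (coh_last (coherent_at x)).
  - by move=> s j; apply: filterS => x; apply: (coh_at (coherent_at x)).
  move=> s E F hs hE hF fin; apply: contrapT => hn.
  (* If [U] contains no one-letter extension of [s], it contains the intersection of the complements
     of the finitely many that [fin] concerns; a point of it that satisfies [E] and [F] contradicts
     [coherent_at]. *)
  have hS : U [set x | forall i, i \in fset_set [set i | AEF A E F i != 0%N] ->
                       ~ gen (rcons s i, None) x].
    by apply: sat_seq => i _; apply: Uc => hi; apply: hn; exists i.
  have hE' : U [set x | forall j, j \in E -> gen (s, Some j) x] by exact: sat_seq.
  have hF' : U [set x | forall k, k \in F -> ~ gen (s, Some k) x].
    by apply: sat_seq => k /hF/Uc.
  have [x [[[xs xE] xF] xS]] :=
    Une _ (filterI (filterI (filterI hs hE') hF') hS).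
  have [i xi] := coh_cluster (coherent_at x) xs xE xF fin.
  apply: (xS i) (xi); rewrite in_fset_set // inE /= AEF_E eqb0 negbK.
  apply/andP; split; apply/allP => k kE.
    exact/(coh_column (coherent_at x) k xi)/xE.
  apply/negP => /(coh_column (coherent_at x) k xi); exact: xF.
have [x hx] := realise csg; exists x; split=> // W /gen_nbhs[s hs].
apply: (filterS (P := [set y | forall g, g \in s -> (gen g x <-> gen g y)])).
  by move=> y hy; exact: hs.
apply: sat_seq => -[w o] _; have [gx|gx] := pselect (gen (w, o) x).
  by have := (hx (w, o)).2 gx; apply: filterS => y.
have /Uc : ~ U (gen (w, o)) by move=> /(hx (w, o)).1.
by apply: filterS => y ny; split=> // /ny.
Qed.

Lemma continuous_gen (T : topologicalType) (f : T -> X) :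
  (forall g, clopen (f @^-1` gen g)) -> continuous f.
Proof.
move=> h x; apply: gen_continuous => g gx.
  by have [go _] := h g; exact: (open_nbhs_nbhs (A := f @^-1` gen g)).
by have [_ /closed_openC go] := h g; exact: (open_nbhs_nbhs (A := ~` (f @^-1` gen g))).
Qed.

Lemma clopen_if (T : topologicalType) (D P Q : set T) : clopen D -> clopen P ->
  clopen Q -> clopen [set x | (D x /\ P x) \/ (~ D x /\ Q x)].
Proof.
move=> hD hP hQ.
have -> : [set x | D x /\ P x \/ ~ D x /\ Q x] = D `&` P `|` ~` D `&` Q by [].
by apply: clopenU; apply: clopenI => //; exact: clopenC.
Qed.

Definition precons i (p : prepath I) : prepath I :=
  match p with
  | InfinitePath f => InfinitePath (fun k => if k is k'.+1 then f k' else i)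
  | FinitePath s J => FinitePath (i :: s) J
  end.

Lemma precons_terminal i x : Iset 0 x i -> terminal A (precons i x).
Proof.
case: x => -[f|s J] h /=; rewrite /Iset /=; first by move=> hi [|k] //=.
case: h => sp cJ; case: s sp => [|a s] //= sp Ja ai; split=> //.
by rewrite /finite_path /= ai.
Qed.

(** Made total by the identity outside the clopen set of the paths that [i] may precede; this keeps
    it continuous on the whole space. *)
Definition cons_path i x : X :=
  if pselect (Iset 0 x i) is left h then TerminalPath (precons_terminal h) else x.

(** The paths that [i] may precede: the source of the bisection [S_i], hence the support of
    [Q_i]. *)
Definition source i : set X := [set x | Iset 0 x i].

Lemma cons_pathE i x : source i x -> cons_path i x = precons i x :> prepath I.
Proof. by move=> h; rewrite /cons_path; case: pselect. Qed.

Lemma cons_path_out i x : ~ source i x -> cons_path i x = x.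
Proof. by rewrite /cons_path; case: pselect. Qed.

Lemma entry_cons0 i x : source i x -> entry (cons_path i x) 0 = Some i.
Proof. by move=> h; rewrite /entry cons_pathE //; case: (tpath x). Qed.

Lemma entry_consS i x k : source i x -> entry (cons_path i x) k.+1 = entry x k.
Proof. by move=> h; rewrite /entry cons_pathE //; case: (tpath x). Qed.

Lemma Iset_consS i x k : source i x -> Iset k.+1 (cons_path i x) = Iset k x.
Proof. by move=> h; rewrite /Iset cons_pathE //; case: (tpath x). Qed.

Lemma gen_cons i x j s o : source i x ->
  gen (j :: s, o) (cons_path i x) <-> i = j /\ gen (s, o) x.
Proof.
move=> h.
have e : starts_with (j :: s) (cons_path i x) <-> i = j /\ starts_with s x.
  rewrite starts_with_cons entry_cons0 //; split=> [[[ij] h2]|[ij h2]]; subst j.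
    by split=> // k ks; rewrite -h2 // entry_consS.
  by split=> // k ks; rewrite entry_consS // h2.
case: o => [k|] //; rewrite /gen /= /Zset_at /= Iset_consS //.
by split=> [[h1 h2]|[ij [h1 h2]]]; [case/e: h1 | split=> //; apply/e].
Qed.

Lemma path_shift_cons i x : source i x -> path_shift A (cons_path i x) = Some x.
Proof.
move=> h; rewrite /path_shift entry_cons0 //; congr Some.
by apply: terminalPath_inj => /=; rewrite cons_pathE //; case: (tpath x).
Qed.

Lemma path_shift_some x i : entry x 0 = Some i ->
  exists2 y, path_shift A x = Some y & source i y /\ x = cons_path i y.
Proof.
move=> h; rewrite /path_shift h; eexists; first by [].
set y := TerminalPath _.
have hy : source i y.
  have := Iset_next h; rewrite /source /= /Iset /y /=.
  by case: (tpath x) => [//|[|a s]].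
split=> //; apply: terminalPath_inj; rewrite cons_pathE // /y /=.
case: x h {y hy} => -[f|[|a s] J] // h; rewrite /entry /= => -[<-] //.
by congr InfinitePath; apply/funext => -[].
Qed.

Lemma source_gen i : source i = gen ([::], Some i).
Proof. by apply/seteqP; split=> x => [h|[]//]; split. Qed.

Lemma source_clopen i : clopen (source i).
Proof. by rewrite source_gen; exact: gen_clopen. Qed.

Definition tail x : X := odflt x (path_shift A x).

Lemma tail_cons i x : source i x -> tail (cons_path i x) = x.
Proof. by move=> h; rewrite /tail path_shift_cons. Qed.

Lemma cons_path_cases x i : starts_with [:: i] x ->
  source i (tail x) /\ x = cons_path i (tail x).
Proof.
move=> /starts_with_cons[/path_shift_some[y e [h ->]] _].
by rewrite tail_cons.
Qed.

Lemma starts_with_cons_path i x : source i x -> starts_with [:: i] (cons_path i x).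
Proof. by move=> h; apply/starts_with_cons; rewrite entry_cons0. Qed.

Lemma cons_path_continuous i : continuous (cons_path i).
Proof.
apply: continuous_gen => -[s o].
pose P : set X := if s is j :: s' then [set x | i = j /\ gen (s', o) x]
  else [set x | if o is Some j then A j i else true].
have cb (T : topologicalType) (Q : Prop) : clopen [set _ : T | Q].
  have [q|q] := pselect Q.
    have -> : [set _ : T | Q] = setT by apply/seteqP; split.
    by split; [exact: openT|exact: closedT].
  have -> : [set _ : T | Q] = set0 by apply/seteqP; split.
  by split; [exact: open0|exact: closed0].
have hP : clopen P.
  rewrite /P {P}; case: s => [|j s]; first exact: cb.
  by apply: clopenI; [exact: cb | exact: gen_clopen].
suff -> : cons_path i @^-1` gen (s, o) =
    [set x | (source i x /\ P x) \/ (~ source i x /\ gen (s, o) x)].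
  by apply: clopen_if => //; [exact: source_clopen | exact: gen_clopen].
have e x : source i x -> gen (s, o) (cons_path i x) <-> P x.
  move=> h; rewrite /P {P hP}; case: s => [|j s]; last exact: gen_cons.
  case: o => [j|] //; rewrite /gen /= /Zset_at /= (Iset_entry (entry_cons0 h)).
  by split=> [[]|].
apply/seteqP; split=> x; have [h|h] := pselect (source i x).
- by move=> /(e x h); left.
- by rewrite /preimage /= cons_path_out //; right.
- by case=> -[//] _ /(e x h).
- by case=> -[//] _ h'; rewrite /preimage /= cons_path_out.
Qed.

(** The domain of the shift is open but in general not closed, whereas each cylinder on one letter
    is clopen; fixing the letter gives a map continuous everywhere. *)
Definition tail_at i x : X := if pselect (starts_with [:: i] x) then tail x else x.

Lemma gen_tail i x s o : starts_with [:: i] x ->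
  gen (s, o) (tail x) <-> gen (i :: s, o) x.
Proof.
move=> /cons_path_cases[h e]; rewrite [in X in _ <-> X]e.
by rewrite gen_cons //; split=> [|[]].
Qed.

Lemma tail_at_continuous i : continuous (tail_at i).
Proof.
apply: continuous_gen => -[s o].
suff -> : tail_at i @^-1` gen (s, o) = [set x |
    (starts_with [:: i] x /\ gen (i :: s, o) x) \/
    (~ starts_with [:: i] x /\ gen (s, o) x)].
  apply: (@clopen_if _ (gen ([:: i], None))); exact: gen_clopen.
apply/seteqP; split=> x; rewrite /preimage /= /tail_at; case: pselect => h.
- by move=> /(gen_tail s o h); left.
- by right.
- by case=> -[//] _ /(gen_tail s o h).
- by case=> -[//].
Qed.

Section ContinuousFunctions.
Variable R : realType.
Local Notation C := (Cplx R).
Implicit Types f h : X -> C.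

Definition restr (D : set X) h : X -> C :=
  fun x => if pselect (D x) then h x else 0.

Lemma restr_in D h x : D x -> restr D h x = h x.
Proof. by rewrite /restr; case: pselect. Qed.
Lemma restr_out D h x : ~ D x -> restr D h x = 0.
Proof. by rewrite /restr; case: pselect. Qed.

Lemma restr_continuous D h : clopen D -> continuous h -> continuous (restr D h).
Proof.
move=> [Do Dc] hc x; rewrite /continuous_at.
have [Dx|nDx] := pselect (D x).
  have nD : \forall y \near x, D y by exact: open_nbhs_nbhs.
  rewrite restr_in // => W hW; apply: filterS (filterI nD (hc x W hW)).
  by move=> y [Dy] /=; rewrite restr_in.
have nD : \forall y \near x, (~` D) y.
  by apply: open_nbhs_nbhs; split=> //; exact: closed_openC.
rewrite restr_out // => W hW; apply: filterS nD => y Dy /=.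
by rewrite restr_out //; exact: nbhs_singleton.
Qed.

(** In operator terms, [h u_i = u_i (pull i h)] and [push i h = u_i h u_i^*]. *)
Definition pull i h : X -> C := restr (source i) (h \o cons_path i).
Definition push i h : X -> C := restr (Zset [:: i]) (h \o tail).

Lemma pull_continuous i h : continuous h -> continuous (pull i h).
Proof.
move=> hc; apply: restr_continuous; first exact: source_clopen.
by move=> x; apply: continuous_comp; [exact: cons_path_continuous|exact: hc].
Qed.

Lemma push_continuous i h : continuous h -> continuous (push i h).
Proof.
move=> hc; have -> : push i h = restr (Zset [:: i]) (h \o tail_at i).
  apply/funext => x; rewrite /push /restr; case: pselect => // hx.
  by rewrite /= /tail_at; case: pselect.
apply: restr_continuous; first exact: (@gen_clopen I A ([:: i], None)).
by move=> x; apply: continuous_comp; [exact: tail_at_continuous|exact: hc].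
Qed.

End ContinuousFunctions.

End TerminalPathSpace.

(** * Uniform oscillation and approximation by step functions *)

Section UniformOscillation.
Variables (R : realType) (X : Type) (G : nat -> set X).
Local Notation C := (Cplx R).
Implicit Types (f g : X -> C) (x y : X).

Definition cls n x : set X := [set y | forall k, (k < n)%N -> (G k x <-> G k y)].

Lemma cls_eq n x y : cls n x y -> cls n x = cls n y.
Proof.
move=> h; apply/seteqP; split=> z hz k kn; have e := h k kn; have e' := hz k kn.
  by rewrite -e.
by rewrite e.
Qed.
Lemma cls_sym n x y : cls n x y -> cls n y x.
Proof. by move=> h k kn; rewrite h. Qed.

(** The sample point depends on [V] and not on [f]. Evaluation is therefore compatible with sums,
    products and conjugation, and the Riemann sums built on it are exactly multiplicative. *)
Definition val_at f (V : set X) : C :=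
  if pselect (exists x, V x) is left h then f (sval (cid h)) else 0.

Lemma val_atP V : V !=set0 -> exists2 x, V x & forall f, val_at f V = f x.
Proof.
move=> V0; rewrite /val_at; case: pselect => // h.
by exists (sval (cid h)) => //; exact: (svalP (cid h)).
Qed.

Lemma val_at_cases V :
  (exists x, forall f, val_at f V = f x) \/ (forall f, val_at f V = 0).
Proof.
have [/val_atP[x _ e]|h] := pselect (V !=set0); first by left; exists x.
by right => f; rewrite /val_at; case: pselect.
Qed.

(** Uniform continuity with respect to the partitions generated by the sets [G k]. *)
Definition uosc f := forall e : R, 0 < e ->
  exists n, forall x y, cls n x y -> nrm (f y - f x) <= e.

Lemma uosc_step f e : uosc f -> 0 < e ->
  exists n, forall x, nrm (f x - val_at f (cls n x)) <= e.
Proof.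
move=> hf /hf[n hn]; exists n => x.
have [|y xy ->] := @val_atP (cls n x); first by exists x.
by rewrite nrm_distC; exact: hn.
Qed.

Section Induction.
Variable P : (X -> C) -> Prop.
Hypothesis Pcst : forall a, P (fun => a).
Hypothesis PG : forall k, P (fun x => (x \in G k)%:R).
Hypothesis PD : forall f g, P f -> P g -> P (fun x => f x + g x).
Hypothesis PM : forall f g, P f -> P g -> P (fun x => f x * g x).

Lemma step_ind n f : (forall x y, cls n x y -> f x = f y) -> P f.
Proof.
elim: n f => [|n IH] f hf.
  have [[x0 _]|hX] := pselect (exists x0 : X, True).
    have -> : f = fun=> f x0 by apply/funext => x; exact: hf.
    exact: Pcst.
  have -> : f = fun=> 0 by apply/funext => x; case: hX; exists x.
  exact: Pcst.
(* [p b] samples [f] on the part of the class of [x] where [G n] has the truth value [b]; it depends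
   only on the class of level [n], so that the induction hypothesis applies. *)
pose p b x := val_at f (cls n x `&` [set y | G n y <-> b]).
have hp b : P (p b).
  by apply: IH => x y xy; rewrite /p (cls_eq xy).
(* The complement of [G n] is written with [1 + -1 * _] because [P] is closed under constants, sums
   and products only. *)
have -> : f = fun x => (x \in G n)%:R * p True x + (1 + -1 * (x \in G n)%:R) * p False x.
  apply/funext => x.
  have hb b : (G n x <-> b) -> p b x = f x.
    move=> e; rewrite /p; have [|y [xy yb] ->] := @val_atP (cls n x `&` [set y | G n y <-> b]).
      by exists x.
    apply: hf; apply: cls_sym => k; rewrite ltnS leq_eqVlt => /orP[/eqP ->|].
      by split=> [h|h]; [exact: (yb.2 (e.1 h)) | exact: (e.2 (yb.1 h))].
    exact: xy.
  case: (boolP (x \in G n)) => [|] xG.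
    rewrite mul1r mulN1r subrr mul0r addr0 hb //; split=> // _.
    by move: xG; rewrite inE.
  rewrite mul0r add0r mulr0 addr0 mul1r hb //; split=> //.
  by move=> Gx; case/negP: xG; rewrite inE.
by apply: PD; apply: PM => //; apply: PD => //; apply: PM.
Qed.

Lemma uosc_approx f : uosc f -> forall e : R, 0 < e ->
  exists2 g, P g & forall x, nrm (f x - g x) <= e.
Proof.
move=> hf e e0; have [n hn] := uosc_step hf e0.
exists (fun x => val_at f (cls n x)) => //.
by apply: (@step_ind n) => x y xy; rewrite (cls_eq xy).
Qed.

End Induction.
End UniformOscillation.

(** Around each point finitely many generators control [f] up to [e / 2]; compactness provides one
    [n] beyond the codes of all those that are used. *)
Lemma continuous_uosc (R : realType) (I : countType) (A : rel I)
    (f : terminalPath A -> Cplx R) : continuous f -> uosc (@gen_at I A) f.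
Proof.
move=> fc e e0.
have nc := (compact_near_coveringP _).1 (@terminalPath_compact I A).
pose P n (x : terminalPath A) := forall y, cls (@gen_at I A) n x y ->
  nrm (f y - f x) <= e.
suff : \forall n \near \oo, [set: terminalPath A] `<=` P n.
  by case=> n _ hn; exists n => x y; apply: (hn n) => //=.
apply: nc => x _.
have e2 : 0 < e / 2 by rewrite divr_gt0.
have /continuous_nrmP/(_ _ e2) := fc x.
move=> /gen_nbhs[s hs].
(* Beyond every code of a generator of [s], so that points in one class of level [N] agree on
   [s]. *)
pose N := (\max_(g <- s) (choice.pickle g).+1)%N.
exists ([set y | forall g, g \in s -> (gen g x <-> gen g y)], [set n | (N <= n)%N]).
  split=> /=; last by exists N.
  apply: sat_seq => g _; have [go /closed_openC gc] := @gen_clopen I A g.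
  have [gx|gx] := pselect (gen g x).
    by apply: filterS (open_nbhs_nbhs (conj go gx)) => y.
  by apply: filterS (open_nbhs_nbhs (conj gc gx)) => y ny; split.
move=> [x' n] /= [hx' Nn] y x'y.
have xy g : g \in s -> (gen g x <-> gen g y).
  move=> gs; rewrite hx' // -!(gen_at_pickle A g); apply: x'y.
  apply: leq_trans Nn; rewrite /N (big_rem g gs) /=; exact: leq_maxl.
apply: (le_trans (nrm_dist (f x) _ _)); rewrite [e]splitr lerD //.
  by apply/ltW/hs.
by rewrite nrm_distC; apply/ltW/hs.
Qed.

(** A Stone-Weierstrass theorem in the form of an induction principle. [P] is not asked to be closed
    under limits: the conclusion only provides a close [g] that satisfies it. *)
Lemma continuous_approx (R : realType) (I : countType) (A : rel I)
    (P : (terminalPath A -> Cplx R) -> Prop) :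
  (forall a, P (fun=> a)) -> (forall g, P (fun x => (x \in @gen I A g)%:R)) ->
  (forall f g, P f -> P g -> P (fun x => f x + g x)) ->
  (forall f g, P f -> P g -> P (fun x => f x * g x)) ->
  forall f, continuous f -> forall e : R, 0 < e ->
  exists2 g, P g & forall x, nrm (f x - g x) <= e.
Proof.
move=> Pcst Pgen PD PM f /continuous_uosc; apply: uosc_approx => // k.
rewrite /gen_at; case: (choice.unpickle k) => [g|]; first exact: Pgen.
have -> : (fun x : terminalPath A => (x \in [set: terminalPath A])%:R : Cplx R) =
    fun=> 1 by apply/funext => x; rewrite in_setT.
exact: Pcst.
Qed.

(** * Functional calculus for a sequence of commuting projections *)

Section FunctionalCalculus.
Variables (R : realType) (X : Type) (G : nat -> set X) (H : hilbertSpace R).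
Local Notation C := (Cplx R).
Variable E : nat -> bop H.
Hypothesis E_idem : forall k, E k * E k = E k.
Hypothesis E_adj : forall k, adjoint (E k) = E k.
Hypothesis E_comm : forall j k, E j * E k = E k * E j.

Fixpoint sign_prod (b : nat -> bool) n : bop H :=
  if n is m.+1 then sign_prod b m * (if b m then E m else 1 - E m) else 1.

(** A pattern of signs realised by no point must give the operator [0]: an empty atom carries no
    projection, and functions can be sent to operators. *)
Hypothesis E_support : forall b n, sign_prod b n != 0 ->
  exists x, forall k, (k < n)%N -> (G k x <-> b k).

Implicit Types (f g : X -> C) (S T : bop H) (v : H).

(** Sets and projections are refined in parallel. Empty sets stay in the list; their projections
    vanish by [atoms_zero]. *)
Fixpoint atoms n : seq (set X * bop H) :=
  if n is m.+1 then
    [seq (a.1 `&` G m, a.2 * E m) | a <- atoms m] ++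
    [seq (a.1 `&` ~` G m, a.2 * (1 - E m)) | a <- atoms m]
  else [:: (setT, 1)].

Lemma atomsS n a : a \in atoms n.+1 -> exists2 a', a' \in atoms n &
  a = (a'.1 `&` G n, a'.2 * E n) \/ a = (a'.1 `&` ~` G n, a'.2 * (1 - E n)).
Proof.
by rewrite mem_cat => /orP[] /mapP[a' ha ->]; exists a' => //; [left | right].
Qed.

Lemma big_atomsS n (W : nmodType) (F : set X * bop H -> W) :
  \sum_(a <- atoms n.+1) F a = \sum_(a <- atoms n)
    (F (a.1 `&` G n, a.2 * E n) + F (a.1 `&` ~` G n, a.2 * (1 - E n))).
Proof. by rewrite big_split /= big_cat /= !big_map. Qed.

Lemma E_mulB k : E k * (1 - E k) = 0.
Proof. by rewrite mulrBr mulr1 E_idem subrr. Qed.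
Lemma E_Bmul k : (1 - E k) * E k = 0.
Proof. by rewrite mulrBl mul1r E_idem subrr. Qed.
Lemma EB_idem k : (1 - E k) * (1 - E k) = 1 - E k.
Proof. by rewrite mulrBl mul1r E_mulB subr0. Qed.
Lemma EB_adj k : adjoint (1 - E k) = 1 - E k.
Proof. by rewrite adjointB adjoint1 E_adj. Qed.
Lemma EB_comm j k : E j * (1 - E k) = (1 - E k) * E j.
Proof. by rewrite mulrBr mulrBl mul1r mulr1 E_comm. Qed.

Lemma atoms_proj n a : a \in atoms n ->
  [/\ adjoint a.2 = a.2, a.2 * a.2 = a.2 & forall k, E k * a.2 = a.2 * E k].
Proof.
elim: n a => [|n IH] a.
  rewrite inE => /eqP ->; split=> /= [||k]; last by rewrite mulr1 mul1r.
    exact: adjoint1.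
  by rewrite mulr1.
case/atomsS => a' /IH[h1 h2 h3] [] -> /=; split=> [||k].
- by rewrite adjointM h1 E_adj h3.
- by rewrite -mulrA (mulrA (E n)) h3 -mulrA E_idem mulrA h2.
- by rewrite mulrA h3 -!mulrA E_comm.
- by rewrite adjointM h1 EB_adj mulrBl mulrBr mul1r mulr1 h3.
- have h4 : (1 - E n) * a'.2 = a'.2 * (1 - E n).
    by rewrite mulrBl mulrBr mul1r mulr1 h3.
  by rewrite -mulrA (mulrA (1 - E n)) h4 -mulrA EB_idem mulrA h2.
- by rewrite mulrA h3 -!mulrA EB_comm.
Qed.

Lemma atoms_sum n : \sum_(a <- atoms n) a.2 = 1.
Proof.
elim: n => [|n IH]; first by rewrite big_seq1.
rewrite big_atomsS -[RHS]IH; apply: eq_bigr => a _ /=.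
by rewrite -mulrDr addrC subrK mulr1.
Qed.

Lemma mul_mid (P Q S T : bop H) : Q * S = S * Q ->
  (P * Q) * (S * T) = P * S * (Q * T).
Proof. by move=> e; rewrite -!mulrA (mulrA Q) e -!mulrA. Qed.

(** Mutual orthogonality of the atoms. Arbitrary coefficients avoid comparing two members of the
    list, which may have repeated entries such as [(set0, 0)]. *)
Lemma atoms_orth n (c : set X * bop H -> C) b : b \in atoms n ->
  (\sum_(a <- atoms n) c a *: a.2) * b.2 = c b *: b.2.
Proof.
elim: n c b => [|n IH] c b.
  by rewrite inE => /eqP -> /=; rewrite big_seq1 /= mulr1.
case/atomsS => b' hb e; have [_ _ h3] := atoms_proj hb.
have h4 : (1 - E n) * b'.2 = b'.2 * (1 - E n).
  by rewrite mulrBl mulrBr mul1r mulr1 h3.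
rewrite big_atomsS mulr_suml; case: e => -> /=.
  rewrite -bop_scaleAl -(IH (fun a => c (a.1 `&` G n, a.2 * E n))) //.
  rewrite !mulr_suml; apply: eq_bigr => a _.
  rewrite mulrDl !bop_scaleAl (mul_mid a.2 (E n) (h3 n)) (mul_mid a.2 (E n) h4).
  by rewrite E_Bmul E_idem mulr0 scaler0 addr0.
rewrite -bop_scaleAl -(IH (fun a => c (a.1 `&` ~` G n, a.2 * (1 - E n)))) //.
rewrite !mulr_suml; apply: eq_bigr => a _.
rewrite mulrDl !bop_scaleAl (mul_mid a.2 (1 - E n) (h3 n)).
by rewrite (mul_mid a.2 (1 - E n) h4) E_mulB EB_idem mulr0 scaler0 add0r.
Qed.

Lemma atoms_nonempty n a : a \in atoms n -> a.2 != 0 -> a.1 !=set0.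
Proof.
(* Each atom comes from a pattern [b] of [n] signs, to which [E_support] applies; [up] below
   prolongs a pattern by one sign. *)
move=> an; have [b e] : exists b : nat -> bool,
    a = ([set x | forall k, (k < n)%N -> (G k x <-> b k)], sign_prod b n).
  elim: n a an => [|n IH] a.
    rewrite inE => /eqP ->; exists (fun=> true) => /=; congr pair.
    by apply/seteqP; split.
  have up (b : nat -> bool) (c : bool) : exists b',
      sign_prod b' n = sign_prod b n /\ b' n = c /\
      forall k, (k < n)%N -> b' k = b k.
    exists (fun k => if k == n then c else b k); split; last first.
      by split=> [|k kn]; [rewrite eqxx | rewrite ltn_eqF].
    have h m : (m <= n)%N -> sign_prod (fun k => if k == n then c else b k) m =
        sign_prod b m.
      by elim: m => [//|m IHm] mn /=; rewrite IHm 1?ltnW // ltn_eqF.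
    exact: h.
  case/atomsS => a' /IH[b ->] /= [] ->.
    have [b' [e1 [e2 e3]]] := up b true; exists b'; rewrite /= e1 e2; congr pair.
    apply/seteqP; split=> x /=.
      move=> [h hG] k; rewrite ltnS leq_eqVlt => /orP[/eqP ->|kn]; first by rewrite e2.
      by rewrite e3 //; exact: h.
    move=> h; split=> [k kn|]; first by rewrite -e3 //; apply: h; exact: ltnW.
    by apply/(h n) => //; rewrite e2.
  have [b' [e1 [e2 e3]]] := up b false; exists b'; rewrite /= e1 e2; congr pair.
  apply/seteqP; split=> x /=.
    move=> [h hG] k; rewrite ltnS leq_eqVlt => /orP[/eqP ->|kn]; first by rewrite e2.
    by rewrite e3 //; exact: h.
  move=> h; split=> [k kn|]; first by rewrite -e3 //; apply: h; exact: ltnW.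
  by move=> /(h n (ltnSn n)); rewrite e2.
by rewrite e /= => /E_support[x hx]; exists x.
Qed.

Lemma atoms_cls n a x y : a \in atoms n -> a.1 x -> a.1 y -> cls G n x y.
Proof.
elim: n a => [|n IH] a; first by [].
case/atomsS => a' /IH h [] -> [/= ax Gx] [/= ay Gy] k.
  by rewrite ltnS leq_eqVlt => /orP[/eqP ->|]; [split | exact: h].
by rewrite ltnS leq_eqVlt => /orP[/eqP ->|]; [split | exact: h].
Qed.

Lemma atoms_E n k a : (k < n)%N -> a \in atoms n ->
  (a.1 `<=` G k /\ E k * a.2 = a.2) \/ (a.1 `<=` ~` G k /\ E k * a.2 = 0).
Proof.
move=> kn an; have [_ _ hc] := atoms_proj an; rewrite hc {hc}.
elim: n a kn an => [//|n IH] a; rewrite ltnS leq_eqVlt => /orP[/eqP ->|kn].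
  case/atomsS => a' _ [] -> /=; [left|right]; split; try exact: subIsetr.
    by rewrite -mulrA E_idem.
  by rewrite -mulrA E_Bmul mulr0.
case/atomsS => a' /(IH _ kn)[] [h1 h2] [] -> /=; [left|left|right|right];
  split; try by move=> x [/h1].
- by rewrite -mulrA E_comm mulrA h2.
- by rewrite -mulrA -EB_comm mulrA h2.
- by rewrite -mulrA E_comm mulrA h2 mul0r.
- by rewrite -mulrA -EB_comm mulrA h2 mul0r.
Qed.

Lemma atoms_refine n m b : (n <= m)%N -> b \in atoms m ->
  exists2 a, a \in atoms n & b.1 `<=` a.1 /\ a.2 * b.2 = b.2.
Proof.
move=> nm bm; elim: m b nm bm => [|m IH] b.
  by rewrite leqn0 => /eqP -> b0; exists b => //; split=> //; have [] := atoms_proj b0.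
rewrite leq_eqVlt => /orP[/eqP -> bm|].
  by exists b => //; split=> //; have [] := atoms_proj bm.
rewrite ltnS => nm /atomsS[b' /(IH _ nm)[a an [h1 h2]]] e; exists a => //.
by case: e => -> /=; split; rewrite ?mulrA ?h2 // => x [/h1].
Qed.

(** The Riemann sum of level [n] for the spectral integral of [f]. *)
Definition phi_n n f : bop H := \sum_(a <- atoms n) val_at f a.1 *: a.2.

Lemma phi_n_atom n f b : b \in atoms n -> phi_n n f * b.2 = val_at f b.1 *: b.2.
Proof. by move=> bn; rewrite /phi_n (atoms_orth (fun a => val_at f a.1)). Qed.

Lemma op_atoms n T (c : set X * bop H -> C) :
  (forall b, b \in atoms n -> T * b.2 = c b *: b.2) ->
  T = \sum_(b <- atoms n) c b *: b.2.
Proof.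
move=> h; rewrite -[LHS]mulr1 -(atoms_sum n) mulr_sumr.
rewrite big_seq [RHS]big_seq; by apply: eq_bigr => b bn; exact: h.
Qed.

Lemma atoms_zero n b : b \in atoms n -> ~ (b.1 !=set0) -> b.2 = 0.
Proof.
move=> bn h; have [//|nz] := eqVneq b.2 0.
by case: h; exact: atoms_nonempty bn nz.
Qed.

Lemma phi_nD n f g : phi_n n (fun x => f x + g x) = phi_n n f + phi_n n g.
Proof.
rewrite -big_split; apply: eq_bigr => a _ /=; rewrite -scalerDl; congr (_ *: _).
by have [[x e]|e] := @val_at_cases R _ a.1; rewrite !e // addr0.
Qed.

Lemma phi_nM n f g : phi_n n (fun x => f x * g x) = phi_n n f * phi_n n g.
Proof.
rewrite mulr_sumr [LHS]big_seq [RHS]big_seq; apply: eq_bigr => a an.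
rewrite bop_scaleAr phi_n_atom // scalerA; congr (_ *: _).
by have [[x e]|e] := @val_at_cases R _ a.1; rewrite !e ?mulr0 // mulrC.
Qed.

Lemma phi_n_conj n f : phi_n n (fun x => Num.conj (f x)) = adjoint (phi_n n f).
Proof.
rewrite adjoint_sum [LHS]big_seq [RHS]big_seq; apply: eq_bigr => a an.
rewrite adjointZ; have [-> _ _] := atoms_proj an; congr (_ *: _).
by have [[x e]|e] := @val_at_cases R _ a.1; rewrite !e ?conjC0.
Qed.

Lemma phi_n_cst n a : phi_n n (fun=> a) = a *: (1 : bop H).
Proof.
rewrite -(atoms_sum n) scaler_sumr [LHS]big_seq [RHS]big_seq.
apply: eq_bigr => b bn.
have [/(@val_atP R)[x bx -> //]|/(atoms_zero bn) ->] := pselect (b.1 !=set0).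
by rewrite !scaler0.
Qed.

Lemma phi_n_indic n k : (k < n)%N -> phi_n n (fun x => (x \in G k)%:R) = E k.
Proof.
move=> kn; rewrite -[RHS]mulr1 -(atoms_sum n) mulr_sumr [LHS]big_seq [RHS]big_seq.
apply: eq_bigr => b bn.
have [/(@val_atP R)[x bx ->]|/(atoms_zero bn) ->] := pselect (b.1 !=set0); last first.
  by rewrite scaler0 mulr0.
have [[h ->]|[h ->]] := atoms_E kn bn.
  by rewrite mem_set ?scale1r //; exact: h.
by rewrite memNset ?scale0r //; exact: h.
Qed.

(** Pythagoras: [|T v|^2] is the sum of the [|c b|^2 |b.2 v|^2], and the same formula for the
    operator [1] gives [|v|^2]. *)
Lemma op_atoms_norm n T M : 0 <= M ->
  (forall b, b \in atoms n -> exists2 c : C, T * b.2 = c *: b.2 & nrm c <= M) ->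
  forall v, nrm (T v) <= M * nrm v.
Proof.
move=> M0 hT v.
have /choice[c hc] b : exists c : C, b \in atoms n -> T * b.2 = c *: b.2 /\ nrm c <= M.
  have [bn|bn] := boolP (b \in atoms n); last by exists 0.
  by have [c h1 h2] := hT b bn; exists c.
have hT1 := op_atoms (fun b bn => (hc b bn).1).
have adj : adjoint T = \sum_(b <- atoms n) Num.conj (c b) *: b.2.
  rewrite [in LHS]hT1 adjoint_sum big_seq [RHS]big_seq; apply: eq_bigr => a an.
  by rewrite adjointZ; have [-> _ _] := atoms_proj an.
have hTT b : b \in atoms n ->
    adjoint T * T * b.2 = toC (nrm (c b) ^+ 2) *: b.2.
  move=> bn; rewrite -mulrA (hc b bn).1 bop_scaleAr adj.
  by rewrite (atoms_orth (fun b => Num.conj (c b))) // scalerA mulrC conj_mulC.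
have sqr_sum (S : bop H) (d : set X * bop H -> R) :
    (forall b, b \in atoms n -> adjoint S * S * b.2 = toC (d b) *: b.2) ->
    nrm (S v) ^+ 2 = \sum_(b <- atoms n) d b * nrm (b.2 v) ^+ 2.
  move=> /op_atoms e; apply: toC_inj; rewrite nrm_sqr_adjoint e.
  rewrite bop_sumE (big_morph _ (@toCD R) (@toC0 R)).
  rewrite (big_morph (fun x => inner H x v) (fun x y => innerDl x y v) (inner0l v)).
  rewrite big_seq [RHS]big_seq; apply: eq_bigr => b /atoms_proj[h1 h2 _].
  by rewrite bopZE innerZl toCM nrm_sqr_adjoint h1 h2.
rewrite -ler_sqr ?nnegrE ?mulr_ge0 ?nrm_ge0 // exprMn.
rewrite (sqr_sum T (fun b => nrm (c b) ^+ 2)) //.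
rewrite (sqr_sum 1 (fun=> 1)); last by move=> b _; rewrite adjoint1 !mul1r scale1r.
rewrite mulr_sumr big_seq [leRHS]big_seq; apply: ler_sum => b bn.
rewrite mul1r ler_wpM2r ?sqr_ge0 // ler_sqr ?nnegrE ?nrm_ge0 //.
exact: (hc b bn).2.
Qed.

Lemma phi_n_norm n f M : 0 <= M -> (forall x, nrm (f x) <= M) ->
  forall v, nrm (phi_n n f v) <= M * nrm v.
Proof.
move=> M0 hf; apply: (@op_atoms_norm n) => // b bn; rewrite phi_n_atom //.
have [/(@val_atP R)[x bx ->]|/(atoms_zero bn) ->] := pselect (b.1 !=set0).
  by exists (f x).
by exists 0; rewrite ?scaler0 // nrm0.
Qed.

Lemma phi_n_cauchy f e : uosc G f -> 0 < e -> exists N, forall m n,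
  (N <= m)%N -> (N <= n)%N -> forall v, nrm (phi_n m f v - phi_n n f v) <= e * nrm v.
Proof.
move=> hf e0; have e2 : 0 < e / 2 by rewrite divr_gt0.
have [N hN] := hf _ e2; exists N.
suff h m : (N <= m)%N -> forall v, nrm (phi_n m f v - phi_n N f v) <= e / 2 * nrm v.
  move=> m n Nm Nn v; apply: (le_trans (nrm_dist (phi_n N f v) _ _)).
  rewrite [e]splitr mulrDl lerD //; first exact: h.
  by rewrite nrm_distC; exact: h.
move=> Nm v; rewrite -bopBE; move: v; apply: (@op_atoms_norm m); first exact: ltW.
move=> b bm; have [a an [ba eab]] := atoms_refine Nm bm.
have [b0|/(atoms_zero bm) ->] := pselect (b.1 !=set0); last first.
  by exists 0; rewrite ?mulr0 ?scaler0 // nrm0 ltW.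
(* On an atom [b] inside the coarser atom [a], the two Riemann sums act by values of [f] at sample
   points of [b] and of [a], and these lie in one class of level [N]. *)
exists (val_at f b.1 - val_at f a.1).
  by rewrite mulrBl phi_n_atom // -{2}eab mulrA phi_n_atom // bop_scaleAl eab scalerBl.
have [x bx ->] := @val_atP R _ _ b0.
have [|y ay ->] := @val_atP R _ a.1; first by exists x; exact: ba.
by apply: hN; apply: atoms_cls an ay (ba _ bx).
Qed.

(** Convergence of the Riemann sums in operator norm, kept as a relation so that sums, products and
    adjoints pass to the limit without carrying [uosc] along. *)
Definition is_phi f T := forall e : R, 0 < e -> exists N, forall n,
  (N <= n)%N -> forall v, nrm (T v - phi_n n f v) <= e * nrm v.

Lemma is_phi_exists f : uosc G f -> exists T, is_phi f T.
Proof. by move=> hf; apply: bop_lim => e e0; exact: phi_n_cauchy. Qed.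

Lemma is_phi_unique f S T : is_phi f S -> is_phi f T -> S = T.
Proof.
move=> hS hT; apply: bop_eqM => d d0 v.
have [N hN] := hS d d0; have [M hM] := hT d d0.
exists (phi_n (N + M)%N f v).
by split; [apply: hN; exact: leq_addr | apply: hM; exact: leq_addl].
Qed.

Lemma is_phiD f g S T : is_phi f S -> is_phi g T ->
  is_phi (fun x => f x + g x) (S + T).
Proof.
move=> hS hT e e0; have e2 : 0 < e / 2 by rewrite divr_gt0.
have [N hN] := hS _ e2; have [M hM] := hT _ e2; exists (N + M)%N => n hn v.
rewrite phi_nD !bopDE opprD addrACA (le_trans (nrmD _ _)) //.
rewrite [e]splitr mulrDl lerD //.
  by apply: hN; apply: leq_trans hn; exact: leq_addr.
by apply: hM; apply: leq_trans hn; exact: leq_addl.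
Qed.

Lemma is_phiM f g S T : is_phi f S -> is_phi g T ->
  is_phi (fun x => f x * g x) (S * T).
Proof.
move=> hS hT e e0.
have [K K0 hK] := bop_bounded S; have [L L0 hL] := bop_bounded T.
have KL : 0 < K + L + 1 by rewrite !addr_gt0.
(* [K] bounds [S], and [L + 1] bounds [phi_n n g] because [d <= 1]; the total error is
   [d * (K + L + 1)]. *)
pose d := Num.min 1 (e / (K + L + 1)).
have d0 : 0 < d by rewrite lt_min ltr01 divr_gt0.
have d1 : d <= 1 by rewrite ge_min lexx.
have dK : d * (K + L + 1) <= e by rewrite -ler_pdivlMr // ge_min lexx orbT.
have [N hN] := hS _ d0; have [M hM] := hT _ d0; exists (N + M)%N => n hn v.
have h1 := hN n (leq_trans (leq_addr _ _) hn).
have h2 := hM n (leq_trans (leq_addl _ _) hn) v.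
rewrite phi_nM !bopME; have -> : S (T v) - phi_n n f (phi_n n g v) =
    S (T v - phi_n n g v) + (S (phi_n n g v) - phi_n n f (phi_n n g v)).
  by rewrite bopB addrA subrK.
have h3 : nrm (phi_n n g v) <= (L + 1) * nrm v.
  rewrite -[phi_n n g v](subrK (T v)) (le_trans (nrmD _ _)) // nrm_distC.
  rewrite mulrDl addrC lerD // (le_trans h2) // ler_wpM2r ?nrm_ge0 //.
have h4 := le_trans (h1 (phi_n n g v)) (ler_wpM2l (ltW d0) h3).
have h5 := le_trans (hK (T v - phi_n n g v)) (ler_wpM2l (ltW K0) h2).
apply: le_trans (nrmD _ _) _; apply: (le_trans (lerD h5 h4)).
apply: (@le_trans _ _ (d * (K + L + 1) * nrm v)).
  by rewrite le_eqVlt; apply/orP; left; apply/eqP; ring.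
by rewrite ler_wpM2r ?nrm_ge0.
Qed.

Lemma is_phi_conj f T : is_phi f T -> is_phi (fun x => Num.conj (f x)) (adjoint T).
Proof.
move=> hT e e0; have [N hN] := hT e e0; exists N => n Nn v.
rewrite phi_n_conj -bopBE -adjointB; apply: adjoint_bound; first exact: ltW.
exact: hN.
Qed.

Lemma is_phi_cst a : is_phi (fun=> a) (a *: (1 : bop H)).
Proof.
move=> e e0; exists 0 => n _ v; rewrite phi_n_cst subrr nrm0.
by rewrite mulr_ge0 ?nrm_ge0 // ltW.
Qed.

Lemma is_phi_indic k : is_phi (fun x => (x \in G k)%:R) (E k).
Proof.
move=> e e0; exists k.+1 => n kn v; rewrite phi_n_indic // subrr nrm0.
by rewrite mulr_ge0 ?nrm_ge0 // ltW.
Qed.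

Lemma is_phi_norm f T M : 0 <= M -> (forall x, nrm (f x) <= M) -> is_phi f T ->
  forall v, nrm (T v) <= M * nrm v.
Proof.
move=> M0 hf hT v; apply: ler_add_smallM (nrm_ge0 v) _ => d /hT[N hN].
rewrite -[T v](subrK (phi_n N f v)) (le_trans (nrmD _ _)) // addrC lerD //.
  exact: phi_n_norm.
exact: hN.
Qed.

(* Junk value [0] on functions that are not [uosc]. *)
Definition phi f : bop H := xget 0 [set T | is_phi f T].

Lemma phiP f : uosc G f -> is_phi f (phi f).
Proof. by move=> /is_phi_exists h; exact: (xgetPex 0 h). Qed.

Lemma phi_eq f T : is_phi f T -> phi f = T.
Proof.
move=> hT; apply: is_phi_unique (hT).
have h : exists T, is_phi f T by exists T.
exact: (xgetPex 0 h).
Qed.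

End FunctionalCalculus.

Lemma fsum_seq (T : choiceType) (W : nmodType) (D : set T) (r : seq T) (F : T -> W) :
  uniq r -> (forall i, D i -> i \notin r -> F i = 0) ->
  (forall i, i \in r -> ~ D i -> F i = 0) ->
  \sum_(i \in D) F i = \sum_(i <- r) F i.
Proof.
move=> ur hr hD; rewrite (fsbigE [seq i <- r | i \in D]) ?filter_uniq //.
- rewrite big_filter_cond [RHS](bigID (fun i => i \in D)) /=.
  rewrite [X in _ = _ + X]big_seq_cond [X in _ = _ + X]big1 ?addr0.
    by apply: eq_bigl => i; rewrite andbb.
  by move=> i /andP[ir iD]; apply: hD => // Di; case/negP: iD; rewrite inE.
- by move=> i /=; rewrite mem_filter => /andP[]; rewrite inE.
by move=> i Di; rewrite mem_filter mem_set //=; exact: hr.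
Qed.

(** * Extending a nonzero product of projections to a full choice of signs *)

Section SignExtension.
Variables (R : realType) (H : hilbertSpace R) (E : nat -> bop H).
Hypothesis E_idem : forall k, E k * E k = E k.
Hypothesis E_comm : forall j k, E j * E k = E k * E j.

(** Greedy choice: when [S * E k = 0], one has [S * (1 - E k) = S], so that one of the two factors
    always keeps the product nonzero. *)
Lemma sign_extend (T : bop H) : T != 0 ->
  exists (sg : nat -> bool) (t : nat -> bop H), [/\ t 0 = T,
    forall n, t n.+1 = t n * (if sg n then E n else 1 - E n) &
    forall n, t n != 0].
Proof.
move=> T0.
pose next k (S : bop H) := S * (if S * E k != 0 then E k else 1 - E k).
pose t := fix t n := if n is m.+1 then next m (t m) else T.
exists (fun n => t n * E n != 0), t; split=> // n.
elim: n => [//|n IH] /=; rewrite /next.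
case: ifP => [//|/negbFE/eqP h]; by rewrite mulrBr mulr1 h subr0.
Qed.

Lemma sign_prod_comm b n k : E k * sign_prod E b n = sign_prod E b n * E k.
Proof.
elim: n => [|n IH]; first by rewrite mulr1 mul1r.
rewrite /= mulrA IH -!mulrA; congr (_ * _); case: (b n); first exact: E_comm.
by rewrite mulrBr mulrBl mulr1 mul1r E_comm.
Qed.

Lemma sign_prod_E b n k : (k < n)%N ->
  E k * sign_prod E b n = if b k then sign_prod E b n else 0.
Proof.
elim: n => [//|n IH]; rewrite ltnS leq_eqVlt => /orP[/eqP ->|kn]; last first.
  by rewrite /= mulrA (IH kn); case: (b k); rewrite ?mul0r.
rewrite /= mulrA sign_prod_comm -mulrA; case: (b n); first by rewrite E_idem.
by rewrite mulrBr mulr1 E_idem subrr mulr0.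
Qed.

(** A substitute for a character of the commutative algebra of the [E k] that does not vanish on
    [sign_prod E b n]: the nonzero operators [t m] decide [E k] as soon as [k < m]. *)
Lemma sign_prod_extend b n : sign_prod E b n != 0 ->
  exists (sg : nat -> bool) (t : nat -> bop H), [/\ forall m, t m != 0,
    forall k m, (k < m)%N -> t m * E k = if sg k then t m else 0 &
    forall k, (k < n)%N -> sg k = b k].
Proof.
move=> /sign_extend[sg [t [t0 tS tn]]]; exists sg, t.
have tc m k : E k * t m = t m * E k.
  elim: m => [|m IH]; first by rewrite t0 sign_prod_comm.
  rewrite tS mulrA IH -!mulrA; congr (_ * _); case: (sg m); first exact: E_comm.
  by rewrite mulrBr mulrBl mulr1 mul1r E_comm.
have tE k m : (k < m)%N -> t m * E k = if sg k then t m else 0.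
  elim: m => [//|m IH]; rewrite ltnS leq_eqVlt => /orP[/eqP ->|km].
    rewrite tS -mulrA; case: (sg m); first by rewrite E_idem.
    by rewrite mulrBl mul1r E_idem subrr mulr0.
  by rewrite -tc tS mulrA tc (IH km); case: (sg k); rewrite ?mul0r.
have tb k m : (k < n)%N -> E k * t m = if b k then t m else 0.
  move=> kn; elim: m => [|m IH]; first by rewrite t0 sign_prod_E.
  by rewrite tS mulrA IH; case: (b k); rewrite ?mul0r.
split=> // k kn; have := tE k k.+1 (ltnSn k); rewrite -tc tb //.
have := tn k.+1; case: (b k) (sg k) => [] [] // /eqP h e; by case: h.
Qed.

End SignExtension.

(** * The commuting projections of a Cuntz-Krieger family *)

Section CuntzKriegerFamily.
Variables (R : realType) (I : countType) (A : rel I) (H : hilbertSpace R).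
Local Notation X := (terminalPath A).
Variable u : I -> bop H.
Hypothesis u_pi : forall i, partial_isometry (@adjoint R H) (u i).
Hypothesis u_ck : cuntz_krieger (@adjoint R H) A u.

Local Notation P i := (u i * adjoint (u i)).
Local Notation Q i := (adjoint (u i) * u i).

Lemma Q_adj i : adjoint (Q i) = Q i. Proof. by rewrite adjointM adjointK. Qed.
Lemma P_adj i : adjoint (P i) = P i. Proof. by rewrite adjointM adjointK. Qed.
Lemma u_Q i : u i * Q i = u i. Proof. by rewrite mulrA; exact: u_pi. Qed.
Lemma Q_ua i : Q i * adjoint (u i) = adjoint (u i).
Proof. by have := congr1 (@adjoint R H) (u_Q i); rewrite adjointM Q_adj. Qed.
Lemma P_u i : P i * u i = u i. Proof. exact: u_pi. Qed.
Lemma ua_P i : adjoint (u i) * P i = adjoint (u i).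
Proof. by rewrite mulrA Q_ua. Qed.

Lemma ua_u i j : i != j -> adjoint (u i) * u j = 0.
Proof.
move=> ij; rewrite -(ua_P i) -(P_u j) mulrA -(mulrA _ (P i)) (CK2 u_ck) //.
by rewrite mulr0 mul0r.
Qed.

Lemma Q_u j i : Q j * u i = if A j i then u i else 0.
Proof.
have : Q j * P i = if A j i then P i else 0.
  have := CK3 u_ck j i; move=> /(congr1 (@adjoint R H)).
  rewrite adjointM Q_adj P_adj => ->.
  by case: (A j i); rewrite ?P_adj ?adjoint0.
move=> h; rewrite -[in LHS](P_u i) mulrA h.
by case: (A j i); rewrite ?mul0r // P_u.
Qed.

Lemma ua_Q j i : adjoint (u i) * Q j = if A j i then adjoint (u i) else 0.
Proof.
by rewrite -(Q_adj j) -adjointM Q_u; case: (A j i); rewrite ?adjoint0.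
Qed.

(* The operator of the representation attached to the indicator of
   [gen (s, o)]. *)
Fixpoint gen_op (s : seq I) (o : option I) : bop H :=
  if s is i :: s' then u i * gen_op s' o * adjoint (u i)
  else if o is Some j then Q j else 1.

Lemma gen_op_adj s o : adjoint (gen_op s o) = gen_op s o.
Proof.
elim: s => [|i s IH] /=; last by rewrite !adjointM adjointK IH mulrA.
by case: o => [j|]; rewrite ?Q_adj ?adjoint1.
Qed.

(** Compression by [u i] is multiplicative up to the factor [Q i] in the middle, which is moved to
    an end and absorbed. [conj_mull] moves it the other way: in [gen_op_comm] only one of the two
    operators is already known to commute with [Q i]. *)
Lemma conj_mul i S T : T * Q i = Q i * T ->
  u i * S * adjoint (u i) * (u i * T * adjoint (u i)) =
  u i * (S * T) * adjoint (u i).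
Proof.
move=> h; have e : adjoint (u i) * (u i * T * adjoint (u i)) = T * adjoint (u i).
  by rewrite !mulrA -h -mulrA Q_ua.
by rewrite -mulrA e !mulrA.
Qed.

Lemma conj_mull i S T : S * Q i = Q i * S ->
  u i * S * adjoint (u i) * (u i * T * adjoint (u i)) =
  u i * (S * T) * adjoint (u i).
Proof.
move=> h; have e : u i * S * adjoint (u i) * u i = u i * S.
  by rewrite -mulrA -mulrA h mulrA u_Q.
by rewrite !mulrA e.
Qed.

Lemma gen_op_comm s o t o' : gen_op s o * gen_op t o' = gen_op t o' * gen_op s o.
Proof.
(* By (CK3) both sides are [A j i] times the compressed operator. *)
have nilC j i T : Q j * (u i * T * adjoint (u i)) = u i * T * adjoint (u i) * Q j.
  by rewrite -[RHS]mulrA ua_Q !mulrA Q_u; case: (A j i); rewrite ?mul0r ?mulr0.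
elim: s t o' => [|i s IH] [|j t] o' /=.
- by case: o o' => [j|] [k|]; rewrite ?mulr1 ?mul1r //; exact: (CK1 u_ck).
- by case: o => [k|]; [exact: nilC | rewrite mulr1 mul1r].
- by case: o' => [k|]; [rewrite nilC | rewrite mulr1 mul1r].
have [<-|ij] := eqVneq i j; last first.
  rewrite !mulrA -(mulrA (u i * _)) ua_u // mulr0 !mul0r.
  by rewrite -(mulrA (u j * _)) ua_u 1?eq_sym // mulr0 !mul0r.
have hQ : gen_op s o * Q i = Q i * gen_op s o by exact: (IH [::] (Some i)).
by rewrite (conj_mull _ hQ) (conj_mul _ hQ) IH.
Qed.

Lemma gen_op_Q s o i : gen_op s o * Q i = Q i * gen_op s o.
Proof. exact: (gen_op_comm s o [::] (Some i)). Qed.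

Lemma gen_op_idem s o : gen_op s o * gen_op s o = gen_op s o.
Proof.
elim: s => [|i s IH] /=; last by rewrite conj_mul ?gen_op_Q // IH.
by case: o => [j|]; rewrite ?mulr1 // mulrA Q_ua.
Qed.

(** This identity, the next four and [gen_op_cluster] are the operator counterparts of the
    conditions in [coherent]. *)
Lemma gen_op_prefix s i :
  gen_op (rcons s i) None * gen_op s None = gen_op (rcons s i) None.
Proof.
elim: s => [|j s IH] /=; first by rewrite !mulr1.
by rewrite conj_mul ?gen_op_Q // IH.
Qed.

Lemma gen_op_uniq s i j : i != j ->
  gen_op (rcons s i) None * gen_op (rcons s j) None = 0.
Proof.
move=> ij; elim: s => [|k s IH] /=; first by rewrite !mulr1; exact: (CK2 u_ck).
by rewrite conj_mul ?gen_op_Q // IH mulr0 mul0r.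
Qed.

Lemma gen_op_column s i j : gen_op (rcons s i) None * gen_op s (Some j) =
  if A j i then gen_op (rcons s i) None else 0.
Proof.
elim: s => [|k s IH] /=.
  by rewrite mulr1 -mulrA ua_Q; case: (A j i); rewrite ?mulr0.
by rewrite conj_mul ?gen_op_Q // IH; case: (A j i); rewrite ?mulr0 ?mul0r.
Qed.

Lemma gen_op_last s i : gen_op (rcons s i) None * gen_op (rcons s i) (Some i) =
  gen_op (rcons s i) None.
Proof.
elim: s => [|j s IH] /=; last by rewrite conj_mul ?gen_op_Q // IH.
by rewrite conj_mul // mulr1 mul1r u_Q.
Qed.

Lemma gen_op_at s j : gen_op s (Some j) * gen_op s None = gen_op s (Some j).
Proof.
elim: s => [|i s IH] /=; first by rewrite mulr1.
by rewrite conj_mul ?gen_op_Q // IH.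
Qed.

Implicit Type L : seq (bool * (seq I * option I)).

Fixpoint sgen_prod L : bop H :=
  if L is a :: L' then
    (if a.1 then gen_op a.2.1 a.2.2 else 1 - gen_op a.2.1 a.2.2) * sgen_prod L'
  else 1.

Lemma sgen_prod_cat L L' : sgen_prod (L ++ L') = sgen_prod L * sgen_prod L'.
Proof. by elim: L => [|a L IH]; rewrite ?mul1r //= IH mulrA. Qed.

Lemma sgen_prod_conj i L T :
  u i * T * adjoint (u i) * sgen_prod [seq (a.1, (i :: a.2.1, a.2.2)) | a <- L] =
  u i * (T * sgen_prod L) * adjoint (u i).
Proof.
elim: L T => [|[b [s o]] L IH] T /=; first by rewrite !mulr1.
rewrite mulrA; case: b; first by rewrite conj_mul ?gen_op_Q // IH -(mulrA T).
rewrite mulrBr mulr1 conj_mul ?gen_op_Q // -mulrBl -mulrBr.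
have -> : T - T * gen_op s o = T * (1 - gen_op s o) by rewrite mulrBr mulr1.
by rewrite IH -(mulrA T).
Qed.

Lemma sgen_prod_zero g L : (false, g) \in L -> gen_op g.1 g.2 * sgen_prod L = 0.
Proof.
elim: L => [//|a L IH]; rewrite in_cons => /orP[/eqP <-|/IH h] /=.
  by rewrite mulrA mulrBr mulr1 gen_op_idem subrr mul0r.
rewrite mulrA; case: a.1; first by rewrite gen_op_comm -mulrA h mulr0.
rewrite mulrBr mulr1 mulrBl h gen_op_comm -mulrA h mulr0 subrr //.
Qed.

(* The signed generators whose product with [gen_op s None] vanishes by the
   last Cuntz-Krieger relation. *)
Definition cluster_signs s (E F S : seq I) : seq (bool * (seq I * option I)) :=
  [seq (true, (s, Some j)) | j <- E] ++ [seq (false, (s, Some k)) | k <- F] ++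
  [seq (false, (rcons s i, None)) | i <- S].

(** For the empty word, (CK4) turns the factors from [E] and [F] into a sum of projections [P i],
    each killed by its own factor [1 - P i]. Longer words follow by compression. *)
Lemma gen_op_cluster s (E F : {fset I}) (fin : finite_set [set i | AEF A E F i != 0%N]) :
  gen_op s None *
  sgen_prod (cluster_signs s E F (fset_set [set i | AEF A E F i != 0%N])) = 0.
Proof.
set S := fset_set _.
elim: s => [|i s IH]; last first.
  have -> : cluster_signs (i :: s) E F S =
      [seq (a.1, (i :: a.2.1, a.2.2)) | a <- cluster_signs s E F S].
    by rewrite /cluster_signs !map_cat -!map_comp.
  by rewrite /= sgen_prod_conj IH mulr0 mul0r.
rewrite mul1r /cluster_signs !sgen_prod_cat mulrA.
have hE (r : seq I) : sgen_prod [seq (true, ([::], Some j)) | j <- r] = \prod_(j <- r) Q j.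
  by elim: r => [|j r IH]; rewrite ?big_nil // big_cons /= IH.
have hF (r : seq I) : sgen_prod [seq (false, ([::], Some k)) | k <- r] =
    \prod_(k <- r) (1 - Q k).
  by elim: r => [|j r IH]; rewrite ?big_nil // big_cons /= IH.
have hS i : [set: I] i -> i \notin (S : seq I) -> P i *+ AEF A E F i = 0.
  move=> _ iS; have [->|h] := eqVneq (AEF A E F i) 0%N; first by rewrite mulr0n.
  by case/negP: iS; rewrite in_fset_set // inE.
rewrite hE hF (CK4 u_ck fin) (fsum_seq (fset_uniq S) hS) //; last first.
  by move=> i _ [].
rewrite mulr_suml big_seq_cond big1 // => i /andP[iS _].
suff h : P i * sgen_prod [seq (false, (rcons [::] i0, None)) | i0 <- S] = 0.
  by rewrite mulrnAl h mul0rn.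
have := @sgen_prod_zero ([:: i], None) [seq (false, (rcons [::] i0, None)) | i0 <- S].
by rewrite /= mulr1; apply; apply/mapP; exists i.
Qed.

Definition gen_proj (k : nat) : bop H :=
  if @choice.unpickle (seq I * option I)%type k is Some g then gen_op g.1 g.2
  else 1.

Lemma gen_proj_pickle g : gen_proj (choice.pickle g) = gen_op g.1 g.2.
Proof. by rewrite /gen_proj choice.pickleK. Qed.
Lemma gen_proj_idem k : gen_proj k * gen_proj k = gen_proj k.
Proof. by rewrite /gen_proj; case: (choice.unpickle k) => [g|]; rewrite ?gen_op_idem ?mulr1. Qed.
Lemma gen_proj_adj k : adjoint (gen_proj k) = gen_proj k.
Proof. by rewrite /gen_proj; case: (choice.unpickle k) => [g|]; rewrite ?gen_op_adj ?adjoint1. Qed.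
Lemma gen_proj_comm j k : gen_proj j * gen_proj k = gen_proj k * gen_proj j.
Proof.
rewrite /gen_proj; case: (choice.unpickle j) => [g|]; last by rewrite mulr1 mul1r.
by case: (choice.unpickle k) => [g'|]; [exact: gen_op_comm|rewrite mulr1 mul1r].
Qed.

(** The signs decided by the sequence [t] form a coherent family; the terminal path that realises it
    is the required point. *)
Lemma gen_proj_support b n : sign_prod gen_proj b n != 0 ->
  exists x : X, forall k, (k < n)%N -> (gen_at k x <-> b k).
Proof.
move=> /(sign_prod_extend gen_proj_idem gen_proj_comm)[sg [t [tn tE sgb]]].
pose w (s : seq I) (o : option I) := sg (choice.pickle (s, o)).
(* [t] eventually gives [T] the value [c], as a character would; the next facts say that such values
   are unique and compatible with products and complements. *)
pose lim T (c : bool) := exists N, forall m, (N <= m)%N ->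
  t m * T = if c then t m else 0.
have lw s o : lim (gen_op s o) (w s o).
  by exists (choice.pickle (s, o)).+1 => m /tE; rewrite gen_proj_pickle.
have lu T c c' : lim T c -> lim T c' -> c = c'.
  move=> [N hN] [N' hN']; have := hN _ (leq_addr N' N).
  rewrite hN' ?leq_addl //; have := tn (N + N')%N.
  by case: (c) (c') => [] [] // /eqP h e; case: h.
have lM T T' c c' : lim T c -> lim T' c' -> lim (T * T') (c && c').
  move=> [N hN] [N' hN']; exists (N + N')%N => m hm.
  rewrite mulrA hN; last exact: leq_trans (leq_addr _ _) hm.
  by case: (c); rewrite ?mul0r // hN' //; exact: leq_trans (leq_addl _ _) hm.
have l0 : lim 0 false by exists 0 => m _; rewrite mulr0.
have l1 : lim 1 true by exists 0 => m _; rewrite mulr1.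
have lB T c : lim T c -> lim (1 - T) (~~ c).
  move=> [N hN]; exists N => m hm; rewrite mulrBr mulr1 hN //.
  by case: (c); rewrite ?subrr ?subr0.
have lL (L : seq (bool * (seq I * option I))) :
    lim (sgen_prod L) (all (fun a => w a.2.1 a.2.2 == a.1) L).
  elim: L => [//|[[] [s o]] L IH] /=; apply: lM => //; first by rewrite eqb_id.
  by rewrite eqbF_neg; exact: lB.
have cw : coherent A w.
  split.
  - exact: lu (lw [::] None) l1.
  - move=> s i h; have := lM _ _ _ _ (lw (rcons s i) None) (lw s None).
    by rewrite gen_op_prefix h => /(lu _ _ _ (lw _ _)); rewrite h.
  - move=> s i j hi hj; apply/eqP; apply: contraT => ij.
    have := lM _ _ _ _ (lw (rcons s i) None) (lw (rcons s j) None).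
    by rewrite gen_op_uniq // hi hj => /(lu _ _ _ l0).
  - move=> s i j h; have := lM _ _ _ _ (lw (rcons s i) None) (lw s (Some j)).
    rewrite gen_op_column h /=; case: (A j i).
      by move=> /(lu _ _ _ (lw _ _)); rewrite h => <-.
    by move=> /(lu _ _ _ l0) <-.
  - move=> s i h; have := lM _ _ _ _ (lw (rcons s i) None) (lw (rcons s i) (Some i)).
    by rewrite gen_op_last h => /(lu _ _ _ (lw _ _)); rewrite h.
  - move=> s j h; have := lM _ _ _ _ (lw s (Some j)) (lw s None).
    by rewrite gen_op_at h => /(lu _ _ _ (lw _ _)); rewrite h.
  (* If no letter extended [s], all the signs in [cluster_signs] would agree with [w], and a product
     equal to [0] would have the value [true]. *)
  move=> s E F hs hE hF fin; apply: contrapT => hn.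
  have := lM _ _ _ _ (lw s None)
    (lL (cluster_signs s E F (fset_set [set i | AEF A E F i != 0%N]))).
  rewrite gen_op_cluster // hs => /(lu _ _ _ l0)/esym/negbT/negP; apply.
  rewrite /cluster_signs !all_cat !all_map; apply/and4P; split=> //; apply/allP => i iS /=.
  - by rewrite (hE i iS).
  - by apply/eqP/negbTE/negP; exact: hF.
  - by apply/eqP/negbTE/negP => h; apply: hn; exists i.
have [x hx] := realise cw; exists x => k kn; rewrite -sgb //.
have lk : lim (gen_proj k) (sg k) by exists k.+1 => m; exact: tE.
move: lk; rewrite /gen_at /gen_proj; case: (choice.unpickle k) => [[s o]|].
  by move=> /(lu _ _ _ (lw s o)) <-; rewrite -(hx (s, o)).
by move=> /(lu _ _ _ l1) <-.
Qed.

End CuntzKriegerFamily.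

(** * The representation of the continuous functions and its covariance *)

Section Covariance.
Variables (R : realType) (I : countType) (A : rel I) (H : hilbertSpace R).
Local Notation C := (Cplx R).
Local Notation X := (terminalPath A).
Variable u : I -> bop H.
Hypothesis u_pi : forall i, partial_isometry (@adjoint R H) (u i).
Hypothesis u_ck : cuntz_krieger (@adjoint R H) A u.
Implicit Types (f g h : X -> C).

Local Notation idem := (gen_proj_idem u_pi u_ck).
Local Notation adj := (gen_proj_adj u).
Local Notation comm := (gen_proj_comm u_pi u_ck).
Local Notation supp := (gen_proj_support u_pi u_ck).
Local Notation is_phi := (is_phi (@gen_at I A) (gen_proj u)).

Definition ck_phi f : bop H := phi (@gen_at I A) (gen_proj u) f.

Lemma ck_phiP f : continuous f -> is_phi f (ck_phi f).
Proof.
by move=> /continuous_uosc; exact: (phiP idem adj comm supp).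
Qed.

Lemma ck_phi_eq f T : is_phi f T -> ck_phi f = T.
Proof. exact: phi_eq. Qed.

Lemma is_phi_gen (g : seq I * option I) :
  is_phi (fun x => (x \in @gen I A g)%:R) (gen_op u g.1 g.2).
Proof.
have := is_phi_indic idem adj comm supp (choice.pickle g).
by rewrite gen_at_pickle gen_proj_pickle.
Qed.

Lemma is_phi_ext f g T : is_phi f T -> (forall x, f x = g x) -> is_phi g T.
Proof. by move=> h /funext <-. Qed.

Lemma ck_phiD f g : continuous f -> continuous g ->
  ck_phi (fun x => f x + g x) = ck_phi f + ck_phi g.
Proof. by move=> hf hg; apply: ck_phi_eq; apply: is_phiD; exact: ck_phiP. Qed.

Lemma ck_phiM f g : continuous f -> continuous g ->
  ck_phi (fun x => f x * g x) = ck_phi f * ck_phi g.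
Proof.
move=> hf hg; apply: ck_phi_eq; apply: (is_phiM idem adj comm); exact: ck_phiP.
Qed.

Lemma ck_phi_conj f : continuous f ->
  ck_phi (fun x => Num.conj (f x)) = adjoint (ck_phi f).
Proof.
move=> hf; apply: ck_phi_eq; apply: (is_phi_conj idem adj comm); exact: ck_phiP.
Qed.

Lemma ck_phi_cst a : ck_phi (fun=> a) = a *: (1 : bop H).
Proof. by apply: ck_phi_eq; exact: (is_phi_cst supp). Qed.

Lemma ck_phi_gen (g : seq I * option I) :
  ck_phi (fun x => (x \in @gen I A g)%:R) = gen_op u g.1 g.2.
Proof. by apply: ck_phi_eq; exact: is_phi_gen. Qed.

Lemma pullD i f g x : pull i (fun x => f x + g x) x = pull i f x + pull i g x.
Proof. by rewrite /pull /restr; case: pselect => //= _; rewrite addr0. Qed.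
Lemma pullM i f g x : pull i (fun x => f x * g x) x = pull i f x * pull i g x.
Proof. by rewrite /pull /restr; case: pselect => //= _; rewrite mulr0. Qed.

Lemma is_phi_source i :
  is_phi (fun x => (x \in @source I A i)%:R) (adjoint (u i) * u i).
Proof. by rewrite source_gen; exact: (is_phi_gen ([::], Some i)). Qed.

(** Covariance in a form stable under sums and products, as [continuous_approx] requires; with
    [is_phi] in place of [ck_phi], continuity need not be carried along. *)
Definition intertwined i f := exists T S,
  [/\ is_phi f T, is_phi (pull i f) S & T * u i = u i * S].

Lemma intertwined_cst i a : intertwined i (fun=> a).
Proof.
exists (a *: (1 : bop H)), ((a *: (1 : bop H)) * (adjoint (u i) * u i)); split.
- exact: (is_phi_cst supp).
- apply: is_phi_ext (is_phiM idem adj comm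
    (is_phi_cst supp a) (is_phi_source i)) _ => x.
  rewrite /pull /restr; case: pselect => h; first by rewrite mem_set ?mulr1.
  by rewrite memNset ?mulr0.
- by rewrite !bop_scaleAl bop_scaleAr !mul1r (u_Q u_pi).
Qed.

Lemma intertwined_gen i (g : seq I * option I) :
  intertwined i (fun x => (x \in @gen I A g)%:R).
Proof.
exists (gen_op u g.1 g.2).
have hsrc (x : X) : source i x -> (x \in @source I A i)%:R = 1 :> C.
  by move=> h; rewrite mem_set.
have hnsrc (x : X) : ~ source i x -> (x \in @source I A i)%:R = 0 :> C.
  by move=> h; rewrite memNset.
have phi0 : is_phi (fun=> 0) 0.
  by have := is_phi_cst supp 0; rewrite scale0r.
case: g => [[|j s] o].
(* Empty word: once [i] is put in front, the condition on [j] is just [A j i], so that the pullback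
   is the indicator of the source or [0]. *)
- case: o => [j|]; last first.
    exists (adjoint (u i) * u i); split; [exact: (is_phi_gen ([::], None))| |].
      apply: is_phi_ext (is_phi_source i) _ => x.
      rewrite /pull /restr; case: pselect => h; last by rewrite hnsrc.
      by rewrite hsrc //= mem_set.
    by rewrite /= mul1r (u_Q u_pi).
  exists (if A j i then adjoint (u i) * u i else 0).
  split; [exact: (is_phi_gen ([::], Some j))| |]; last first.
    by rewrite /= (Q_u u_pi u_ck); case: (A j i); rewrite ?(u_Q u_pi) ?mulr0.
  have e (x : X) : source i x -> gen ([::], Some j) (cons_path i x) <-> A j i.
    move=> h; rewrite /gen /= /Zset_at /= (Iset_entry (entry_cons0 h)).
    by split=> [[]|].
  case Aji : (A j i).
    apply: is_phi_ext (is_phi_source i) _ => x.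
    rewrite /pull /restr; case: pselect => h; last by rewrite hnsrc.
    by rewrite hsrc //= mem_set //; apply/e.
  apply: is_phi_ext phi0 _ => x.
  rewrite /pull /restr; case: pselect => h //=.
  by rewrite memNset // => /(e _ h); rewrite Aji.
(* For distinct letters the pullback vanishes, and so does [u_j^* u_i]. *)
have [ij|ij] := eqVneq i j; last first.
  exists 0; split; [exact: (is_phi_gen (j :: s, o))| |].
    apply: is_phi_ext phi0 _ => x; rewrite /pull /restr; case: pselect => h //=.
    by rewrite memNset // => /(gen_cons _ _ _ h)[/eqP]; rewrite (negPf ij).
  by rewrite /= -mulrA (ua_u u_pi u_ck) 1?eq_sym // !mulr0.
subst j; exists (adjoint (u i) * u i * gen_op u s o).
split; [exact: (is_phi_gen (i :: s, o))| |].
  apply: is_phi_ext (is_phiM idem adj comm (is_phi_source i)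
    (is_phi_gen (s, o))) _ => x.
  rewrite /pull /restr; case: pselect => h; last by rewrite hnsrc // mul0r.
  rewrite hsrc // mul1r /=; congr (_%:R); congr nat_of_bool.
  apply/idP/idP; rewrite !inE; first by move=> hx; apply/(gen_cons _ _ _ h).
  by move=> /(gen_cons _ _ _ h)[].
by rewrite /= -(gen_op_Q u_pi u_ck) -!mulrA.
Qed.

Lemma intertwinedD i f g : intertwined i f -> intertwined i g ->
  intertwined i (fun x => f x + g x).
Proof.
move=> [T [S [h1 h2 h3]]] [T' [S' [h1' h2' h3']]]; exists (T + T'), (S + S').
split; first exact: is_phiD.
  by apply: is_phi_ext (is_phiD h2 h2') _ => x; rewrite pullD.
by rewrite mulrDl mulrDr h3 h3'.
Qed.

Lemma intertwinedM i f g : intertwined i f -> intertwined i g ->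
  intertwined i (fun x => f x * g x).
Proof.
move=> [T [S [h1 h2 h3]]] [T' [S' [h1' h2' h3']]]; exists (T * T'), (S * S').
split; first exact: (is_phiM idem adj comm).
  by apply: is_phi_ext (is_phiM idem adj comm h2 h2') _ => x; rewrite pullM.
by rewrite -mulrA h3' !mulrA h3.
Qed.

Lemma is_phiB f g S T : is_phi f S -> is_phi g T ->
  is_phi (fun x => f x - g x) (S - T).
Proof.
move=> hS hT; have h := is_phiD hS
  (is_phiM idem adj comm (is_phi_cst supp (-1)) hT).
rewrite bop_scaleAl mul1r scaleN1r in h.
by apply: is_phi_ext h _ => x; rewrite mulN1r.
Qed.

(** Both sides depend continuously on [f] for the uniform norm, by [is_phi_norm], and agree on the
    approximants that satisfy [intertwined]. *)
Lemma ck_phi_pull i f : continuous f ->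
  ck_phi f * u i = u i * ck_phi (pull i f).
Proof.
move=> fc; apply: bop_ext => v; have [K K0 hK] := bop_bounded (u i).
apply: (@nrm_eqM _ _ _ _ (nrm (u i v) + K * nrm v)) => [|d d0].
  by rewrite addr_ge0 ?mulr_ge0 ?nrm_ge0 // ltW.
have [g [T [S [h1 h2 h3]]] h4] := continuous_approx (intertwined_cst i)
  (@intertwined_gen i) (@intertwinedD i) (@intertwinedM i) fc d0.
have b1 := is_phi_norm idem adj comm supp (ltW d0) h4 (is_phiB (ck_phiP fc) h1) (u i v).
have h5 x : nrm (pull i g x - pull i f x) <= d.
  rewrite /pull /restr; case: pselect => h /=; first by rewrite nrm_distC.
  by rewrite subrr nrm0 ltW.
have b2 := is_phi_norm idem adj comm supp (ltW d0) h5
  (is_phiB h2 (ck_phiP (pull_continuous fc))) v.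
have -> : (ck_phi f * u i) v - (u i * ck_phi (pull i f)) v =
    (ck_phi f - T) (u i v) + u i ((S - ck_phi (pull i f)) v).
  rewrite !bopME !bopBE bopB -[T (u i v)]bopME h3 bopME.
  by rewrite addrA subrK.
apply: le_trans (nrmD _ _) _; apply: (le_trans (lerD b1 (hK _))).
have b3 := ler_wpM2l (ltW K0) b2.
apply: (le_trans (lerD (lexx _) b3)).
by rewrite mulrDr lerD2l mulrCA.
Qed.

Lemma indic_continuous (D : set X) : clopen D ->
  continuous (fun x => (x \in D)%:R : C).
Proof.
move=> hD; have -> : (fun x => (x \in D)%:R : C) = restr D (fun=> 1).
  apply/funext => x; rewrite /restr; case: pselect => h.
    by rewrite mem_set.
  by rewrite memNset.
by apply: restr_continuous => //; exact: cst_continuous.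
Qed.

(** [push i h] is carried by the paths that start with [i], hence absorbs [u_i u_i^*]. Covariance
    takes it through [u_i], and pulling it back restores [h] on the source of [i]. *)
Lemma ck_phi_push i h : continuous h ->
  ck_phi (push i h) = u i * ck_phi h * adjoint (u i).
Proof.
move=> hc; have pc : continuous (push i h) by exact: push_continuous.
have e1 : ck_phi (push i h) = ck_phi (push i h) * (u i * adjoint (u i)).
  have -> : u i * adjoint (u i) =
      ck_phi (fun x => (x \in @gen I A ([:: i], None))%:R).
    by rewrite ck_phi_gen /= mulr1.
  rewrite -(ck_phiM pc (indic_continuous (@gen_clopen I A ([:: i], None)))).
  congr ck_phi; apply/funext => x; rewrite /push /restr.
  by case: pselect => hx; [rewrite mem_set ?mulr1 | rewrite mul0r].
have e2 : ck_phi (pull i (push i h)) = ck_phi h * (adjoint (u i) * u i).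
  have -> : adjoint (u i) * u i = ck_phi (fun x => (x \in @source I A i)%:R).
    by rewrite source_gen ck_phi_gen.
  rewrite -(ck_phiM hc (indic_continuous (@source_clopen I A i))).
  congr ck_phi; apply/funext => x; rewrite /pull {1}/restr.
  case: pselect => hx; last by rewrite memNset ?mulr0.
  by rewrite /= /push restr_in /= ?tail_cons ?mem_set ?mulr1 //; exact: starts_with_cons_path.
rewrite e1 mulrA (ck_phi_pull _ pc) e2 -!mulrA; congr (_ * (_ * _)).
by rewrite mulrA (Q_ua u_pi).
Qed.

End Covariance.

(** * Arrows, reduced pairs of words and bisections *)

Section PathGroupoid.
Variables (I : countType) (A : rel I).
Local Notation X := (terminalPath A).
Local Notation T := (path_shift A).
Local Notation G := (drGroupoid T).
Implicit Types (x y z : X) (s t : seq I) (g : G).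

Definition prepend s x : X := foldr (@cons_path I A) x s.

(** The [z] for which [s z] is a genuine path; elsewhere [prepend s] is affected by the default
    value of [cons_path]. *)
Fixpoint dom s : set X :=
  if s is i :: s' then dom s' `&` (prepend s' @^-1` source i) else setT.

Lemma prepend_continuous s : continuous (prepend s).
Proof.
elim: s => [|i s IH] x; first exact: cvg_id.
exact: (continuous_comp (IH x) (@cons_path_continuous I A i _)).
Qed.

Lemma dom_clopen s : clopen (dom s).
Proof.
elim: s => [|i s IH]; first by split; [exact: openT | exact: closedT].
apply: clopenI => //; have [so sc] := @source_clopen I A i.
by split; [apply: open_comp so|apply: closed_comp sc] => x _;
  exact: prepend_continuous.
Qed.

Lemma prepend_cat s t x : prepend (s ++ t) x = prepend s (prepend t x).
Proof. exact: foldr_cat. Qed.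

Lemma dom_cat s t x : dom (s ++ t) x <-> dom t x /\ dom s (prepend t x).
Proof.
elim: s => [|i s IH] /=; first by split=> [|[]].
rewrite /setI /preimage /= prepend_cat.
by split=> [[/IH[? ?] ?]|[? [? ?]]]; do !split=> //; apply/IH.
Qed.

Lemma piterD m n x : piter T (m + n) x = obind (piter T m) (piter T n x).
Proof.
elim: m => [|m IH]; first by case: (piter T n x).
rewrite addSn -[LHS]/(obind T (piter T (m + n) x)) IH.
by case: (piter T n x).
Qed.

Lemma piter1 x : piter T 1 x = T x. Proof. by []. Qed.

Lemma piter_prepend s x : dom s x -> piter T (size s) (prepend s x) = Some x.
Proof.
elim: s => [//|i s IH] [hs hi].
by rewrite [size _]/= -addn1 piterD piter1 path_shift_cons //= IH.
Qed.

Lemma piter_some n x z : piter T n x = Some z ->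
  exists s, [/\ size s = n, dom s z & x = prepend s z].
Proof.
elim: n x => [|n IH] x; first by case=> ->; exists [::].
rewrite -addn1 piterD piter1; case e : (T x) => [y|//] /= /IH[s [hs ds ey]].
have : exists i, entry x 0 = Some i.
  by move: e; rewrite /path_shift; case: (entry x 0) => [i|//] _; exists i.
case=> i /path_shift_some[y']; rewrite e => -[<-] [hi ex].
by exists (i :: s); rewrite /= hs addn1 -ey; split=> //; split; rewrite //= -ey.
Qed.

Lemma starts_with_prepend s x : dom s x -> starts_with s (prepend s x).
Proof.
elim: s x => [//|i s IH] x [hs hi].
apply/starts_with_cons; rewrite [prepend _ _]/= entry_cons0 //; split=> // k ks.
by rewrite entry_consS // IH.
Qed.

Lemma starts_with_inj s t x : starts_with s x -> starts_with t x ->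
  size s = size t -> s = t.
Proof.
move=> hs ht e; apply/eq_from_onth => k; have [ks|sk] := ltnP k (size s).
  by rewrite -hs // -ht // -e.
by rewrite !onth_default // -e.
Qed.

Lemma prepend_inj s x y : dom s x -> dom s y -> prepend s x = prepend s y ->
  x = y.
Proof.
by move=> /piter_prepend hx /piter_prepend hy e; move: hx; rewrite e hy => -[].
Qed.

(** The local homeomorphism property of the shift: the image under one letter is cut out of a clopen
    cylinder by the continuous map [tail_at i]. *)
Lemma prepend_open s (W : set X) : open W -> open (prepend s @` (W `&` dom s)).
Proof.
elim: s => [|i s IH] Wo.
  by rewrite (_ : _ @` _ = W) //= setIT image_id.
have -> : prepend (i :: s) @` (W `&` dom (i :: s)) =
    Zset [:: i] `&` tail_at i @^-1` (prepend s @` (W `&` dom s)).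
  have tin x : starts_with [:: i] x -> tail_at i x = tail x.
    by rewrite /tail_at; case: pselect.
  have htail x : source i x -> tail_at i (cons_path i x) = x.
    by move=> h; rewrite tin ?tail_cons //; exact: starts_with_cons_path.
  apply/seteqP; split=> [_ [x [Wx [ds di]] <-]|y [hy [x [Wx ds] ex]]].
    split; first exact: starts_with_cons_path.
    by rewrite /preimage /= htail //; exists x.
  have [st ey] := cons_path_cases hy; exists x; last by rewrite /= ex tin.
  by split=> //; split=> //; rewrite /preimage /= ex tin.
apply: openI; first by have [] := @gen_clopen I A ([:: i], None).
by apply: open_comp (IH Wo) => x _; exact: tail_at_continuous.
Qed.

(** The arrow [(s z, |s| - |t|, t z)]. A relation fits better than a function here, since one arrow
    has several expressions and the two domain conditions travel with each. *)
Definition arr_rel s t z g :=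
  [/\ dom s z, dom t z, rg g = prepend s z, sr g = prepend t z &
      deg g = (size s)%:Z - (size t)%:Z].

Lemma arrow_inj g g' : rg g = rg g' -> deg g = deg g' -> sr g = sr g' -> g = g'.
Proof.
case: g g' => [x k y p] [x' k' y' p'] /= e1 e2 e3; subst.
by rewrite (Prop_irrelevance p p').
Qed.

Lemma arr_subproof s t z : dom s z /\ dom t z -> exists m n z',
  [/\ (size s)%:Z - (size t)%:Z = m%:Z - n%:Z,
      piter T m (prepend s z) = Some z' & piter T n (prepend t z) = Some z'].
Proof. by move=> [ds dt]; exists (size s), (size t), z; rewrite !piter_prepend. Qed.

(* The unit at [z] when [s z] or [t z] is not a path. *)
Definition arr s t z : G :=
  if pselect (dom s z /\ dom t z) is left h then DRGroupoid (arr_subproof h)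
  else DRGroupoid (@arr_subproof [::] [::] z (conj Logic.I Logic.I)).

Lemma arrP s t z : dom s z -> dom t z -> arr_rel s t z (arr s t z).
Proof. by move=> ds dt; rewrite /arr; case: pselect => [h|[]]. Qed.

Lemma arr_out s t z : ~ (dom s z /\ dom t z) -> arr_rel [::] [::] z (arr s t z).
Proof. by move=> h; rewrite /arr; case: pselect. Qed.

Lemma arr_rel_fun s t z g g' : arr_rel s t z g -> arr_rel s t z g' -> g = g'.
Proof.
by move=> [_ _ e1 e2 e3] [_ _ e1' e2' e3']; apply: arrow_inj;
  rewrite ?e1 ?e1' ?e2 ?e2' ?e3 ?e3'.
Qed.

Lemma arr_rel_inj s t z z' g : arr_rel s t z g -> arr_rel s t z' g -> z = z'.
Proof. by move=> [ds _ e _ _] [ds' _ e' _ _]; apply: (prepend_inj ds ds'); rewrite -e. Qed.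

(** A common last letter [i] can be moved into the base point, as [arr_rel_rcons] shows; a reduced
    pair leaves none to move. *)
Definition reduced s t := ~ exists s' t' i, s = rcons s' i /\ t = rcons t' i.

Lemma arr_rel_rcons s t i z g : arr_rel (rcons s i) (rcons t i) z g <->
  source i z /\ arr_rel s t (cons_path i z) g.
Proof.
rewrite /arr_rel -!cats1 !prepend_cat !size_cat /=.
have e (w : seq I) : dom (w ++ [:: i]) z <-> source i z /\ dom w (cons_path i z).
  by rewrite dom_cat /=; split=> [[[_ hi] h]|[hi h]].
have e' : (size s + 1)%N%:Z - (size t + 1)%N%:Z = (size s)%:Z - (size t)%:Z.
  by rewrite !PoszD opprD addrACA subrr addr0.
rewrite e'; split=> [[/e[? ?] /e[_ ?] ? ? ?]|[? [? ? ? ? ?]]]; first by split.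
by split=> //; apply/e.
Qed.

Lemma arr_rel_cover g : exists s t z, reduced s t /\ arr_rel s t z g.
Proof.
have [m [n [z [e1 e2 e3]]]] := drGroupoidP g.
have [s [es ds hs]] := piter_some e2; have [t [et dt ht]] := piter_some e3.
have : arr_rel s t z g by split; rewrite ?es ?et.
elim/last_ind: s t z {es ds hs et dt ht e1 e2 e3 m n} => [|s i IH] t z h.
  exists [::], t, z; split=> // -[s' [t' [i [e _]]]].
  by have := congr1 size e; rewrite size_rcons.
have [[s' [t' [j [e1 e2]]]]|hr] := pselect (exists s' t' j,
    rcons s i = rcons s' j /\ t = rcons t' j).
  have [es ei] := rcons_inj e1; subst s' j t.
  by case/arr_rel_rcons: h => _ /IH.
by exists (rcons s i), t, z.
Qed.

(** Equal degrees force the longer pair to be [s ++ b], [t ++ b], with the same [b] because both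
    tails are the prefix of [z] of that length; a nonempty [b] would contradict reducedness. *)
Lemma arr_rel_uniq s t z s' t' z' g : reduced s t -> reduced s' t' ->
  arr_rel s t z g -> arr_rel s' t' z' g -> s = s' /\ t = t'.
Proof.
wlog le : s t z s' t' z' / (size s <= size s')%N.
  move=> h; have [le|/ltnW le] := leqP (size s) (size s'); first exact: h.
  by move=> r r' a a'; have [-> ->] := h _ _ _ _ _ _ le r' r a' a.
move=> r r' [ds dt e1 e2 e3] [ds' dt' e1' e2' e3'].
pose d := (size s' - size s)%N.
have hs' : size s' = (size s + d)%N by rewrite subnKC.
have ht' : size t' = (size t + d)%N.
  have : (size s + d)%N%:Z - (size t')%:Z = (size s)%:Z - (size t)%:Z.
    by rewrite -hs' -e3' e3.
  by move=> h; apply/eqP; rewrite -eqz_nat PoszD; apply/eqP; move: h; rewrite PoszD; lia.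
have split_at (a a' : seq I) : size a' = (size a + d)%N -> dom a z -> dom a' z' ->
    prepend a z = prepend a' z' -> exists b, [/\ a' = a ++ b, size b = d,
      dom b z' & z = prepend b z'].
  move=> ha da da' e; have ea : take (size a) a' = a.
    apply: (@starts_with_inj _ _ (prepend a z)).
    - move=> k; rewrite size_takel ?ha ?leq_addr // => ka; rewrite e.
      rewrite (starts_with_prepend da') ?ha ?ltn_addr //.
      by rewrite -{1}(cat_take_drop (size a) a') onth_cat size_takel ?ha ?leq_addr // ka.
    - exact: starts_with_prepend.
    - by rewrite size_takel // ha leq_addr.
  exists (drop (size a) a'); have eb : a' = a ++ drop (size a) a'.
    by rewrite -{1}(cat_take_drop (size a) a') ea.
  split=> //; first by rewrite size_drop ha addKn.
    by move: da'; rewrite eb => /dom_cat[]; rewrite -eb.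
  move: da' e; rewrite eb prepend_cat => /dom_cat[_ h] e.
  by have := prepend_inj da h e; rewrite -eb.
have [b [eb sb db zb]] := split_at _ _ hs' ds ds' (etrans (esym e1) e1').
have [c [ec sc dc zc]] := split_at _ _ ht' dt dt' (etrans (esym e2) e2').
have bc : b = c.
  apply: (@starts_with_inj _ _ z); rewrite ?sb //.
    by rewrite zb; exact: starts_with_prepend.
  by rewrite zc; exact: starts_with_prepend.
subst c; case/lastP: b eb ec {sb db zb sc dc zc} => [|b i] eb ec.
  by rewrite eb ec !cats0.
by case: r'; exists (s ++ b), (t ++ b), i; rewrite eb ec !rcons_cat.
Qed.

Definition bis s t : set G := [set g | exists z, arr_rel s t z g].

Lemma dr_basic_open (W : set G) : dr_basic (T := T) W -> open W.
Proof. exact: subbase_open. Qed.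

Lemma arr_open s t (W : set X) : open W ->
  open [set g | exists2 z, W z & arr_rel s t z g].
Proof.
move=> Wo; apply: dr_basic_open.
exists (prepend s @` (W `&` dom s)), (prepend t @` (setT `&` dom t)), (size s), (size t).
split; [exact: prepend_open|exact: prepend_open openT| | |].
- split=> [_ [x [_ dx] <-]|x y]; first by rewrite piter_prepend.
  rewrite !inE => -[x' [_ dx] <-] [y' [_ dy] <-].
  by rewrite !piter_prepend // => -[->].
- split=> [_ [x [_ dx] <-]|x y]; first by rewrite piter_prepend.
  rewrite !inE => -[x' [_ dx] <-] [y' [_ dy] <-].
  by rewrite !piter_prepend // => -[->].
apply/seteqP; split=> g /=.
  case=> z Wz [ds dt e1 e2 e3]; rewrite e1 e2 !piter_prepend //.
  by split=> //; exists z.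
case=> -[z [Wz ds] e1] [z' [_ dt] e2] e3; rewrite -e1 -e2 !piter_prepend //.
by case=> zz'; subst z'; exists z.
Qed.

Lemma bis_open s t : open (bis s t).
Proof.
have -> : bis s t = [set g | exists2 z, [set: X] z & arr_rel s t z g].
  by apply/seteqP; split=> g [z]; exists z.
exact: arr_open openT.
Qed.

(** The bisections of reduced pairs partition the groupoid, so that the complement of one is the
    union of the others. *)
Lemma bis_reduced_clopen s t : reduced s t -> clopen (bis s t).
Proof.
move=> r; split; first exact: bis_open.
rewrite -openC.
have -> : ~` bis s t = \bigcup_(p in [set p | reduced p.1 p.2 /\ p <> (s, t)])
    bis p.1 p.2.
  apply/seteqP; split=> g.
    move=> h; have [s' [t' [z [r' a]]]] := arr_rel_cover g.
    exists (s', t'); last by exists z.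
    by split=> // -[e1 e2]; subst s' t'; apply: h; exists z.
  case=> -[s' t'] /= [r' ne] [z a] [z' a']; apply: ne.
  by have [-> ->] := arr_rel_uniq r' r a a'.
by apply: bigcup_open => p _; exact: bis_open.
Qed.

(** A basic open set has exponents [m], [n] of its own, tied to the words only by
    [m - n = |s| - |t|]; the point is that [T^m (s z) = T^n (t z)] persists near [z0]. *)
Lemma to_groupoid_continuous s t (f : X -> G) z0 : dom s z0 -> dom t z0 ->
  (\forall z \near z0, arr_rel s t z (f z)) -> {for z0, continuous f}.
Proof.
move=> ds dt hf W; rewrite nbhsE => -[V0 [V0o V0z] V0W].
have [L [hL1 hL2]] := subbase_finI V0o V0z.
suff : \forall z \near z0, forall V, V \in L -> V (f z).
  by apply: filterS => z h; apply/V0W/hL2.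
apply: sat_seq => V /hL1[[U [U' [m [n [Uo U'o [Ud _] _ ->]]]]]].
have a0 := nbhs_singleton hf.
case=> Uz U'z dmn emn.
have [_ _ e1 e2 e3] := a0.
have n1 : nbhs z0 (dom s) by apply: open_nbhs_nbhs; split=> //; have [] := dom_clopen s.
have n2 : nbhs z0 (dom t) by apply: open_nbhs_nbhs; split=> //; have [] := dom_clopen t.
have n3 : nbhs z0 (prepend s @^-1` U).
  by apply: prepend_continuous; apply: open_nbhs_nbhs; split=> //; rewrite -e1.
have n4 : nbhs z0 (prepend t @^-1` U').
  by apply: prepend_continuous; apply: open_nbhs_nbhs; split=> //; rewrite -e2.
apply: filterS (filterI (filterI hf (filterI n1 n2)) (filterI n3 n4)).
move=> z [[[_ _ f1 f2 f3] [dsz dtz]] [Us Ut]] /=.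
rewrite f1 f2 f3; split=> //; first by rewrite -dmn e3.
have hd : (size s)%:Z - (size t)%:Z = m%:Z - n%:Z by rewrite -e3.
(* When the exponents use up both words, the two sides are the same iterate of [z]. *)
have [sm|ms] := leqP (size s) m.
  have em : m = ((m - size s) + size s)%N by rewrite subnK.
  have en : n = ((m - size s) + size t)%N by lia.
  by rewrite em en !piterD !piter_prepend.
(* Otherwise suffixes of [s] and [t] of equal length are left in front of [z]; at [z0] they are
   prefixes of one path, hence the same word. *)
have em : m = size (take m s) by rewrite size_takel // ltnW.
have en : n = size (take n t) by rewrite size_takel //; lia.
have hp (a : seq I) k w : dom a w -> k = size (take k a) ->
    piter T k (prepend a w) = Some (prepend (drop k a) w).
  rewrite -{1}(cat_take_drop k a) => /dom_cat[_ /piter_prepend h] ek.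
  by move: h; rewrite -ek -prepend_cat cat_take_drop.
have hdd (a : seq I) k w : dom a w -> dom (drop k a) w.
  by rewrite -{1}(cat_take_drop k a) => /dom_cat[].
move: emn; rewrite e1 e2 !hp // => -[e].
suff -> : drop m s = drop n t by [].
apply: (@starts_with_inj _ _ (prepend (drop m s) z0)).
- exact/starts_with_prepend/hdd.
- by rewrite e; exact/starts_with_prepend/hdd.
- by rewrite !size_drop; lia.
Qed.

Lemma arr_continuous s t : continuous (arr s t).
Proof.
move=> z.
have cD : clopen (dom s `&` dom t) by apply: clopenI; exact: dom_clopen.
have [[ds dt]|h] := pselect ((dom s `&` dom t) z).
  apply: (to_groupoid_continuous ds dt).
  have [Do _] := cD; apply: filterS (open_nbhs_nbhs (conj Do (conj ds dt))).
  by move=> y [dsy dty]; exact: arrP.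
apply: (@to_groupoid_continuous [::] [::]) => //.
have [_ /closed_openC Do] := cD.
by apply: filterS (open_nbhs_nbhs (conj Do h)) => y hy; exact: arr_out.
Qed.

Lemma bis_compact s t : compact (bis s t).
Proof.
have -> : bis s t = arr s t @` (dom s `&` dom t).
  apply/seteqP; split=> [g [z a]|_ [z [ds dt] <-]]; last first.
    by exists z; exact: arrP.
  have [ds dt _ _ _] := a; exists z => //.
  exact: arr_rel_fun (arrP ds dt) a.
apply: continuous_compact.
  by apply: continuous_subspaceT => z; exact: arr_continuous.
apply: (subclosed_compact _ (@terminalPath_compact I A)) => //.
by apply: closedI; [have [] := dom_clopen s|have [] := dom_clopen t].
Qed.

End PathGroupoid.

(** * Functions carried by one bisection, and the decomposition of compactly supported functions *)

Section GroupoidFunctions.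
Variables (I : countType) (A : rel I) (R : realType).
Local Notation C := (Cplx R).
Local Notation X := (terminalPath A).
Local Notation G := (drGroupoid (path_shift A)).
Implicit Types (x y z : X) (s t v w : seq I) (c : G) (h k : X -> C) (f : G -> C).

Fixpoint pull_word s h : X -> C :=
  if s is i :: s' then pull_word s' (pull i h) else h.

Lemma pull_wordE s h x : pull_word s h x = restr (dom s) (h \o prepend s) x.
Proof.
elim: s h x => [|i s IH] h x /=; first by rewrite restr_in.
rewrite IH /restr; case: pselect => d; case: pselect => d' //=.
- by rewrite /pull restr_in //; case: d'.
- by rewrite /pull restr_out // => hi; apply: d'.
- by case: d; case: d'.
Qed.

Lemma pull_word_in s h x : dom s x -> pull_word s h x = h (prepend s x).
Proof. by move=> d; rewrite pull_wordE restr_in. Qed.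
Lemma pull_word_out s h x : ~ dom s x -> pull_word s h x = 0.
Proof. by move=> d; rewrite pull_wordE restr_out. Qed.

Lemma pull_word_continuous s h : continuous h -> continuous (pull_word s h).
Proof. by elim: s h => [//|i s IH] h hc; apply/IH/pull_continuous. Qed.

Lemma mulf_continuous (Y : topologicalType) (f g : Y -> C) :
  continuous f -> continuous g -> continuous (fun y : Y => f y * g y).
Proof. by move=> hf hg y; apply: cvgM; [exact: hf | exact: hg]. Qed.

Lemma addf_continuous (Y : topologicalType) (f g : Y -> C) :
  continuous f -> continuous g -> continuous (fun y : Y => f y + g y).
Proof. by move=> hf hg y; apply: cvgD; [exact: hf | exact: hg]. Qed.

Lemma conjf_continuous (Y : topologicalType) (f : Y -> C) :
  continuous f -> continuous (fun y : Y => Num.conj (f y)).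
Proof.
move=> hf y; apply/continuous_nrmP => e e0.
have /continuous_nrmP/(_ _ e0) := hf y; apply: filterS => y' /=.
by rewrite -rmorphB nrm_conj.
Qed.

(* [theta s t h] lives on the bisection of the arrows [s z <- t z], where it
   takes the value [h z]. *)
Definition theta s t h : G -> C := fun c =>
  if pselect (exists z, arr_rel s t z c) is left e then h (sval (cid e)) else 0.

Lemma theta_in s t h z c : arr_rel s t z c -> theta s t h c = h z.
Proof.
move=> a; rewrite /theta; case: pselect => [e|[]]; last by exists z.
by case: (cid e) => z' a' /=; rewrite (arr_rel_inj a' a).
Qed.

Lemma theta_out s t h c : ~ bis s t c -> theta s t h c = 0.
Proof. by rewrite /theta; case: pselect. Qed.

Lemma theta_ext s t h k :
  (forall z, dom s z -> dom t z -> h z = k z) -> theta s t h = theta s t k.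
Proof.
move=> e; apply/funext => c; have [[z a]|n] := pselect (bis s t c).
  by rewrite !(theta_in _ a); case: a => ds dt _ _ _; exact: e.
by rewrite !theta_out.
Qed.

Lemma theta_rcons s t i h :
  theta (rcons s i) (rcons t i) h = theta s t (push i h).
Proof.
apply/funext => c; have [[z a]|n] := pselect (bis s t c); last first.
  by rewrite !theta_out // => -[z /arr_rel_rcons[_ a]]; apply: n; exists (cons_path i z).
rewrite (theta_in _ a) /push; have [hz|hz] := pselect (starts_with [:: i] z).
  rewrite restr_in //; have [st ez] := cons_path_cases hz.
  apply: theta_in; apply/arr_rel_rcons; split=> //; first by rewrite -ez.
rewrite restr_out // theta_out // => -[z' /arr_rel_rcons[st a']].
by apply: hz; rewrite (arr_rel_inj a a'); exact: starts_with_cons_path.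
Qed.

(** Common last letters are stripped until the pair is reduced, by the identity [theta_rcons].
    Reduced pairs alone would not do, because products of bisections leave them. *)
Lemma theta_ind (Q : seq I -> seq I -> (X -> C) -> Prop) :
  (forall s t h, reduced s t -> continuous h -> Q s t h) ->
  (forall s t i h, continuous h -> Q s t (push i h) -> Q (rcons s i) (rcons t i) h) ->
  forall s t h, continuous h -> Q s t h.
Proof.
move=> h1 h2; elim/last_ind => [|s i IH] t h hc.
  apply: h1 => // -[s' [t' [i [e _]]]].
  by have := congr1 size e; rewrite size_rcons.
have [[s' [t' [j [e1 e2]]]]|hr] := pselect (exists s' t' j,
    rcons s i = rcons s' j /\ t = rcons t' j); last exact: h1.
have [es ei] := rcons_inj e1; subst s' j t.
by apply: h2 => //; apply: IH; exact: push_continuous.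
Qed.

Lemma theta_continuous s t h : continuous h -> continuous (theta s t h).
Proof.
apply: (@theta_ind (fun s t h => continuous (theta s t h))) => {s t h}; last first.
  by move=> s t i h _; rewrite theta_rcons.
move=> s t h r hc c; have [bo bc] := @bis_reduced_clopen I A _ _ r.
have [[z a]|n] := pselect (bis s t c).
  apply/continuous_nrmP => e e0.
  have /continuous_nrmP/(_ _ e0) := hc z.
  rewrite /prop_near1 nbhsE => -[W [Wo Wz] We].
  apply: filterS (open_nbhs_nbhs (conj (arr_open s t Wo) _)); last by exists z.
  by move=> c' [z' Wz' a']; rewrite (theta_in _ a) (theta_in _ a'); exact: We.
have ho := closed_openC bc.
move=> W; rewrite theta_out // => hW.
apply: filterS (open_nbhs_nbhs (conj ho n)) => c' n'.
by rewrite /preimage /= theta_out //; exact: nbhs_singleton.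
Qed.

Lemma theta_Cc s t h : continuous h -> Cc (theta s t h).
Proof.
move=> hc; split; first exact: theta_continuous.
by exists (bis s t); [exact: bis_compact | exact: theta_out].
Qed.

Definition coef f s t : X -> C := restr (dom s `&` dom t) (f \o arr s t).

Lemma coef_in f s t z c : arr_rel s t z c -> coef f s t z = f c.
Proof.
move=> a; have [ds dt _ _ _] := a; rewrite /coef restr_in //=.
by rewrite (arr_rel_fun (arrP ds dt) a).
Qed.

Lemma coef_out f s t z : ~ (dom s z /\ dom t z) -> coef f s t z = 0.
Proof. by move=> h; rewrite /coef restr_out. Qed.

Lemma coef_continuous f s t : continuous f -> continuous (coef f s t).
Proof.
move=> hf; apply: restr_continuous; first by apply: clopenI; exact: dom_clopen.
by move=> z; apply: continuous_comp; [exact: arr_continuous | exact: hf].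
Qed.

(** The bisections of reduced pairs are open, disjoint and cover the groupoid, so that a compact
    support meets finitely many of them. *)
Lemma Cc_decomposition f : Cc f -> exists L : seq (seq I * seq I),
  [/\ uniq L, forall p, p \in L -> reduced p.1 p.2,
      forall p, reduced p.1 p.2 -> p \notin L -> forall z, coef f p.1 p.2 z = 0 &
      forall c, f c = \sum_(p <- L) theta p.1 p.2 (coef f p.1 p.2) c].
Proof.
move=> [fc [K Kc K0]].
have [L [uL Lr Lcov]] : exists L : seq (seq I * seq I), [/\ uniq L,
    forall p, p \in L -> reduced p.1 p.2 &
    forall c, K c -> exists2 p, p \in L & bis p.1 p.2 c].
  pose D n c := exists p : seq I * seq I,
    [/\ reduced p.1 p.2, bis p.1 p.2 c & (choice.pickle p < n)%N].
  have nc := (compact_near_coveringP _).1 Kc.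
  have [N _ hN] : \forall n \near \oo, K `<=` D n.
    apply: nc => c _; have [s [t [z [r a]]]] := arr_rel_cover c.
    exists (bis s t, [set n | (choice.pickle (s, t) < n)%N]).
      split=> /=; last by exists (choice.pickle (s, t)).+1.
      by apply: open_nbhs_nbhs; split; [exact: bis_open | exists z].
    by move=> [c' n] /= [hc' hn]; exists (s, t).
  pose L := undup (pmap (@choice.unpickle (seq I * seq I)%type) (iota 0 N)).
  exists [seq p <- L | `[< reduced p.1 p.2 >]]; split.
  - by rewrite filter_uniq // undup_uniq.
  - by move=> p; rewrite mem_filter => /andP[/asboolP].
  move=> c /(hN N (leqnn N))[p [r b pN]]; exists p => //.
  rewrite mem_filter; apply/andP; split; first exact/asboolP.
  rewrite mem_undup mem_pmap; apply/mapP; exists (choice.pickle p).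
    by rewrite mem_iota.
  by rewrite choice.pickleK.
exists L; split=> // [p r pL z|c].
  have [[ds dt]|] := pselect (dom p.1 z /\ dom p.2 z); last exact: coef_out.
  have a := arrP ds dt; rewrite (coef_in _ a); apply: K0 => /Lcov[p' p'L [z' a']].
  have [e1 e2] := arr_rel_uniq r (Lr _ p'L) a a'.
  by case/negP: pL; move: p'L; rewrite (surjective_pairing p) e1 e2 -surjective_pairing.
have [s [t [z [r a]]]] := arr_rel_cover c.
have hne p : p \in L -> p != (s, t) -> theta p.1 p.2 (coef f p.1 p.2) c = 0.
  move=> pL ne; apply: theta_out => -[z' a'].
  have [e1 e2] := arr_rel_uniq r (Lr _ pL) a a'; case/eqP: ne.
  by rewrite (surjective_pairing p) e1 e2.
have [stL|stL] := boolP ((s, t) \in L).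
  rewrite (big_rem _ stL) /= (theta_in _ a) (coef_in _ a) big_seq big1 ?addr0 //.
  move=> p; rewrite mem_rem_uniq // inE => /andP[ne pL]; exact: hne.
rewrite big_seq big1 => [|p pL]; last first.
  by apply: hne => //; apply: contraNneq stL => <-.
apply: K0 => /Lcov[p pL [z' a']].
have [e1 e2] := arr_rel_uniq r (Lr _ pL) a a'.
by case/negP: stL; rewrite e1 e2 -surjective_pairing.
Qed.

End GroupoidFunctions.

(** * Convolution of functions carried by bisections *)

Section Convolution.
Variables (I : countType) (A : rel I) (R : realType).
Local Notation C := (Cplx R).
Local Notation X := (terminalPath A).
Local Notation G := (drGroupoid (path_shift A)).
Implicit Types (x y z : X) (s t v w : seq I) (c : G) (h k : X -> C) (f : G -> C).

Lemma convolution_single f f' c a b : is_product a b c ->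
  (forall a' b', is_product a' b' c -> f a' * f' b' != 0 -> a' = a /\ b' = b) ->
  convolution f f' c = f a * f' b.
Proof.
move=> abc huniq; rewrite /convolution (@fsum_seq _ _ _ [:: (a, b)]) ?big_seq1 //.
  move=> [a' b'] /= p; apply: contraNeq => /(huniq _ _ p)[-> ->].
  by rewrite inE eqxx.
by move=> p; rewrite inE => /eqP -> /=.
Qed.

Lemma convolution_zero f f' c :
  (forall a b, is_product a b c -> f a * f' b = 0) -> convolution f f' c = 0.
Proof. by move=> h; apply: fsbig1 => -[a b]; exact: h. Qed.

(** An arrow factors in at most one way through two bisections, so that the sum has at most one
    term. [F] is this term in the coordinate of the target bisection; the second hypothesis makes it
    vanish where no factorisation exists. *)
Lemma convolution_theta s t t' v s' v' h k (F : X -> C) :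
  (forall z1 z2, dom s z1 -> dom t z1 -> dom t' z2 -> dom v z2 ->
    prepend t z1 = prepend t' z2 -> exists z,
    [/\ dom s' z /\ dom v' z, prepend s' z = prepend s z1, prepend v' z = prepend v z2 &
      (size s)%:Z - (size t)%:Z + ((size t')%:Z - (size v)%:Z) =
        (size s')%:Z - (size v')%:Z /\ F z = h z1 * k z2]) ->
  (forall z, dom s' z -> dom v' z -> F z != 0 -> exists z1 z2,
     [/\ dom s z1 /\ dom t z1, dom t' z2 /\ dom v z2, prepend t z1 = prepend t' z2,
      prepend s z1 = prepend s' z /\ prepend v z2 = prepend v' z &
      (size s)%:Z - (size t)%:Z + ((size t')%:Z - (size v)%:Z) =
        (size s')%:Z - (size v')%:Z]) ->
  convolution (theta s t h) (theta t' v k) = theta s' v' F.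
Proof.
move=> h1 h2; apply/funext => c.
have [[a [b [[z1 a1] [z2 a2] abc]]]|hno] := pselect (exists a b,
    [/\ bis s t a, bis t' v b & is_product a b c]).
  have [e1 e2 e3 e4] := abc.
  have [ds dt p1 p2 p3] := a1; have [dt' dv q1 q2 q3] := a2.
  have [|z [[ds' dv'] r1 r2 [r3 r4]]] := h1 z1 z2 ds dt dt' dv.
    by rewrite -p2 -q1.
  have az : arr_rel s' v' z c.
    by split=> //; rewrite ?e2 ?e3 ?e4 ?p1 ?q2 ?p3 ?q3.
  rewrite (theta_in _ az) r4 -(theta_in h a1) -(theta_in k a2).
  apply: convolution_single abc _ => a' b' [f1 f2 f3 f4] ne.
  have [[z1' a1']|n1] := pselect (bis s t a'); last first.
    by move: ne; rewrite theta_out // mul0r eqxx.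
  have [[z2' a2']|n2] := pselect (bis t' v b'); last first.
    by move: ne; rewrite [X in _ * X]theta_out // mulr0 eqxx.
  have [ds1 dt1 p1' _ _] := a1'; have [_ dv1 _ q2' _] := a2'.
  have z11 : z1' = z1 by apply: (prepend_inj ds1 ds); rewrite -p1' -p1 -f2 -e2.
  have z22 : z2' = z2 by apply: (prepend_inj dv1 dv); rewrite -q2' -q2 -f3 -e3.
  subst z1' z2'; split; first exact: arr_rel_fun a1' a1.
  exact: arr_rel_fun a2' a2.
rewrite convolution_zero => [|a b abc]; last first.
  have [ba|n1] := pselect (bis s t a); last by rewrite theta_out // mul0r.
  have [bb|n2] := pselect (bis t' v b); last by rewrite [X in _ * X]theta_out // mulr0.
  by case: hno; exists a, b.
have [[z a]|n] := pselect (bis s' v' c); last by rewrite theta_out.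
rewrite (theta_in _ a); apply/esym/eqP; apply: contraT => Fz; exfalso; apply: hno.
have [ds' dv' p1 p2 p3] := a.
have [z1 [z2 [[ds dt] [dt' dv] e [e1 e2] e3]]] := h2 z ds' dv' Fz.
exists (arr s t z1), (arr t' v z2).
have a1 := arrP ds dt; have a2 := arrP dt' dv.
split; [by exists z1|by exists z2|].
have [_ _ r1 r2 r3] := a1; have [_ _ u1 u2 u3] := a2.
by split; rewrite ?r1 ?r2 ?r3 ?u1 ?u2 ?u3 ?p1 ?p2 ?p3.
Qed.

Lemma deg_catr s t w v : (size s)%:Z - (size t)%:Z +
  ((size (t ++ w))%:Z - (size v)%:Z) = (size (s ++ w))%:Z - (size v)%:Z.
Proof. by rewrite !size_cat; lia. Qed.

Lemma deg_catl s t w v : (size s)%:Z - (size (t ++ w))%:Z +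
  ((size t)%:Z - (size v)%:Z) = (size s)%:Z - (size (v ++ w))%:Z.
Proof. by rewrite !size_cat; lia. Qed.

(** The function [pull_word t (fun=> 1)] is the indicator of [dom t], that is [S_t^* S_t]. The
    formula moves [h] times this indicator to the right of [S_w]. *)
Lemma convolution_thetar s t w v h k :
  convolution (theta s t h) (theta (t ++ w) v k) = theta (s ++ w) v
    (fun z => pull_word w (fun y => h y * pull_word t (fun=> 1) y) z * k z).
Proof.
apply: convolution_theta => [z1 z2 ds dt /dom_cat[dw dt'] dv|z].
  rewrite prepend_cat => /(prepend_inj dt dt') ez; exists z2; split=> //.
  - by split=> //; apply/dom_cat; rewrite -ez.
  - by rewrite prepend_cat ez.
  split; first exact: deg_catr.
  by rewrite pull_word_in // pull_word_in // ez mulr1.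
move=> /dom_cat[dw ds] dv ne.
have dt : dom t (prepend w z).
  apply: contrapT => dt; move: ne; rewrite pull_word_in // pull_word_out //.
  by rewrite mulr0 mul0r eqxx.
exists (prepend w z), z; split=> //; first by split=> //; apply/dom_cat.
- by rewrite prepend_cat.
- by rewrite prepend_cat.
exact: deg_catr.
Qed.

Lemma convolution_thetal s t w v h k :
  convolution (theta s (t ++ w) h) (theta t v k) = theta s (v ++ w)
    (fun z => h z * pull_word w (fun y => pull_word t (fun=> 1) y * k y) z).
Proof.
apply: convolution_theta => [z1 z2 ds /dom_cat[dw dt'] dt dv|z ds].
  rewrite prepend_cat => /(prepend_inj dt' dt) ez; exists z1; split=> //.
  - by split=> //; apply/dom_cat; rewrite ez.
  - by rewrite prepend_cat ez.
  split; first exact: deg_catl.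
  by rewrite pull_word_in // pull_word_in // ez mul1r.
move=> /dom_cat[dw dv] ne.
have dt : dom t (prepend w z).
  apply: contrapT => dt; move: ne; rewrite pull_word_in // pull_word_out //.
  by rewrite mul0r mulr0 eqxx.
exists z, (prepend w z); split=> //; first by split=> //; apply/dom_cat.
- by rewrite prepend_cat.
- by rewrite prepend_cat.
exact: deg_catl.
Qed.

Lemma convolution_theta0 s t t' v h k :
  (forall z1 z2, dom t z1 -> dom t' z2 -> prepend t z1 <> prepend t' z2) ->
  convolution (theta s t h) (theta t' v k) = fun=> 0.
Proof.
move=> hn; apply/funext => c; apply: convolution_zero => a b [e _ _ _].
have [[z1 [_ dt _ p _]]|n1] := pselect (bis s t a); last by rewrite theta_out // mul0r.
have [[z2 [dt' _ q _ _]]|n2] := pselect (bis t' v b).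
  by case: (hn z1 z2 dt dt'); rewrite -p -q.
by rewrite [X in _ * X]theta_out // mulr0.
Qed.

Lemma arr_rel_inv s t z c : arr_rel s t z (dr_inv c) <-> arr_rel t s z c.
Proof.
split=> -[/= ? ? ? ? e]; split=> //; last by rewrite /= e opprB.
by rewrite -[LHS]opprK e opprB.
Qed.

Lemma theta_star s t h :
  Cc_star (theta s t h) = theta t s (fun z => Num.conj (h z)).
Proof.
apply/funext => c; rewrite /Cc_star; have [[z a]|n] := pselect (bis t s c).
  by rewrite (theta_in _ a); congr Num.conj; apply: theta_in; apply/arr_rel_inv.
rewrite [RHS]theta_out // theta_out ?conjC0 // => -[z /arr_rel_inv a].
by apply: n; exists z.
Qed.

Lemma theta_Sset i : (\1_(Sset A i) : G -> C) = theta [:: i] [::] (fun=> 1).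
Proof.
apply/funext => c; rewrite indicE; have [[z a]|n] := pselect (bis [:: i] [::] c).
  rewrite (theta_in _ a) mem_set //; case: a => -[_ hi] _ /= e1 e2 e3.
  rewrite /preimage /= in hi; split.
  - by rewrite e1; exact: starts_with_cons_path.
  - by rewrite e3.
  by rewrite e1 e2 path_shift_cons.
rewrite theta_out // memNset // => -[hs d1 sh]; apply: n.
have [st e] := cons_path_cases hs; exists (tail (rg c)).
have etail : tail (rg c) = sr c by rewrite /tail sh.
by split; rewrite ?d1 //= -?e ?etail.
Qed.

Lemma bis_Sset i : bis [:: i] [::] = Sset A i.
Proof.
apply/seteqP; split=> c h.
  have : \1_(Sset A i) c = 1 :> C.
    by case: h => z a; rewrite theta_Sset (theta_in _ a).
  rewrite indicE; case: (boolP (c \in Sset A i)) => [|_ /eqP]; first by rewrite inE.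
  by rewrite eq_sym oner_eq0.
apply: contrapT => n; have : \1_(Sset A i) c = 1 :> C by rewrite indicE mem_set.
by rewrite theta_Sset theta_out // => /eqP; rewrite eq_sym oner_eq0.
Qed.

Lemma word_cases (t t' : seq I) : [\/ exists w, t' = t ++ w, exists w, t = t' ++ w |
  exists p i j w w', [/\ t = p ++ i :: w, t' = p ++ j :: w' & i != j]].
Proof.
elim: t t' => [|i t IH] [|j t'].
- by apply: Or31; exists [::].
- by apply: Or31; exists (j :: t').
- by apply: Or32; exists (i :: t).
have [<-|ij] := eqVneq i j; last by apply: Or33; exists [::], i, j, t, t'.
have [[w ->]|[w ->]|[p [a [b [w [w' [-> -> ab]]]]]]] := IH t'.
- by apply: Or31; exists w.
- by apply: Or32; exists w.
by apply: Or33; exists (i :: p), a, b, w, w'.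
Qed.

Lemma prepend_incomparable p i j w w' z z' : i != j ->
  dom (p ++ i :: w) z -> dom (p ++ j :: w') z' ->
  prepend (p ++ i :: w) z <> prepend (p ++ j :: w') z'.
Proof.
move=> ij d d' e; have h := starts_with_prepend d; have h' := starts_with_prepend d'.
have ps (a b : seq I) : (size a < size (a ++ i :: b))%N.
  by rewrite size_cat /= addnS ltnS leq_addr.
have ps' (a b : seq I) : (size a < size (a ++ j :: b))%N.
  by rewrite size_cat /= addnS ltnS leq_addr.
have := h (size p) (ps _ _); rewrite e h' ?ps' // !onth_cat !ltnn subnn /=.
by move=> [/esym/eqP]; rewrite (negPf ij).
Qed.

End Convolution.

(** * The Cuntz-Krieger relations in the groupoid *)

Section GroupoidRelations.
Variables (I : countType) (A : rel I) (R : realType).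
Local Notation C := (Cplx R).
Local Notation X := (terminalPath A).
Local Notation G := (drGroupoid (path_shift A)).
Implicit Types (x y z : X) (s t v w : seq I) (h : X -> C) (f : G -> C).

Lemma cst_continuousC (a : C) : continuous (fun _ : X => a).
Proof. exact: cst_continuous. Qed.

Lemma theta_one i : Cc (\1_(Sset A i) : G -> C).
Proof. by rewrite theta_Sset; apply: theta_Cc; exact: cst_continuousC. Qed.

Definition indic (D : set X) : X -> C := fun x => (x \in D)%:R.

Lemma pull_cst1 i : pull i (fun=> 1) = indic (source i).
Proof.
apply/funext => x; rewrite /pull /restr /indic; case: pselect => h.
  by rewrite mem_set.
by rewrite memNset.
Qed.

Lemma push_cst1 i : push i (fun=> 1) = indic (Zset [:: i]).
Proof.
apply/funext => x; rewrite /push /restr /indic; case: pselect => h.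
  by rewrite mem_set.
by rewrite memNset.
Qed.

Lemma prod_indic (E F : seq I) x :
  \prod_(j <- E) indic (source j) x * \prod_(k <- F) (1 - indic (source k) x) =
  (all (fun j => x \in @source I A j) E && all (fun k => x \notin @source I A k) F)%:R.
Proof.
have h1 : \prod_(j <- E) indic (source j) x = (all (fun j => x \in @source I A j) E)%:R.
  elim: E => [|j E IH]; first by rewrite big_nil.
  by rewrite big_cons IH -natrM mulnb.
have h2 : \prod_(k <- F) (1 - indic (source k) x) =
    (all (fun k => x \notin @source I A k) F)%:R.
  elim: F => [|j F IH]; first by rewrite big_nil.
  rewrite big_cons IH /= /indic; case: (x \in _) => /=; first by rewrite mulr1n subrr mul0r.
  by rewrite mulr0n subr0 mul1r.
by rewrite h1 h2 -natrM mulnb.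
Qed.

(** At a path with first letter [i] both sides are [A(E,F,i)]. At an empty path [(\emptyset; J)] the
    right side is [0]; so is the left side, since otherwise the cluster point [J] would leave
    infinitely many [i] in the finite set. *)
Lemma CK4_pointwise (E F : {fset I}) (fin : finite_set [set i | AEF A E F i != 0%N]) x :
  \prod_(j <- E) indic (source j) x * \prod_(k <- F) (1 - indic (source k) x) =
  \sum_(i <- fset_set [set i | AEF A E F i != 0%N]) indic (Zset [:: i]) x *+ AEF A E F i.
Proof.
set S := fset_set _; rewrite prod_indic.
have [[i hi]|hn] := pselect (exists i, entry x 0 = Some i).
  have hsrc j : (x \in @source I A j) = A j i.
    by rewrite /source; apply/idP/idP; rewrite inE /= (Iset_entry hi).
  have -> : (all (fun j => x \in @source I A j) E &&
      all (fun k => x \notin @source I A k) F) = AEF A E F i :> nat.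
    rewrite AEF_E; congr (nat_of_bool (_ && _)); apply: eq_all => j; first exact: hsrc.
    by rewrite hsrc.
  have hZ j : indic (Zset [:: j]) x = (i == j)%:R.
    rewrite /indic; congr (nat_of_bool _)%:R; apply/idP/eqP.
      by rewrite inE => /starts_with_cons[]; rewrite hi => -[].
    by move=> <-; rewrite inE; apply/starts_with_cons.
  under eq_bigr do rewrite hZ.
  have [iS|iS] := boolP (i \in S).
    rewrite (big_rem _ iS) /= eqxx big_seq big1 ?addr0 // => j.
    by rewrite mem_rem_uniq ?fset_uniq // inE eq_sym => /andP[/negPf -> _]; rewrite mul0rn.
  have -> : AEF A E F i = 0%N.
    by apply/eqP; apply: contraNT iS => h; rewrite in_fset_set // inE.
  rewrite big_seq big1 // => j jS; have [e|_] := eqVneq i j; last by rewrite mul0rn.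
  by move: iS; rewrite e jS.
rewrite big1 => [|i _]; last first.
  rewrite /indic memNset ?mul0rn // => /starts_with_cons[e _].
  by apply: hn; exists i.
apply/eqP; rewrite pnatr_eq0 eqb0; apply/negP => /andP[/allP hE /allP hF].
have hg j : gen ([::], Some j) x <-> source j x by rewrite source_gen.
have [||||i] := @coh_cluster _ _ _ (coherent_at x) [::] E F => //.
- by move=> j /hE; rewrite inE => /hg.
- by move=> k /hF /negP + /hg; rewrite inE; apply.
by move=> /starts_with_cons[e _]; apply: hn; exists i.
Qed.

Section Relations.
(** [Phi] is abstract so as to serve both for the map [iota] into the C*-algebra and for
    representations on a Hilbert space. *)
Variables (D : pzRingType) (st : D -> D) (Phi : (G -> C) -> D).
Hypothesis PhiD : forall f g, Cc f -> Cc g -> Phi (fun c => f c + g c) = Phi f + Phi g.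
Hypothesis PhiM : forall f g, Cc f -> Cc g -> Phi (convolution f g) = Phi f * Phi g.
Hypothesis Phi_star : forall f, Cc f -> Phi (Cc_star f) = st (Phi f).
Hypothesis Phi1 : Phi (theta [::] [::] (fun=> 1)) = 1.

(** [theta [::] [::] h] is [h] placed on the unit space: [J] is [Phi] restricted to the continuous
    functions on the path space. *)
Local Notation J h := (Phi (theta [::] [::] h)).
Local Notation S i := (Phi \1_(Sset A i)).

Lemma theta_add s t h (k : X -> C) c :
  theta s t (fun z => h z + k z) c = theta s t h c + theta s t k c.
Proof. by rewrite /theta; case: pselect => // _; rewrite addr0. Qed.

Lemma PhiJD h (k : X -> C) : continuous h -> continuous k ->
  J (fun z => h z + k z) = J h + J k.
Proof.
move=> hc kc; rewrite -PhiD; [|exact: theta_Cc|exact: theta_Cc].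
by congr Phi; apply/funext => c; exact: theta_add.
Qed.

Lemma PhiJ0 : J (fun=> 0) = 0.
Proof.
have c0 := @cst_continuousC 0.
apply: (addrI (J (fun=> 0))); rewrite addr0 -(PhiJD c0 c0).
by congr Phi; apply: theta_ext => z _ _; rewrite addr0.
Qed.

Lemma PhiJM h (k : X -> C) : continuous h -> continuous k ->
  J (fun z => h z * k z) = J h * J k.
Proof.
move=> hc kc; rewrite -PhiM; [|exact: theta_Cc|exact: theta_Cc].
rewrite (@convolution_thetar _ _ _ [::] [::] [::] [::]); congr Phi.
by apply: theta_ext => z _ _; rewrite /= mulr1.
Qed.

Lemma PhiJMn h n : continuous h -> J (fun z => h z *+ n) = J h *+ n.
Proof.
move=> hc; elim: n => [|n IH]; first by rewrite mulr0n -PhiJ0.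
have e : (fun z => h z *+ n.+1) = (fun z => h z + h z *+ n).
  by apply/funext => z; rewrite mulrS.
have c2 : continuous (fun z => h z *+ n).
  have -> : (fun z => h z *+ n) = (fun z => h z * n%:R).
    by apply/funext => y; rewrite mulr_natr.
  by apply: mulf_continuous; [exact: hc | exact: cst_continuousC].
by rewrite e (PhiJD hc c2) IH mulrS.
Qed.

Lemma PhiJ_sum (L : seq I) (F : I -> X -> C) : (forall i, continuous (F i)) ->
  J (fun z => \sum_(i <- L) F i z) = \sum_(i <- L) J (F i).
Proof.
move=> Fc; suff [] : continuous (fun z => \sum_(i <- L) F i z) /\
  J (fun z => \sum_(i <- L) F i z) = \sum_(i <- L) J (F i) by [].
elim: L => [|i L [IHc IH]].
  rewrite big_nil; have -> : (fun z => \sum_(i <- [::]) F i z) = (fun=> 0).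
    by apply/funext => z; rewrite big_nil.
  by split; [exact: cst_continuousC | exact: PhiJ0].
rewrite big_cons; have -> : (fun z => \sum_(j <- i :: L) F j z) =
    (fun z => F i z + \sum_(j <- L) F j z).
  by apply/funext => z; rewrite big_cons.
split; last by rewrite (PhiJD (Fc i) IHc) IH.
exact: addf_continuous (Fc i) IHc.
Qed.

Lemma prod_continuous (L : seq I) (F : I -> X -> C) : (forall i, continuous (F i)) ->
  continuous (fun z => \prod_(i <- L) F i z).
Proof.
move=> Fc; elim: L => [|i L IH].
  have -> : (fun z => \prod_(i <- [::]) F i z) = (fun=> 1).
    by apply/funext => z; rewrite big_nil.
  exact: cst_continuousC.
have -> : (fun z => \prod_(j <- i :: L) F j z) =
    (fun z => F i z * \prod_(j <- L) F j z).
  by apply/funext => z; rewrite big_cons.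
by apply: mulf_continuous; [exact: Fc | exact: IH].
Qed.

Lemma PhiJ_prod (L : seq I) (F : I -> X -> C) : (forall i, continuous (F i)) ->
  J (fun z => \prod_(i <- L) F i z) = \prod_(i <- L) J (F i).
Proof.
move=> Fc; elim: L => [|i L IH].
  rewrite big_nil -[RHS]Phi1; congr (J _).
  by apply/funext => z; rewrite big_nil.
have -> : (fun z => \prod_(j <- i :: L) F j z) =
    (fun z => F i z * \prod_(j <- L) F j z).
  by apply/funext => z; rewrite big_cons.
by rewrite big_cons (PhiJM (Fc i) (@prod_continuous L _ Fc)) IH.
Qed.

Lemma Phi_starS i : st (S i) = Phi (theta [::] [:: i] (fun=> 1)).
Proof.
rewrite -Phi_star; last exact: theta_one.
rewrite theta_Sset theta_star; congr Phi; apply: theta_ext => z _ _.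
exact: conjC1.
Qed.

Let c1 := @cst_continuousC 1.

Lemma Phi_range i : S i * st (S i) = J (indic (Zset [:: i])).
Proof.
rewrite Phi_starS theta_Sset -PhiM; [|exact: theta_Cc c1|exact: theta_Cc c1].
rewrite (@convolution_thetar _ _ _ [:: i] [::] [::] [:: i]) -push_cst1.
rewrite -(@theta_rcons _ _ _ [::] [::] i); congr Phi.
by apply: theta_ext => z _ _; rewrite /= !mulr1.
Qed.

Lemma Phi_source i : st (S i) * S i = J (indic (source i)).
Proof.
rewrite Phi_starS theta_Sset -PhiM; [|exact: theta_Cc c1|exact: theta_Cc c1].
rewrite (@convolution_thetar _ _ _ [::] [:: i] [::] [::]) -pull_cst1; congr Phi.
by apply: theta_ext => z _ _; rewrite /= !mulr1 mul1r.
Qed.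

Let Zc i : continuous (indic (@Zset I A [:: i])).
Proof. exact: indic_continuous (@gen_clopen I A ([:: i], None)). Qed.
Let Dc i : continuous (indic (@source I A i)).
Proof. exact: indic_continuous (@source_clopen I A i). Qed.

Lemma Phi_partial_isometry i : partial_isometry st (S i).
Proof.
rewrite /partial_isometry Phi_range theta_Sset -PhiM;
  [|by apply: theta_Cc; exact: Zc|by apply: theta_Cc; exact: c1].
rewrite (@convolution_thetar _ _ _ [::] [::] [:: i] [::]); congr Phi.
apply: theta_ext => z [_ hz] _; rewrite pull_word_in //= !mulr1 /indic mem_set //.
exact: starts_with_cons_path.
Qed.

Lemma Phi_cuntz_krieger : cuntz_krieger st A (fun i => S i).
Proof.
split=> [i j|i j ij|i j|E F fin].
- rewrite !Phi_source -(PhiJM (@Dc i) (@Dc j)) -(PhiJM (@Dc j) (@Dc i)).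
  by congr (J _); apply/funext => z; rewrite mulrC.
- rewrite !Phi_range -(PhiJM (@Zc i) (@Zc j)) -PhiJ0.
  congr (J _); apply/funext => z; rewrite /indic.
  have [|_] := boolP (z \in Zset [:: i]); last by rewrite mul0r.
  have [|_] := boolP (z \in Zset [:: j]); last by rewrite mulr0.
  rewrite !inE => /starts_with_cons[e _] /starts_with_cons[]; rewrite e => -[e' _].
  by rewrite e' eqxx in ij.
- rewrite Phi_range Phi_source -(PhiJM (@Zc j) (@Dc i)) -(PhiJMn _ (@Zc j)).
  congr (J _); apply/funext => z; rewrite /indic.
  have [|_] := boolP (z \in Zset [:: j]); last by rewrite mul0r mul0rn.
  rewrite inE => /starts_with_cons[e _]; rewrite mul1r.
  congr (nat_of_bool _)%:R; apply/idP/idP; rewrite inE /source /= (Iset_entry e) //.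
(* Each factor [1 - Q k] is written as a sum, as [Phi] is only assumed additive; the sign is
   recovered below by cancellation. *)
transitivity (J (fun z => \prod_(j <- E) indic (source j) z *
    \prod_(k <- F) (1 + -1 * indic (source k) z))).
  have BDc i : continuous (fun z => 1 + -1 * indic (@source I A i) z).
    apply: addf_continuous; first exact: c1.
    by apply: mulf_continuous; [exact: cst_continuousC | exact: Dc].
  rewrite (PhiJM (@prod_continuous E _ (@Dc)) (@prod_continuous F _ BDc)).
  rewrite (PhiJ_prod _ (@Dc)) (PhiJ_prod _ BDc).
  congr (_ * _); apply: eq_bigr => i _; rewrite Phi_source //.
  have c2 : continuous (fun z => -1 * indic (@source I A i) z).
    by apply: mulf_continuous; [exact: cst_continuousC | exact: Dc].
  rewrite (PhiJD c1 c2) Phi1; congr (1 + _).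
  apply/esym/eqP; rewrite -addr_eq0 -(PhiJD c2 (@Dc i)) -PhiJ0; apply/eqP.
  by congr (J _); apply/funext => z; rewrite mulN1r addNr.
have hS i : [set: I] i -> i \notin (fset_set [set i | AEF A E F i != 0%N] : seq I) ->
    S i * st (S i) *+ AEF A E F i = 0.
  move=> _ iS; have [->|h] := eqVneq (AEF A E F i) 0%N; first by rewrite mulr0n.
  by case/negP: iS; rewrite in_fset_set // inE.
rewrite (fsum_seq (fset_uniq _) hS); last by move=> i _ [].
under eq_bigr do rewrite Phi_range -(PhiJMn _ (@Zc _)).
rewrite -PhiJ_sum => [|i]; last first.
  have -> : (fun z => indic (Zset [:: i]) z *+ AEF A E F i) =
      (fun z => indic (@Zset I A [:: i]) z * (AEF A E F i)%:R).
    by apply/funext => y; rewrite mulr_natr.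
  by apply: mulf_continuous; [exact: Zc | exact: cst_continuousC].
congr (J _); apply/funext => z; rewrite -CK4_pointwise //; congr (_ * _).
by apply: eq_bigr => k _; rewrite mulN1r.
Qed.

End Relations.
End GroupoidRelations.

(** * The operators attached to the convolution algebra by a Cuntz-Krieger family *)

Section RepresentationOfFamily.
Variables (R : realType) (I : countType) (A : rel I) (H : hilbertSpace R).
Local Notation C := (Cplx R).
Local Notation X := (terminalPath A).
Local Notation G := (drGroupoid (path_shift A)).
Variable u : I -> bop H.
Hypothesis u_pi : forall i, partial_isometry (@adjoint R H) (u i).
Hypothesis u_ck : cuntz_krieger (@adjoint R H) A u.
Implicit Types (z : X) (s t v w : seq I) (h k : X -> C) (f g : G -> C).

Local Notation phi := (@ck_phi R I A H u).

Fixpoint word_op s : bop H := if s is i :: s' then u i * word_op s' else 1.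

Lemma word_op_cat s t : word_op (s ++ t) = word_op s * word_op t.
Proof. by elim: s => [|i s IH] /=; rewrite ?mul1r // IH mulrA. Qed.

Lemma phi_pull_word s h : continuous h ->
  phi h * word_op s = word_op s * phi (pull_word s h).
Proof.
elim: s h => [|i s IH] h hc /=; first by rewrite mulr1 mul1r.
by rewrite mulrA (ck_phi_pull u_pi u_ck i hc) -!mulrA (IH _ (pull_continuous hc)).
Qed.

Lemma phi_one : phi (fun=> 1) = 1.
Proof. by rewrite (ck_phi_cst u_pi u_ck) scale1r. Qed.

Lemma phi_zero : phi (fun=> 0) = 0.
Proof. by rewrite (ck_phi_cst u_pi u_ck) scale0r. Qed.

Let c1 := @cst_continuousC I A R 1.

Lemma word_op_adj_phi s h : continuous h ->
  adjoint (word_op s) * phi h = phi (pull_word s h) * adjoint (word_op s).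
Proof.
move=> hc; have cc := conjf_continuous hc.
have /(congr1 (@adjoint R H)) := phi_pull_word s cc.
rewrite !adjointM -(ck_phi_conj u_pi u_ck cc).
rewrite -(ck_phi_conj u_pi u_ck (pull_word_continuous cc)) => e.
have -> : h = (fun z => Num.conj (Num.conj (h z))).
  by apply/funext => z; rewrite conjCK.
rewrite e; congr (phi _ * _); apply/funext => z.
have [d|d] := pselect (dom s z); first by rewrite !pull_word_in.
by rewrite !pull_word_out // conjC0.
Qed.

Lemma word_op_source s : adjoint (word_op s) * word_op s = phi (pull_word s (fun=> 1)).
Proof.
elim: s => [|i s IH] /=; first by rewrite adjoint1 mulr1 phi_one.
rewrite adjointM -mulrA (mulrA (adjoint (u i))).
have -> : adjoint (u i) * u i = phi (pull i (fun=> 1)).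
  by rewrite pull_cst1 source_gen /indic (ck_phi_gen u_pi u_ck).
have pc := @pull_continuous I A R i _ c1.
rewrite (phi_pull_word _ pc) mulrA IH.
rewrite -(ck_phiM u_pi u_ck (pull_word_continuous c1) (pull_word_continuous pc)).
congr (phi _); apply/funext => z; have [d|d] := pselect (dom s z).
  by rewrite !pull_word_in // mul1r.
by rewrite !pull_word_out // mul0r.
Qed.

(** The common prefix [p] contributes a function, which covariance carries across [u_j]; then
    [u_i^* u_j = 0] appears. *)
Lemma word_op_incomparable p i j w w' : i != j ->
  adjoint (word_op (p ++ i :: w)) * word_op (p ++ j :: w') = 0.
Proof.
move=> ij; rewrite !word_op_cat adjointM -mulrA (mulrA (adjoint (word_op p))).
rewrite word_op_source /= adjointM.
have pc := @pull_word_continuous I A R p _ c1.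
rewrite (mulrA (phi _)) (ck_phi_pull u_pi u_ck j pc) !mulrA.
by rewrite -(mulrA _ (adjoint (u i)) (u j)) (ua_u u_pi u_ck ij) mulr0 !mul0r.
Qed.

Definition theta_op s t h : bop H := word_op s * phi h * adjoint (word_op t).

Lemma theta_opE s t h : theta_op s t h = word_op s * phi h * adjoint (word_op t).
Proof. by []. Qed.

(** The indicator of [dom s] is absorbed by [u_s], because covariance applied to the constant [1]
    gives [u_s = u_s phi(1_{dom s})]. *)
Lemma word_op_phi s h : continuous h ->
  word_op s * phi (fun z => pull_word s (fun=> 1) z * h z) = word_op s * phi h.
Proof.
move=> hc; have pc := @pull_word_continuous I A R s _ c1.
rewrite (ck_phiM u_pi u_ck pc hc) mulrA -(phi_pull_word s c1) phi_one.
by rewrite mul1r.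
Qed.

Lemma phi_word_op s h : continuous h ->
  phi (fun z => h z * pull_word s (fun=> 1) z) * adjoint (word_op s) =
  phi h * adjoint (word_op s).
Proof.
move=> hc; have pc := @pull_word_continuous I A R s _ c1.
rewrite (ck_phiM u_pi u_ck hc pc) -mulrA; congr (_ * _).
by rewrite -(word_op_adj_phi s c1) phi_one mulr1.
Qed.

(** Hence the operator depends only on the function [theta s t h], which ignores [h] outside [dom s]
    and [dom t]. *)
Lemma theta_op_ext s t h k : continuous h -> continuous k ->
  (forall z, dom s z -> dom t z -> h z = k z) -> theta_op s t h = theta_op s t k.
Proof.
move=> hc kc e; rewrite /theta_op.
rewrite -(word_op_phi s hc) -(word_op_phi s kc) -!mulrA.
have ps := @pull_word_continuous I A R s _ c1.
rewrite -(phi_word_op t (mulf_continuous ps hc)).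
rewrite -(phi_word_op t (mulf_continuous ps kc)).
congr (_ * (phi _ * _)); apply/funext => z.
have [ds|ds] := pselect (dom s z); last by rewrite pull_word_out // !mul0r.
have [dt|dt] := pselect (dom t z); last by rewrite [pull_word t _ _]pull_word_out // !mulr0.
by rewrite e.
Qed.

Lemma theta_op_rcons s t i h : continuous h ->
  theta_op (rcons s i) (rcons t i) h = theta_op s t (push i h).
Proof.
move=> hc; rewrite /theta_op (ck_phi_push u_pi u_ck i hc) -!cats1 !word_op_cat /=.
by rewrite !mulr1 adjointM !mulrA.
Qed.

Lemma theta_op_star s t h : continuous h ->
  adjoint (theta_op s t h) = theta_op t s (fun z => Num.conj (h z)).
Proof.
by move=> hc; rewrite /theta_op !adjointM adjointK -(ck_phi_conj u_pi u_ck hc) mulrA.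
Qed.

(** The operator side of [convolution_thetar], with the same function on the right: [u_t^* u_t] is
    the image of the indicator of [dom t]. *)
Lemma theta_opMr s t w v h k : continuous h -> continuous k ->
  theta_op s t h * theta_op (t ++ w) v k = theta_op (s ++ w) v
    (fun z => pull_word w (fun y => h y * pull_word t (fun=> 1) y) z * k z).
Proof.
move=> hc kc; have pt := @pull_word_continuous I A R t _ c1.
have hpt := mulf_continuous hc pt.
rewrite /theta_op !word_op_cat.
rewrite (ck_phiM u_pi u_ck (pull_word_continuous hpt) kc).
rewrite -!mulrA (mulrA (adjoint (word_op t))) word_op_source.
congr (word_op s * _); rewrite !mulrA; congr (_ * _ * _).
by rewrite -(ck_phiM u_pi u_ck hc pt) (phi_pull_word _ hpt).
Qed.

Lemma theta_opMl s t w v h k : continuous h -> continuous k ->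
  theta_op s (t ++ w) h * theta_op t v k = theta_op s (v ++ w)
    (fun z => h z * pull_word w (fun y => pull_word t (fun=> 1) y * k y) z).
Proof.
move=> hc kc; have pt := @pull_word_continuous I A R t _ c1.
have ptk := mulf_continuous pt kc.
rewrite /theta_op !word_op_cat !adjointM.
rewrite (ck_phiM u_pi u_ck hc (pull_word_continuous ptk)).
rewrite -!mulrA; congr (_ * (_ * _)).
rewrite (mulrA (adjoint (word_op t))) word_op_source.
rewrite (mulrA (phi (pull_word t _))) -(ck_phiM u_pi u_ck pt kc) !mulrA.
by rewrite (word_op_adj_phi _ ptk).
Qed.

(** Only reduced pairs occur, so that each arrow is counted once; for [f] in [Cc] the coefficients
    vanish outside finitely many pairs. *)
Definition rep f : bop H := \sum_(p \in [set p : seq I * seq I | reduced p.1 p.2])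
  theta_op p.1 p.2 (coef f p.1 p.2).

Lemma repE f (L : seq (seq I * seq I)) : uniq L ->
  (forall p, p \in L -> reduced p.1 p.2) ->
  (forall p, reduced p.1 p.2 -> p \notin L -> forall z, coef f p.1 p.2 z = 0) ->
  rep f = \sum_(p <- L) theta_op p.1 p.2 (coef f p.1 p.2).
Proof.
move=> uL Lr hL; rewrite /rep (fsum_seq uL) //; last by move=> p /Lr.
move=> p r pL; have -> : coef f p.1 p.2 = (fun=> 0) by apply/funext => z; exact: hL.
by rewrite /theta_op phi_zero mulr0 mul0r.
Qed.

Lemma theta_opD s t h k : continuous h -> continuous k ->
  theta_op s t (fun z => h z + k z) = theta_op s t h + theta_op s t k.
Proof.
by move=> hc kc; rewrite /theta_op (ck_phiD u_pi u_ck hc kc) mulrDr mulrDl.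
Qed.

Lemma theta_opZ s t a h : continuous h ->
  theta_op s t (fun z => a * h z) = a *: theta_op s t h.
Proof.
move=> hc; rewrite /theta_op (ck_phiM u_pi u_ck (@cst_continuousC I A R a) hc).
by rewrite (ck_phi_cst u_pi u_ck) bop_scaleAl mul1r bop_scaleAr bop_scaleAl.
Qed.

Lemma rep_linear a f g : Cc f -> Cc g ->
  rep (fun c => a * f c + g c) = a *: rep f + rep g.
Proof.
move=> hf hg; have [L [uL Lr L0 _]] := Cc_decomposition hf.
have [L' [uL' Lr' L0' _]] := Cc_decomposition hg.
pose M := undup (L ++ L').
have uM : uniq M by exact: undup_uniq.
have Mr p : p \in M -> reduced p.1 p.2.
  by rewrite mem_undup mem_cat => /orP[/Lr|/Lr'].
have ML p : p \notin M -> (p \notin L) && (p \notin L').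
  by rewrite mem_undup mem_cat negb_or.
have M0 p : reduced p.1 p.2 -> p \notin M -> forall z, coef f p.1 p.2 z = 0.
  by move=> r /ML/andP[pL _]; exact: L0.
have M0' p : reduced p.1 p.2 -> p \notin M -> forall z, coef g p.1 p.2 z = 0.
  by move=> r /ML/andP[_ pL]; exact: L0'.
have ce s t z : coef (fun c => a * f c + g c) s t z = a * coef f s t z + coef g s t z.
  by rewrite /coef /restr; case: pselect => //= _; rewrite mulr0 addr0.
rewrite (repE uM Mr M0) (repE uM Mr M0') (repE uM Mr); last first.
  by move=> p r pM z; rewrite ce M0 // M0' // mulr0 addr0.
rewrite scaler_sumr -big_split /=; apply: eq_bigr => p _.
have cf := @coef_continuous _ _ _ _ p.1 p.2 hf.1.
have cg := @coef_continuous _ _ _ _ p.1 p.2 hg.1.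
have cm := mulf_continuous (@cst_continuousC I A R a) cf.
rewrite -(theta_opZ _ _ _ cf) -(theta_opD _ _ cm cg).
by congr theta_op; apply/funext => z; exact: ce.
Qed.

(** For a reduced pair a single term remains. The other pairs are reached by [theta_rcons] and its
    operator counterpart [theta_op_rcons], the consistency that products require. *)
Lemma rep_theta s t h : continuous h -> rep (theta s t h) = theta_op s t h.
Proof.
apply: (@theta_ind _ _ _ (fun s t h => rep (theta s t h) = theta_op s t h)) => {s t h}.
  move=> s t h r hc; rewrite (@repE _ [:: (s, t)]) //.
  - rewrite big_seq1 /=; apply: theta_op_ext; [|exact: hc|].
      by apply: coef_continuous; exact: theta_continuous.
    move=> z ds dt; have a := arrP ds dt.
    by rewrite (coef_in _ a) (theta_in _ a).
  - by move=> p; rewrite inE => /eqP ->.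
  move=> [s' t'] /= r' ne z; rewrite inE in ne.
  have [[ds dt]|] := pselect (dom s' z /\ dom t' z); last exact: coef_out.
  have a := arrP ds dt; rewrite (coef_in _ a); apply: theta_out => -[z' a'].
  by have [e1 e2] := arr_rel_uniq r' r a a'; rewrite e1 e2 eqxx in ne.
by move=> s t i h hc IH; rewrite theta_rcons IH (theta_op_rcons _ _ _ hc).
Qed.

End RepresentationOfFamily.

(** * Finiteness of factorisations and bilinearity of the convolution *)

Section ConvolutionBilinear.
Variables (I : countType) (A : rel I) (R : realType).
Local Notation C := (Cplx R).
Local Notation X := (terminalPath A).
Local Notation G := (drGroupoid (path_shift A)).
Implicit Types (s t v w : seq I) (a b c : G) (h k : X -> C) (f g : G -> C).

Lemma Cc_zero : Cc (fun _ : G => 0 : C).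
Proof. by split; [exact: cst_continuous | exists set0 => //; exact: compact0]. Qed.

Lemma Cc_add f g : Cc f -> Cc g -> Cc (fun c => f c + g c).
Proof.
move=> [fc [K Kc hK]] [gc [L Lc hL]]; split; first exact: addf_continuous fc gc.
exists (K `|` L); first exact: compactU.
by move=> c h; rewrite hK ?hL ?addr0 // => hc; apply: h; [right | left].
Qed.

Lemma Cc_sum (J : Type) (L : seq J) (F : J -> G -> C) : (forall j, Cc (F j)) ->
  Cc (fun c => \sum_(j <- L) F j c).
Proof.
move=> hF; elim: L => [|j L IH].
  have -> : (fun c => \sum_(j <- [::]) F j c) = (fun=> 0).
    by apply/funext => c; rewrite big_nil.
  exact: Cc_zero.
have -> : (fun c => \sum_(i <- j :: L) F i c) =
    (fun c => F j c + \sum_(i <- L) F i c).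
  by apply/funext => c; rewrite big_cons.
exact: Cc_add.
Qed.

Lemma additive_sum (V : zmodType) (Phi : (G -> C) -> V)
    (PhiD : forall f g, Cc f -> Cc g -> Phi (fun c => f c + g c) = Phi f + Phi g)
    (J : Type) (L : seq J) (F : J -> G -> C) : (forall j, Cc (F j)) ->
  Phi (fun c => \sum_(j <- L) F j c) = \sum_(j <- L) Phi (F j).
Proof.
move=> hF; elim: L => [|j L IH].
  have -> : (fun c => \sum_(j <- [::]) F j c) = (fun=> 0).
    by apply/funext => c; rewrite big_nil.
  rewrite big_nil; apply: (addrI (Phi (fun=> 0))).
  rewrite addr0 -(PhiD _ _ Cc_zero Cc_zero); congr Phi.
  by apply/funext => c; rewrite addr0.
have -> : (fun c => \sum_(i <- j :: L) F i c) =
    (fun c => F j c + \sum_(i <- L) F i c).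
  by apply/funext => c; rewrite big_cons.
by rewrite big_cons (PhiD _ _ (hF j) (Cc_sum L hF)) IH.
Qed.

Lemma Cc_theta_sum f : Cc f -> exists L : seq (seq I * seq I),
  f = (fun c => \sum_(p <- L) theta p.1 p.2 (coef f p.1 p.2) c).
Proof. by move=> /Cc_decomposition[L [_ _ _ e]]; exists L; apply/funext. Qed.

(** A sum with infinite support takes a default value, so that additivity of the convolution first
    needs these sets to be finite. *)
Definition factorisations f c : set (G * G) :=
  [set p | is_product p.1 p.2 c /\ f p.1 != 0].

(** A left factor has the range of [c], a bisection contains at most one such arrow, and the left
    factor determines the right one. *)
Lemma factorisations_theta s t h c : finite_set (factorisations (theta s t h) c).
Proof.
have [[p0 [p0c n0]]|hn] := pselect (exists p, factorisations (theta s t h) c p).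
  apply: (@sub_finite_set _ _ [set p0]); last exact: finite_set1.
  move=> [a b] /= [abc n].
  case: p0 p0c n0 => a0 b0 /= abc0 n0.
  have [[z e]|na] := pselect (bis s t a); last by move: n; rewrite theta_out // eqxx.
  have [[z0 e0]|na] := pselect (bis s t a0); last by move: n0; rewrite theta_out // eqxx.
  have [p1 p2 p3 p4] := abc; have [q1 q2 q3 q4] := abc0.
  have [ds dt r1 r2 r3] := e; have [ds0 dt0 r10 r20 r30] := e0.
  have ez : z = z0 by apply: (prepend_inj ds ds0); rewrite -r1 -r10 -p2 -q2.
  subst z0; have ea : a = a0 by exact: arr_rel_fun e e0.
  subst a0; congr pair; apply: arrow_inj; [by rewrite -p1 -q1| |by rewrite -p3 -q3].
  by apply: (addrI (deg a)); rewrite -p4 -q4.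
suff -> : factorisations (theta s t h) c = set0 by exact: finite_set0.
by apply/seteqP; split=> // p hp; apply: hn; exists p.
Qed.

Lemma factorisations_Cc f c : Cc f -> finite_set (factorisations f c).
Proof.
move=> /Cc_theta_sum[L e].
apply: (@sub_finite_set _ _ (\bigcup_(p in [set` L])
    factorisations (theta p.1 p.2 (coef f p.1 p.2)) c)); last first.
  apply: bigcup_finite; first exact: finite_seq.
  by move=> p _; exact: factorisations_theta.
move=> p [pc /eqP n]; apply: contrapT => hn; apply: n; rewrite e.
rewrite big_seq big1 // => q qL; apply/eqP; apply: contraT => nq.
by case: hn; exists q => //; split.
Qed.

Lemma convolution_seq f g c (M : seq (G * G)) : uniq M ->
  (forall p, factorisations f c p -> p \in M) ->
  (forall p, p \in M -> is_product p.1 p.2 c) ->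
  convolution f g c = \sum_(p <- M) f p.1 * g p.2.
Proof.
move=> uM h1 h2; apply: fsum_seq => // [p pc|p /h2 //].
by apply: contraNeq => n; apply: h1; split=> //; apply: contra_neq n => ->; rewrite mul0r.
Qed.

Lemma convolution_addl f1 f2 g : Cc f1 -> Cc f2 ->
  convolution (fun c => f1 c + f2 c) g =
  fun c => convolution f1 g c + convolution f2 g c.
Proof.
move=> h1 h2; apply/funext => c.
have F1 := factorisations_Cc c h1; have F2 := factorisations_Cc c h2.
pose M := fset_set (factorisations f1 c `|` factorisations f2 c).
have hM p : (p \in M) = (p \in factorisations f1 c `|` factorisations f2 c).
  by rewrite in_fset_set // finite_setU.
have uM : uniq M by exact: fset_uniq.
have M2 p : p \in (M : seq _) -> is_product p.1 p.2 c.
  by rewrite hM inE => -[] [].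
rewrite !(@convolution_seq _ _ _ M) //.
- by rewrite -big_split; apply: eq_bigr => p _; rewrite /= mulrDl.
- by move=> p hp; rewrite hM inE; right.
- by move=> p hp; rewrite hM inE; left.
move=> p [pc n]; rewrite hM inE; have [e|n1] := eqVneq (f1 p.1) 0; last by left.
by right; split=> //; apply: contra_neq n => e'; rewrite e e' addr0.
Qed.

Lemma convolution_addr f g1 g2 : Cc f ->
  convolution f (fun c => g1 c + g2 c) =
  fun c => convolution f g1 c + convolution f g2 c.
Proof.
move=> h; apply/funext => c; have F := factorisations_Cc c h.
pose M := fset_set (factorisations f c).
have hM p : (p \in M) = (p \in factorisations f c) by rewrite in_fset_set.
have M2 p : p \in (M : seq _) -> is_product p.1 p.2 c by rewrite hM inE => -[].
rewrite !(@convolution_seq _ _ _ M) //; try exact: fset_uniq;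
  try by move=> p hp; rewrite hM inE.
by rewrite -big_split; apply: eq_bigr => p _; rewrite /= mulrDr.
Qed.

Lemma convolution_suml (J : Type) (L : seq J) (F : J -> G -> C) g :
  (forall j, Cc (F j)) ->
  convolution (fun c => \sum_(j <- L) F j c) g =
  fun c => \sum_(j <- L) convolution (F j) g c.
Proof.
move=> hF; elim: L => [|j L IH].
  apply/funext => c; rewrite big_nil; apply: convolution_zero => a b _.
  by rewrite big_nil mul0r.
transitivity (convolution (fun c => F j c + \sum_(i <- L) F i c) g).
  by congr convolution; apply/funext => c; rewrite big_cons.
rewrite (convolution_addl _ (hF j) (Cc_sum L hF)) IH.
by apply/funext => c; rewrite big_cons.
Qed.

Lemma convolution_sumr (J : Type) (L : seq J) (F : J -> G -> C) f : Cc f ->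
  convolution f (fun c => \sum_(j <- L) F j c) =
  fun c => \sum_(j <- L) convolution f (F j) c.
Proof.
move=> hf; elim: L => [|j L IH].
  apply/funext => c; rewrite big_nil; apply: convolution_zero => a b _.
  by rewrite big_nil mulr0.
transitivity (convolution f (fun c => F j c + \sum_(i <- L) F i c)).
  by congr convolution; apply/funext => c; rewrite big_cons.
rewrite (convolution_addr _ _ hf) IH.
by apply/funext => c; rewrite big_cons.
Qed.

Lemma Cc_star_sum (J : Type) (L : seq J) (F : J -> G -> C) :
  Cc_star (fun c => \sum_(j <- L) F j c) = fun c => \sum_(j <- L) Cc_star (F j) c.
Proof. by apply/funext => c; rewrite /Cc_star rmorph_sum. Qed.

Lemma convolution_theta_Cc s t t' v h k : continuous h -> continuous k ->
  Cc (convolution (theta s t h) (theta t' v k)).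
Proof.
move=> hc kc; have c1 := @cst_continuousC I A R 1.
case: (word_cases t t') => [[w ->]|[w ->]|[p [i [j [w [w' [-> -> ij]]]]]]].
- have pt := @pull_word_continuous I A R t _ c1.
  rewrite convolution_thetar; apply: theta_Cc.
  exact: mulf_continuous (pull_word_continuous (mulf_continuous hc pt)) kc.
- have pt := @pull_word_continuous I A R t' _ c1.
  rewrite convolution_thetal; apply: theta_Cc.
  exact: mulf_continuous hc (pull_word_continuous (mulf_continuous pt kc)).
rewrite convolution_theta0; first exact: Cc_zero.
by move=> z1 z2; exact: prepend_incomparable.
Qed.

End ConvolutionBilinear.

(** * Multiplicativity, adjoints and nondegeneracy of the representation *)

Section RepIsRepresentation.
Variables (R : realType) (I : countType) (A : rel I) (H : hilbertSpace R).
Local Notation C := (Cplx R).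
Local Notation X := (terminalPath A).
Local Notation G := (drGroupoid (path_shift A)).
Variable u : I -> bop H.
Hypothesis u_pi : forall i, partial_isometry (@adjoint R H) (u i).
Hypothesis u_ck : cuntz_krieger (@adjoint R H) A u.
Local Notation rep := (@rep R I A H u).
Local Notation theta_op := (@theta_op R I A H u).

Lemma repD f g : Cc f -> Cc g -> rep (fun c => f c + g c) = rep f + rep g.
Proof.
move=> hf hg; rewrite -[rep f]scale1r -(rep_linear u_pi u_ck 1 hf hg).
by congr rep; apply/funext => c; rewrite mul1r.
Qed.

Lemma rep_convolution_theta s t t' v (h k : X -> C) : continuous h -> continuous k ->
  rep (convolution (theta s t h) (theta t' v k)) = theta_op s t h * theta_op t' v k.
Proof.
move=> hc kc; have c1 := @cst_continuousC I A R 1.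
case: (word_cases t t') => [[w ->]|[w ->]|[p [i [j [w [w' [-> -> ij]]]]]]].
- have pt := @pull_word_continuous I A R t _ c1.
  have mc := mulf_continuous (@pull_word_continuous I A R w _ (mulf_continuous hc pt)) kc.
  by rewrite convolution_thetar (rep_theta u_pi u_ck _ _ mc) (theta_opMr u_pi u_ck _ _ _ _ hc kc).
- have pt := @pull_word_continuous I A R t' _ c1.
  have mc := mulf_continuous hc (@pull_word_continuous I A R w _ (mulf_continuous pt kc)).
  by rewrite convolution_thetal (rep_theta u_pi u_ck _ _ mc) (theta_opMl u_pi u_ck _ _ _ _ hc kc).
rewrite convolution_theta0; last by move=> z1 z2; exact: prepend_incomparable.
have -> : (fun _ : G => 0 : C) = theta [::] [::] (fun=> 0).
  apply/funext => c; have [[z a]|n] := pselect (bis [::] [::] c).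
    by rewrite (theta_in _ a).
  by rewrite theta_out.
rewrite (rep_theta u_pi u_ck _ _ (@cst_continuousC I A R 0)).
rewrite !theta_opE (phi_zero u_pi u_ck) mulr0 mul0r.
rewrite -!mulrA (mulrA (adjoint _)) (word_op_incomparable u_pi u_ck _ _ _ ij).
by rewrite mul0r !mulr0.
Qed.

Lemma rep_sum (L : seq (seq I * seq I)) (F : seq I * seq I -> X -> C) :
  (forall p, continuous (F p)) ->
  rep (fun c => \sum_(p <- L) theta p.1 p.2 (F p) c) =
  \sum_(p <- L) theta_op p.1 p.2 (F p).
Proof.
move=> hF; rewrite (additive_sum repD L (fun p => theta_Cc p.1 p.2 (hF p))).
by apply: eq_bigr => p _; rewrite (rep_theta u_pi u_ck _ _ (hF p)).
Qed.

Lemma rep_is_Cc_rep : is_Cc_rep rep.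
Proof.
have c1 := @cst_continuousC I A R 1.
split.
- exact: rep_linear u_pi u_ck.
- move=> f g hf hg; have [L ef] := Cc_theta_sum hf; have [M eg] := Cc_theta_sum hg.
  have cf p : continuous (coef f p.1 p.2) := @coef_continuous _ _ _ _ p.1 p.2 hf.1.
  have cg p : continuous (coef g p.1 p.2) := @coef_continuous _ _ _ _ p.1 p.2 hg.1.
  have e1 : rep f = \sum_(p <- L) theta_op p.1 p.2 (coef f p.1 p.2).
    by rewrite [in LHS]ef (rep_sum _ cf).
  have e2 : rep g = \sum_(p <- M) theta_op p.1 p.2 (coef g p.1 p.2).
    by rewrite [in LHS]eg (rep_sum _ cg).
  have -> : convolution f g = (fun c => \sum_(p <- L) \sum_(q <- M)
      convolution (theta p.1 p.2 (coef f p.1 p.2)) (theta q.1 q.2 (coef g q.1 q.2)) c).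
    rewrite [in LHS]ef (convolution_suml _ _ (fun p => theta_Cc p.1 p.2 (cf p))).
    apply/funext => c; apply: eq_bigr => p _; rewrite [in LHS]eg.
    by rewrite (convolution_sumr _ _ (theta_Cc _ _ (cf p))).
  rewrite (additive_sum repD) => [|p]; last first.
    by apply: Cc_sum => q; exact: convolution_theta_Cc (cf p) (cg q).
  rewrite e1 e2 mulr_suml; apply: eq_bigr => p _.
  rewrite (additive_sum repD) => [|q]; last exact: convolution_theta_Cc (cf p) (cg q).
  rewrite mulr_sumr; apply: eq_bigr => q _.
  exact: rep_convolution_theta (cf p) (cg q).
- move=> f hf; have [L ef] := Cc_theta_sum hf.
  have cf p : continuous (coef f p.1 p.2) := @coef_continuous _ _ _ _ p.1 p.2 hf.1.
  have e1 : rep f = \sum_(p <- L) theta_op p.1 p.2 (coef f p.1 p.2).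
    by rewrite [in LHS]ef (rep_sum _ cf).
  rewrite e1 adjoint_sum {1}ef Cc_star_sum.
  rewrite (additive_sum repD) => [|p]; last first.
    by rewrite theta_star; apply: theta_Cc; exact: conjf_continuous (cf p).
  apply: eq_bigr => p _; rewrite theta_star (theta_op_star u_pi u_ck _ _ (cf p)).
  by rewrite (rep_theta u_pi u_ck _ _ (conjf_continuous (cf p))).
(* Nondegeneracy holds because the unit of the convolution algebra is sent to [1]. *)
apply/seteqP; split=> // w _; apply: subset_closure.
exists [:: (1 : bop H, w)]; last by rewrite big_seq1.
move=> p; rewrite inE => /eqP -> /=; exists (theta [::] [::] (fun=> 1)).
  exact: theta_Cc c1.
rewrite (rep_theta u_pi u_ck _ _ c1) theta_opE /= (phi_one u_pi u_ck).
by rewrite adjoint1 !mulr1.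
Qed.

Lemma rep_Sset i : rep \1_(Sset A i) = u i.
Proof.
have c1 := @cst_continuousC I A R 1.
rewrite theta_Sset (rep_theta u_pi u_ck _ _ c1) theta_opE /=.
by rewrite (phi_one u_pi u_ck) adjoint1 !mulr1.
Qed.

End RepIsRepresentation.

(** * A representation of the convolution algebra is determined by the images of the [S_i] *)

Section Uniqueness.
Variables (R : realType) (I : countType) (A : rel I).
Local Notation C := (Cplx R).
Local Notation X := (terminalPath A).
Local Notation G := (drGroupoid (path_shift A)).
Implicit Types (f g : G -> C).

Lemma convolution_unit f : convolution (theta [::] [::] (fun=> 1)) f = f.
Proof.
apply/funext => c.
have a0 : arr_rel [::] [::] (rg c) (arr [::] [::] (rg c)) by exact: arrP.
have [_ _ e1 e2 e3] := a0.
rewrite (@convolution_single _ _ _ _ _ c (arr [::] [::] (rg c)) c).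
- by rewrite (theta_in _ a0) mul1r.
- by split; rewrite ?e1 ?e2 ?e3 //= subrr add0r.
move=> a' b' [p1 p2 p3 p4] ne.
have [[z a]|n] := pselect (bis [::] [::] a'); last first.
  by move: ne; rewrite theta_out // mul0r eqxx.
have [_ _ q1 q2 q3] := a.
have ez : z = rg c by rewrite p2 q1.
subst z; split; first exact: arr_rel_fun a a0.
by apply: arrow_inj; rewrite -?p1 ?q2 // p4 q3 subrr add0r.
Qed.

Section OneRep.
Variables (H : hilbertSpace R) (p : (G -> C) -> bop H).
Hypothesis hp : is_Cc_rep p.

(** [E] fixes every vector [T x] with [T] in [L], hence their dense span, and it is bounded. *)
Lemma nondegenerate_unit (L : set (bop H)) (E : bop H) :
  Defs.nondegenerate L -> (forall T, L T -> E * T = T) -> E = 1.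
Proof.
move=> hL hE; apply: bop_ext => w; have [K K0 hK] := bop_bounded E.
apply: (@nrm_eqM _ _ _ _ (K + 1)) => [|d d0]; first by rewrite addr_ge0 // ltW.
have : closure [set w : H | exists2 s : seq (bop H * H),
    (forall q, q \in s -> L q.1) & w = \sum_(q <- s) q.1 q.2] w by rewrite hL.
move=> /(_ [set y | nrm (y - w) < d]) []; first by apply/nbhs_nrmP; exists d.
move=> y [[s hs ey] /= /ltW yw].
have Ey : E y = y.
  rewrite ey bop_sum big_seq [RHS]big_seq; apply: eq_bigr => q /hs /hE {2}<-.
  by [].
apply: (le_trans (nrm_dist (E y) _ _)).
rewrite -bopB Ey mulrDr mulr1 lerD // (le_trans (hK _)) // mulrC nrm_distC.
by rewrite ler_wpM2r // ltW.
Qed.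

Let c1 := @cst_continuousC I A R 1.

Lemma Cc_rep_unit : p (theta [::] [::] (fun=> 1)) = 1.
Proof.
apply: (nondegenerate_unit (Cc_rep_nondegenerate hp)) => _ [f hf <-].
by rewrite -(Cc_repM hp (theta_Cc _ _ c1) hf) convolution_unit.
Qed.

Lemma Cc_repD f g : Cc f -> Cc g -> p (fun c => f c + g c) = p f + p g.
Proof.
move=> hf hg; rewrite -[p f]scale1r -(Cc_rep_linear hp 1 hf hg).
by congr p; apply/funext => c; rewrite mul1r.
Qed.

Local Notation J h := (p (theta [::] [::] h)).
Local Notation S i := (p \1_(Sset A i)).

Lemma Cc_rep_JD (h k : X -> C) : continuous h -> continuous k ->
  J (fun z => h z + k z) = J h + J k.
Proof. by move=> hc kc; have := PhiJD Cc_repD hc kc. Qed.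

Lemma Cc_rep_JM (h k : X -> C) : continuous h -> continuous k ->
  J (fun z => h z * k z) = J h * J k.
Proof. by move=> hc kc; have := PhiJM (Cc_repM hp) hc kc. Qed.

Lemma Cc_rep_Jstar (h : X -> C) : continuous h ->
  J (fun z => Num.conj (h z)) = adjoint (J h).
Proof. by move=> hc; rewrite -(Cc_rep_star hp (theta_Cc _ _ hc)) theta_star. Qed.

Lemma Cc_rep_Jcst (a : C) : J (fun=> a) = a *: (1 : bop H).
Proof.
have h1 := theta_Cc [::] [::] c1.
have -> : theta [::] [::] (fun=> a) =
    (fun c => a * theta [::] [::] (fun _ : X => 1 : C) c + (fun _ : G => 0 : C) c).
  apply/funext => c; rewrite addr0; have [[z e]|n] := pselect (bis [::] [::] c).
    by rewrite !(theta_in _ e) mulr1.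
  by rewrite !theta_out // mulr0.
rewrite (Cc_rep_linear hp a h1 (Cc_zero A R)) Cc_rep_unit.
have -> : (fun _ : G => 0 : C) = theta [::] [::] (fun=> 0).
  apply/funext => c; have [[z e]|n] := pselect (bis [::] [::] c).
    by rewrite !(theta_in _ e).
  by rewrite !theta_out.
by rewrite (PhiJ0 Cc_repD) addr0.
Qed.

(* [M^2 - |h|^2] has a continuous square root, so the operator it defines is
   positive. *)
Lemma Cc_rep_J_norm (h : X -> C) (M : R) : continuous h -> 0 <= M ->
  (forall x, nrm (h x) <= M) -> forall v, nrm (J h v) <= M * nrm v.
Proof.
move=> hc M0 hM v.
pose d x := M ^+ 2 - nrm (h x) ^+ 2.
have d0 x : 0 <= d x by rewrite subr_ge0 ler_sqr ?nnegrE ?nrm_ge0.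
pose k x := toC (Num.sqrt (d x)).
have kc : continuous k by exact: sqrt_sub_nrm_continuous.
have hcc := conjf_continuous hc; have kcc := conjf_continuous kc.
have sum : adjoint (J h) * J h + adjoint (J k) * J k = toC (M ^+ 2) *: (1 : bop H).
  rewrite -Cc_rep_Jcst -(Cc_rep_Jstar hc) -(Cc_rep_Jstar kc).
  rewrite -(Cc_rep_JM hcc hc) -(Cc_rep_JM kcc kc).
  rewrite -(Cc_rep_JD (mulf_continuous hcc hc) (mulf_continuous kcc kc)).
  congr (J _); apply/funext => x; rewrite !conj_mulC -toCD; congr toC.
  rewrite /k nrm_toC ger0_norm ?sqrtr_ge0 // sqr_sqrtr // /d.
  by rewrite addrC subrK.
have : nrm (J h v) ^+ 2 + nrm (J k v) ^+ 2 = M ^+ 2 * nrm v ^+ 2.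
  apply: toC_inj; rewrite toCD !nrm_sqr_adjoint -innerDl -bopDE sum.
  by rewrite bopZE innerZl inner_nrm toCM.
move=> e; rewrite -ler_sqr ?nnegrE ?mulr_ge0 ?nrm_ge0 // exprMn -e lerDl.
exact: sqr_ge0.
Qed.

Lemma Cc_rep_theta_word s : p (theta s [::] (fun=> 1)) = word_op (fun i => S i) s.
Proof.
elim: s => [|i s IH]; first exact: Cc_rep_unit.
rewrite /= -IH theta_Sset -(Cc_repM hp (theta_Cc _ _ c1) (theta_Cc _ _ c1)).
rewrite (@convolution_thetar _ _ _ [:: i] [::] s [::]); congr p.
by apply: theta_ext => z [ds _] _; rewrite pull_word_in // !mulr1.
Qed.

Lemma Cc_rep_theta s t (h : X -> C) : continuous h ->
  p (theta s t h) = word_op (fun i => S i) s * J h * adjoint (word_op (fun i => S i) t).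
Proof.
move=> hc; have hs := theta_Cc s [::] c1; have h0 := theta_Cc [::] [::] hc.
have ht := theta_Cc t [::] c1; have ht' := theta_Cc [::] t c1.
have -> : adjoint (word_op (fun i => S i) t) = p (theta [::] t (fun=> 1)).
  rewrite -Cc_rep_theta_word -(Cc_rep_star hp ht) theta_star; congr p.
  by apply: theta_ext => z _ _; rewrite conjC1.
rewrite -Cc_rep_theta_word -(Cc_repM hp hs h0).
rewrite (@convolution_thetar _ _ _ s [::] [::] [::]) /= cats0.
have e : theta s [::] (fun z => 1 * 1 * h z) = theta s [::] h.
  by apply: theta_ext => z _ _; rewrite !mul1r.
rewrite e -(Cc_repM hp (theta_Cc _ _ hc) ht').
rewrite (@convolution_thetar _ _ _ s [::] [::] t) /= cats0; congr p.
by apply: theta_ext => z _ _; rewrite !mulr1.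
Qed.

(** The indicator of [gen (i :: s, o)] is the push by [i] of that of [gen (s, o)]; a representation
    therefore follows the recursion that defines [gen_op]. *)
Lemma Cc_rep_gen (g : seq I * option I) :
  J (indic R (@gen I A g)) = gen_op (fun i => S i) g.1 g.2.
Proof.
case: g => s o; elim: s => [|i s IH] /=.
  case: o => [j|].
    by rewrite -source_gen -(Phi_source (Cc_repM hp) (Cc_rep_star hp)).
  rewrite -Cc_rep_unit; congr (J _); apply/funext => x.
  by rewrite /indic mem_set.
have gc : continuous (indic R (@gen I A (s, o))) by apply: indic_continuous; exact: gen_clopen.
have -> : theta [::] [::] (indic R (@gen I A (i :: s, o))) =
    theta [:: i] [:: i] (indic R (@gen I A (s, o))) :> (G -> C).
  rewrite (@theta_rcons _ _ _ [::] [::] i); congr theta; apply/funext => x.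
  rewrite /push /indic; have [h|h] := pselect (starts_with [:: i] x).
    rewrite restr_in //=; congr (nat_of_bool _)%:R; apply/idP/idP; rewrite !inE.
      by move=> /(gen_tail s o h).
    by move=> /(gen_tail s o h).
  rewrite restr_out // memNset // => hg; apply: h.
  by case: o {IH gc} hg => [j|]; [case=> + _|] => /starts_with_cons[e _];
    apply/starts_with_cons.
by rewrite (Cc_rep_theta _ _ gc) IH /= !mulr1.
Qed.

End OneRep.

(** On indicators of generators both representations are given by [gen_op] of the same operators.
    Uniform approximation with [Cc_rep_J_norm] reaches all continuous functions, and each
    [theta s t h] is a product of such a function with words in the [S_i] and their adjoints. *)
Lemma Cc_rep_unique (H : hilbertSpace R) (p q : (G -> C) -> bop H) :
  is_Cc_rep p -> is_Cc_rep q -> (forall i, p \1_(Sset A i) = q \1_(Sset A i)) ->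
  forall f, Cc f -> p f = q f.
Proof.
move=> hp hq pq.
have Spq : (fun i => p \1_(Sset A i)) = (fun i => q \1_(Sset A i)) by exact/funext.
have hJ (h : X -> C) : continuous h -> p (theta [::] [::] h) = q (theta [::] [::] h).
  move=> hc; pose Q (h : X -> C) := continuous h /\
    p (theta [::] [::] h) = q (theta [::] [::] h).
  have Qcst a : Q (fun=> a).
    by split; [exact: cst_continuousC | rewrite !Cc_rep_Jcst].
  have QG (g : seq I * option I) : Q (fun x => (x \in @gen I A g)%:R).
    split; first by apply: indic_continuous; exact: gen_clopen.
    by rewrite (Cc_rep_gen hp) (Cc_rep_gen hq) Spq.
  have QD (f g : X -> C) : Q f -> Q g -> Q (fun x => f x + g x).
    move=> [fc fe] [gc ge]; split; first exact: addf_continuous fc gc.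
    by rewrite (Cc_rep_JD hp fc gc) (Cc_rep_JD hq fc gc) fe ge.
  have QM (f g : X -> C) : Q f -> Q g -> Q (fun x => f x * g x).
    move=> [fc fe] [gc ge]; split; first exact: mulf_continuous fc gc.
    by rewrite (Cc_rep_JM hp fc gc) (Cc_rep_JM hq fc gc) fe ge.
  apply: bop_eqM => d d0 v.
  have [g [gc ge] hg] := continuous_approx Qcst QG QD QM hc d0.
  have mgc : continuous (fun x => -1 * g x).
    by apply: mulf_continuous; [exact: cst_continuousC | exact: gc].
  have bound (r : (G -> C) -> bop H) : is_Cc_rep r ->
      nrm (r (theta [::] [::] h) v - r (theta [::] [::] g) v) <= d * nrm v.
    move=> hr; rewrite -bopBE.
    have -> : r (theta [::] [::] h) - r (theta [::] [::] g) =
        r (theta [::] [::] (fun x => h x + -1 * g x)).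
      rewrite (Cc_rep_JD hr hc mgc) (Cc_rep_JM hr (@cst_continuousC I A R _) gc).
      by rewrite (Cc_rep_Jcst hr) bop_scaleAl mul1r scaleN1r.
    apply: (Cc_rep_J_norm hr (addf_continuous hc mgc) (ltW d0)) => x.
    by rewrite mulN1r.
  by exists (p (theta [::] [::] g) v); split; [exact: bound | rewrite ge; exact: bound].
move=> f hf; have [L ->] := Cc_theta_sum hf.
have cf r : continuous (coef f r.1 r.2) := @coef_continuous _ _ _ _ r.1 r.2 hf.1.
have hL r : Cc (theta r.1 r.2 (coef f r.1 r.2)) by exact: theta_Cc (cf r).
rewrite (additive_sum (Cc_repD hp) L hL) (additive_sum (Cc_repD hq) L hL).
apply: eq_bigr => r _.
by rewrite (Cc_rep_theta hp _ _ (cf r)) (Cc_rep_theta hq _ _ (cf r)) Spq (hJ _ (cf r)).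
Qed.

End Uniqueness.

(** * Square roots in a C*-algebra, towards the contractivity of representations *)

Section CstarAlgebraTheory.
Variables (R : realType) (B : cstarAlgType R).
Local Notation C := (Cplx R).
Implicit Types (a b x y z : B) (c : C).

Lemma nrm_cmul x y : nrm (cmul x y) <= nrm x * nrm y.
Proof. by rewrite -ler_toC toCM -!nrmE cnormM. Qed.

Lemma nrm_cstar x : nrm (cmul (star x) x) = nrm x ^+ 2.
Proof. by apply: toC_inj; rewrite toCX -!nrmE cstar_norm. Qed.

Lemma cmulNl x y : cmul (- x) y = - cmul x y.
Proof. by rewrite -scaleN1r cmulZl scaleN1r. Qed.
Lemma cmulNr x y : cmul x (- y) = - cmul x y.
Proof. by rewrite -scaleN1r cmulZr scaleN1r. Qed.

Lemma starD x y : star (x + y) = star x + star y.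
Proof. by rewrite -{1}[x]scale1r starP conjC1 scale1r. Qed.
Lemma star0 : star (0 : B) = 0.
Proof. by apply: (addrI (star 0)); rewrite -starD !addr0. Qed.
Lemma starZ c x : star (c *: x) = Num.conj c *: star x.
Proof. by rewrite -[c *: x]addr0 starP star0 addr0. Qed.
Lemma starN x : star (- x) = - star x.
Proof. by apply/eqP; rewrite -addr_eq0 -starD addNr star0. Qed.
Lemma starB x y : star (x - y) = star x - star y.
Proof. by rewrite starD starN. Qed.

Lemma star_cone : star (cone : B) = cone.
Proof.
have := starM (star cone) (cone : B).
by rewrite cmul1r !starK cmul1r => <-.
Qed.

Lemma nrm_star x : nrm (star x) = nrm x.
Proof.
suff le y : nrm y <= nrm (star y).
  by apply/le_anti; rewrite le /= -{2}[x]starK le.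
have [->|y0] := eqVneq (nrm y) 0; first exact: nrm_ge0.
have yp : 0 < nrm y by rewrite lt_def y0 nrm_ge0.
by rewrite -(ler_pM2r yp) -expr2 -nrm_cstar nrm_cmul.
Qed.

Definition half : C := toC 2^-1.

Lemma half_half x : half *: x + half *: x = x.
Proof.
have e : 2^-1 + 2^-1 = 1 :> R by lra.
by rewrite -scalerDl /half -toCD e toC1 scale1r.
Qed.

(* [1 - y] squares to [1 - a] when [y] is fixed. *)
Definition sqrt_step a y := half *: (a + cmul y y).

Section SquareRoot.
Variable a : B.
Hypothesis a1 : nrm a < 1.
Local Notation q := (nrm a).
Local Notation F := (sqrt_step a).

Lemma sqrt_step_ball y : nrm y <= q -> nrm (F y) <= q.
Proof.
move=> hy; rewrite /F nrmZ nrm_toC ger0_norm ?invr_ge0 // mulrC ler_pdivrMr //.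
rewrite (le_trans (nrmD _ _)) // mulr_natr mulr2n lerD2l.
rewrite (le_trans (nrm_cmul _ _)) // -[leRHS]mulr1.
by rewrite ler_pM ?nrm_ge0 // (le_trans hy) // ltW.
Qed.

(** From [y y - z z = y (y - z) + (y - z) z], valid without commutation: two terms of size at most
    [q] times the distance, halved. *)
Lemma sqrt_step_contract y z : nrm y <= q -> nrm z <= q ->
  nrm (F y - F z) <= q * nrm (y - z).
Proof.
move=> hy hz.
have -> : F y - F z = half *: (cmul y (y - z) + cmul (y - z) z).
  rewrite /F -scalerBr cmulDr cmulDl cmulNr cmulNl addrA subrK.
  by rewrite opprD addrACA subrr add0r.
rewrite nrmZ nrm_toC ger0_norm ?invr_ge0 // mulrC ler_pdivrMr //.
rewrite (le_trans (nrmD _ _)) // mulr_natr mulr2n lerD //.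
  by rewrite (le_trans (nrm_cmul _ _)) // ler_wpM2r ?nrm_ge0.
by rewrite (le_trans (nrm_cmul _ _)) // mulrC ler_wpM2r ?nrm_ge0.
Qed.

Local Notation it n := (iter n F 0).

Lemma sqrt_iter_ball n : nrm (it n) <= q.
Proof.
by elim: n => [|n IH] /=; [rewrite nrm0 nrm_ge0 | exact: sqrt_step_ball].
Qed.

Lemma sqrt_iter_dist m n : nrm (it (m + n) - it m) <= q ^+ m.
Proof.
elim: m => [|m IH].
  by rewrite subr0 expr0 (le_trans (sqrt_iter_ball _)) // ltW.
rewrite addSn /= (le_trans (sqrt_step_contract _ _)) ?sqrt_iter_ball //.
by rewrite exprS ler_wpM2l ?nrm_ge0.
Qed.

Lemma expr_small (e : R) : 0 < e -> exists N, forall n, (N <= n)%N -> q ^+ n < e.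
Proof.
move=> e0; have : `|q| < 1 by rewrite ger0_norm ?nrm_ge0.
move=> /cvg_expr/cvgrPdist_lt/(_ e e0)[N _ hN]; exists N => n /hN.
by rewrite sub0r normrN ger0_norm ?exprn_ge0 ?nrm_ge0.
Qed.

Lemma sqrt_fixed : exists2 y, nrm y <= q & F y = y.
Proof.
have [|y hy] := @complete_nrm R B (fun n => it n).
  move=> e e0; have [N hN] := expr_small e0; exists N => m n Nm mn.
  by rewrite -(subnKC mn) (le_lt_trans (sqrt_iter_dist _ _)) ?hN.
have {}hy (e : R) : 0 < e -> exists n, nrm (it n - y) < e /\ nrm (it n.+1 - y) < e.
  move=> /((cvgn_nrmP _ _).1 hy)[N hN]; exists N; split; apply: hN => //.
have yq : nrm y <= q.
  apply/ler_addgt0Pl => e e0; have [n [hn _]] := hy e e0.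
  rewrite -[y](subKr (it n)) (le_trans (nrmB _ _)) // addrC lerD ?sqrt_iter_ball //.
  exact: ltW.
exists y => //; apply/eqP; rewrite -subr_eq0; apply/eqP/nrm_small => e e0.
have [n [h1 h2]] := hy (e / 2) (divr_gt0 e0 (ltr0Sn _ 1)).
apply: (le_trans (nrm_dist (it n.+1) _ _)); rewrite [e]splitr lerD ?(ltW h2) //.
rewrite /= (le_trans (sqrt_step_contract _ _)) ?sqrt_iter_ball //.
rewrite nrm_distC (le_trans _ (ltW h1)) // -[leRHS]mul1r.
by rewrite ler_wpM2r ?nrm_ge0 // ltW.
Qed.

(** The fixed point [y] is self-adjoint because [star y] is also a fixed point in the ball of radius
    [q], where the step is a strict contraction. The square of [1 - y] follows from
    [a + y y = y + y]. *)
Lemma sqrt_one_sub : star a = a ->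
  exists2 c, star c = c & cmul c c = cone - a.
Proof.
move=> sa; have [y yq Fy] := sqrt_fixed; exists (cone - y).
  rewrite starB star_cone; congr (_ - _).
  have Fs : F (star y) = star y.
    by rewrite -{2}Fy /sqrt_step starZ conj_toC starD sa starM.
  have sq : nrm (star y) <= q by rewrite nrm_star.
  have := sqrt_step_contract sq yq; rewrite Fs Fy => h.
  apply/eqP; rewrite -subr_eq0; apply/eqP/nrm_eq0/le_anti; rewrite nrm_ge0 andbT.
  have q1 : 0 < 1 - q by rewrite subr_gt0.
  by rewrite -(pmulr_rle0 _ q1) mulrBl mul1r subr_le0.
have e : a + cmul y y = y + y.
  by rewrite -[LHS]half_half -/(F y) Fy.
rewrite cmulDl !cmulDr cmulNl !cmulNr cmulNl cmul1l cmul1r cmul1l opprK.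
have -> : cmul y y = y + y - a by rewrite -e [a + _]addrC addrK.
by rewrite -addrA; congr (_ + _); rewrite -[y + y - a]addrA !addKr.
Qed.

End SquareRoot.
End CstarAlgebraTheory.

Section CstarRepresentations.
Variables (R : realType) (B : cstarAlgType R) (H : hilbertSpace R) (rho : B -> bop H).
Hypothesis hrho : is_cstar_rep rho.
Implicit Types (b x y : B) (v : H).

Lemma cstar_repZ (c : Cplx R) x : rho (c *: x) = c *: rho x.
Proof.
have r0 : rho 0 = 0.
  have := cstar_rep_linear hrho 1 0 0; rewrite !scale1r addr0 => e.
  by apply: (addrI (rho 0)); rewrite -e addr0.
by have := cstar_rep_linear hrho c x 0; rewrite r0 !addr0.
Qed.

Lemma cstar_repD x y : rho (x + y) = rho x + rho y.
Proof. by have := cstar_rep_linear hrho 1 x y; rewrite !scale1r. Qed.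

Lemma cstar_repB x y : rho (x - y) = rho x - rho y.
Proof. by rewrite cstar_repD -scaleN1r cstar_repZ scaleN1r. Qed.

Lemma cstar_rep1 : rho cone = 1.
Proof.
apply: (nondegenerate_unit (cstar_rep_nondegenerate hrho)) => _ [b _ <-].
by rewrite -(cstar_repM hrho) cmul1l.
Qed.

(* [1 - b^* b] is the square of a self-adjoint element. *)
Lemma cstar_rep_contract1 b v : nrm b < 1 -> nrm (rho b v) <= nrm v.
Proof.
move=> b1; have bb1 : nrm (cmul (star b) b) < 1.
  by rewrite nrm_cstar expr_lt1 ?nrm_ge0.
have [|c sc cc] := sqrt_one_sub bb1; first by rewrite starM starK.
have e : adjoint (rho c) * rho c + adjoint (rho b) * rho b = 1.
  rewrite -!(cstar_rep_star hrho) -!(cstar_repM hrho) sc cc -cstar_repD subrK.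
  exact: cstar_rep1.
have : nrm (rho c v) ^+ 2 + nrm (rho b v) ^+ 2 = nrm v ^+ 2.
  by apply: toC_inj; rewrite toCD !nrm_sqr_adjoint -innerDl -bopDE e bop1E inner_nrm.
move=> {}e; rewrite -ler_sqr ?nnegrE ?nrm_ge0 // -e lerDr.
exact: sqr_ge0.
Qed.

Lemma cstar_rep_contract b v : nrm (rho b v) <= nrm b * nrm v.
Proof.
(* Division by any [M > nrm b] reaches the open unit ball, where the square root exists, also when
   [nrm b] is [0]. *)
suff h (M : R) : nrm b < M -> nrm (rho b v) <= M * nrm v.
  apply: ler_add_smallM (nrm_ge0 v) _ => d d0.
  by rewrite -mulrDl h // ltrDl.
move=> bM; have M0 : 0 < M by exact: le_lt_trans (nrm_ge0 _) bM.
have e : b = toC M *: (toC M^-1 *: b).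
  by rewrite scalerA -toCM divff ?gt_eqF // toC1 scale1r.
rewrite e cstar_repZ bopZE nrmZ nrm_toC gtr0_norm // ler_wpM2l ?(ltW M0) //.
apply: cstar_rep_contract1.
by rewrite nrmZ nrm_toC gtr0_norm ?invr_gt0 // mulrC ltr_pdivrMr // mul1r.
Qed.

End CstarRepresentations.

Section CcAlgebra.
Variables (I : countType) (A : rel I) (R : realType).
Local Notation C := (Cplx R).
Local Notation G := (drGroupoid (path_shift A)).
Implicit Types (f g : G -> C).

Lemma Cc_scale (a : C) f : Cc f -> Cc (fun c => a * f c).
Proof.
move=> [fc [K Kc hK]]; split; last by exists K => // c /hK ->; rewrite mulr0.
exact: mulf_continuous (@cst_continuous _ _ a) fc.
Qed.

Lemma Cc_convolution f g : Cc f -> Cc g -> Cc (convolution f g).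
Proof.
move=> hf hg; have [L ef] := Cc_theta_sum hf; have [M eg] := Cc_theta_sum hg.
have cf p : continuous (coef f p.1 p.2) := @coef_continuous _ _ _ _ p.1 p.2 hf.1.
have cg p : continuous (coef g p.1 p.2) := @coef_continuous _ _ _ _ p.1 p.2 hg.1.
rewrite ef (convolution_suml _ _ (fun p => theta_Cc p.1 p.2 (cf p))).
apply: Cc_sum => p; rewrite eg (convolution_sumr _ _ (theta_Cc _ _ (cf p))).
by apply: Cc_sum => q; exact: convolution_theta_Cc (cf p) (cg q).
Qed.

Lemma Cc_Cc_star f : Cc f -> Cc (Cc_star f).
Proof.
move=> hf; have [L ef] := Cc_theta_sum hf.
have cf p : continuous (coef f p.1 p.2) := @coef_continuous _ _ _ _ p.1 p.2 hf.1.
rewrite ef Cc_star_sum; apply: Cc_sum => p; rewrite theta_star.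
exact: theta_Cc (conjf_continuous (cf p)).
Qed.

End CcAlgebra.

(** * The groupoid C*-algebra: restriction and extension of representations *)

Section GroupoidCstar.
Variables (R : realType) (I : countType) (A : rel I).
Local Notation C := (Cplx R).
Local Notation X := (terminalPath A).
Local Notation G := (drGroupoid (path_shift A)).
Variables (B : cstarAlgType R) (iota : (G -> C) -> B).
Hypothesis hB : is_groupoid_cstar iota.
Implicit Types (f g : G -> C) (b : B).

Let c1 := @cst_continuousC I A R 1.

Lemma gcstarD f g : Cc f -> Cc g -> iota (fun c => f c + g c) = iota f + iota g.
Proof.
move=> hf hg; rewrite -[iota f]scale1r -(gcstar_linear hB 1 hf hg).
by congr iota; apply/funext => c; rewrite mul1r.
Qed.

Lemma gcstar_approx b (e : R) : 0 < e -> exists2 f, Cc f & nrm (b - iota f) < e.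
Proof.
move=> e0; have : closure (iota @` @Cc X (path_shift A) R) b by rewrite (gcstar_dense hB).
move=> /(_ [set y | nrm (y - b) < e]) [].
  by apply/nbhs_nrmP; exists e.
by move=> y [[f hf <-] /= yb]; exists f => //; rewrite nrm_distC.
Qed.

Lemma gcstar1 : iota (theta [::] [::] (fun=> 1)) = cone.
Proof.
set E := iota _; rewrite -[LHS]cmul1r.
suff h b : cmul E b = b by rewrite h.
apply: (@nrm_eqM _ _ _ _ (nrm E + 1)) => [|d d0]; first by rewrite addr_ge0 ?nrm_ge0.
have [f hf /ltW bf] := gcstar_approx b d0.
have Ef : cmul E (iota f) = iota f.
  by rewrite /E -(gcstarM hB (theta_Cc _ _ c1) hf) convolution_unit.
apply: (le_trans (nrm_dist (iota f) _ _)).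
rewrite -{1}Ef -cmulNr -cmulDr mulrDr mulr1 lerD //; last by rewrite nrm_distC.
by rewrite (le_trans (nrm_cmul _ _)) // mulrC ler_wpM2r ?nrm_ge0.
Qed.

Lemma gcstar_partial_isometry i :
  @partial_isometry (cstar_ring B) star (iota \1_(Sset A i)).
Proof.
exact: (@Phi_partial_isometry I A R (cstar_ring B) star iota
  (gcstarM hB) (gcstar_star hB)).
Qed.

Lemma gcstar_cuntz_krieger :
  @cuntz_krieger (cstar_ring B) star I A (fun i => iota \1_(Sset A i)).
Proof.
exact: (@Phi_cuntz_krieger I A R (cstar_ring B) star iota
  gcstarD (gcstarM hB) (gcstar_star hB) gcstar1).
Qed.

Section Restriction.
Variables (H : hilbertSpace R) (rho : B -> bop H).
Hypothesis hrho : is_cstar_rep rho.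

Lemma cstar_rep_Cc_rep : is_Cc_rep (fun f => rho (iota f)).
Proof.
split=> [a f g hf hg|f g hf hg|f hf|].
- by rewrite (gcstar_linear hB) // (cstar_rep_linear hrho).
- by rewrite (gcstarM hB) // (cstar_repM hrho).
- by rewrite (gcstar_star hB) // (cstar_rep_star hrho).
apply/seteqP; split=> // w _; apply: subset_closure.
exists [:: (1 : bop H, w)]; last by rewrite big_seq1.
move=> p; rewrite inE => /eqP -> /=; exists (theta [::] [::] (fun=> 1)).
  exact: theta_Cc c1.
by rewrite gcstar1 (cstar_rep1 hrho).
Qed.

End Restriction.

Section Extension.
Variables (H : hilbertSpace R) (p : (G -> C) -> bop H).
Hypothesis hp : is_Cc_rep p.
Implicit Types (S T : bop H) (v : H).

(** Characterises the value at [b] of the continuous extension of [p]. Testing against every [f],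
    and not along a chosen sequence, makes it independent of choices. *)
Definition extends b T :=
  forall f, Cc f -> forall v, nrm (T v - p f v) <= nrm (b - iota f) * nrm v.

Lemma gcstar_bound f v : Cc f -> nrm (p f v) <= nrm (iota f) * nrm v.
Proof. by move=> hf; rewrite -ler_toC toCM -!nrmE (gcstar_norm_ub hB). Qed.

Lemma gcstar_sub f g : Cc f -> Cc g ->
  iota (fun c => -1 * f c + g c) = iota g - iota f.
Proof. by move=> hf hg; rewrite (gcstar_linear hB) // scaleN1r addrC. Qed.

Lemma gcstar_bound_sub f g v : Cc f -> Cc g ->
  nrm (p g v - p f v) <= nrm (iota g - iota f) * nrm v.
Proof.
move=> hf hg; rewrite -gcstar_sub //.
have -> : p g v - p f v = p (fun c => -1 * f c + g c) v.
  by rewrite (Cc_rep_linear hp) // scaleN1r bopDE bopNE addrC.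
exact: gcstar_bound (Cc_add (Cc_scale _ hf) hg).
Qed.

(** One family of approximants suffices: [gcstar_bound_sub] compares it with any other element of
    [Cc]. *)
Lemma extends_of_approx b T :
  (forall e : R, 0 < e -> exists f, [/\ Cc f, nrm (b - iota f) <= e &
    forall v, nrm (T v - p f v) <= e * nrm v]) -> extends b T.
Proof.
move=> h f hf v; apply: (@ler_add_smallM _ _ _ (nrm v + nrm v)) => [|d d0].
  by rewrite addr_ge0 ?nrm_ge0.
have [g [hg bg Tg]] := h d d0.
rewrite (le_trans (nrm_dist (p g v) _ _)) // mulrDr addrCA lerD //.
rewrite (le_trans (gcstar_bound_sub _ hf hg)) // addrC -mulrDl ler_wpM2r ?nrm_ge0 //.
by rewrite (le_trans (nrm_dist b _ _)) // lerD2r nrm_distC.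
Qed.

Lemma extends_unique b S T : extends b S -> extends b T -> S = T.
Proof.
move=> hS hT; apply: bop_eqM => d d0 v.
have [f hf /ltW bf] := gcstar_approx b d0; exists (p f v).
by split; [rewrite (le_trans (hS _ hf _)) // | rewrite (le_trans (hT _ hf _)) //];
  rewrite ler_wpM2r ?nrm_ge0.
Qed.

Lemma extends_Cc f : Cc f -> extends (iota f) (p f).
Proof. by move=> hf g hg v; exact: gcstar_bound_sub. Qed.

Lemma extends_exists b : exists T, extends b T.
Proof.
have /choice[f hf] n : exists f, Cc f /\ nrm (b - iota f) < n.+1%:R^-1.
  have n0 : 0 < n.+1%:R^-1 :> R by rewrite invr_gt0 ltr0Sn.
  by have [f hf bf] := gcstar_approx b n0; exists f.
have hb (e : R) : 0 < e -> exists N, forall n, (N <= n)%N -> nrm (b - iota (f n)) <= e.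
  move=> /invS_small[N hN]; exists N => n /hN h; exact: ltW (lt_trans (hf n).2 h).
have [|T hT] := @bop_lim _ _ (fun n => p (f n)).
  move=> e e0; have [|N hN] := hb (e / 2); first by rewrite divr_gt0.
  exists N => m n Nm Nn v.
  rewrite (le_trans (gcstar_bound_sub _ (hf n).1 (hf m).1)) // ler_wpM2r ?nrm_ge0 //.
  rewrite (le_trans (nrm_dist b _ _)) // [leRHS]splitr lerD ?hN // nrm_distC.
  exact: hN.
exists T; apply: extends_of_approx => e e0.
have [N hN] := hb e e0; have [M hM] := hT e e0.
exists (f (N + M)%N); split; first exact: (hf _).1.
  by apply: hN; exact: leq_addr.
by apply: hM; exact: leq_addl.
Qed.

Lemma extends_linear a b b' S T : extends b S -> extends b' T ->
  extends (a *: b + b') (a *: S + T).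
Proof.
move=> hS hT; apply: extends_of_approx => e e0.
have a1 : 0 < nrm a + 1 by rewrite ltr_wpDl ?nrm_ge0.
have d0 := divr_gt0 e0 a1; set d := e / _ in d0.
have [f hf bf] := gcstar_approx b d0; have [g hg bg] := gcstar_approx b' d0.
have de : d * (nrm a + 1) = e by rewrite divfK // gt_eqF.
exists (fun c => a * f c + g c); split; first exact: Cc_add (Cc_scale _ hf) hg.
  rewrite (gcstar_linear hB) // opprD addrACA -scalerBr (le_trans (nrmD _ _)) //.
  rewrite -de nrmZ mulrDr mulr1 lerD ?(ltW bg) // mulrC ler_wpM2r ?nrm_ge0 //.
  exact: ltW.
move=> v; rewrite (Cc_rep_linear hp) // !bopDE !bopZE opprD addrACA -scalerBr.
rewrite (le_trans (nrmD _ _)) // -de nrmZ mulrDr mulr1 mulrDl lerD //.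
  rewrite (mulrC d) -mulrA ler_wpM2l ?nrm_ge0 // (le_trans (hS _ hf _)) //.
  by rewrite ler_wpM2r ?nrm_ge0 // ltW.
by rewrite (le_trans (hT _ hg _)) // ler_wpM2r ?nrm_ge0 // ltW.
Qed.

Lemma extends_star b S : extends b S -> extends (star b) (adjoint S).
Proof.
move=> hS; apply: extends_of_approx => e e0.
have [f hf bf] := gcstar_approx b e0.
exists (Cc_star f); split; first exact: Cc_Cc_star.
  by rewrite (gcstar_star hB) // -starB nrm_star ltW.
move=> v; rewrite (Cc_rep_star hp) // -bopBE -adjointB.
apply: adjoint_bound (ltW e0) _ _ => x; rewrite bopBE (le_trans (hS _ hf _)) //.
by rewrite ler_wpM2r ?nrm_ge0 // ltW.
Qed.

Lemma extendsM b b' S T : extends b S -> extends b' T ->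
  extends (cmul b b') (S * T).
Proof.
move=> hS hT; apply: extends_of_approx => e e0.
have [M M0 hM] := bop_bounded S.
(* This constant dominates both error sums, [nrm b + nrm b' + d] for the elements and
   [M + nrm b' + d] for the operators, given [d <= 1]. *)
have K0 : 0 < M + nrm b + nrm b' + 1 by rewrite !ltr_wpDl ?nrm_ge0 // !addr_ge0 ?nrm_ge0 ?ltW.
set K := _ + 1 in K0.
pose d := Num.min 1 (e / K).
have d0 : 0 < d by rewrite lt_min ltr01 divr_gt0.
have d1 : d <= 1 by rewrite ge_min lexx.
have dK : d * K <= e by rewrite -ler_pdivlMr // ge_min lexx orbT.
have [f hf bf] := gcstar_approx b d0; have [g hg bg] := gcstar_approx b' d0.
have gb : nrm (iota g) <= nrm b' + d.
  rewrite -[iota g](subKr b') (le_trans (nrmB _ _)) // lerD2l ltW //.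
have n0 := nrm_ge0 b; have n0' := nrm_ge0 b'.
exists (convolution f g); split; first exact: Cc_convolution.
  rewrite (gcstarM hB) //; apply: le_trans dK.
  apply: (le_trans (nrm_dist (cmul b (iota g)) _ _)).
  rewrite -cmulNr -cmulDr -cmulNl -cmulDl.
  have h1 := nrm_cmul b (b' - iota g); have h2 := nrm_cmul (b - iota f) (iota g).
  have h3 := ler_pM (nrm_ge0 _) (nrm_ge0 _) (ltW bf) gb.
  have h4 := ler_wpM2l n0 (ltW bg).
  apply: (le_trans (lerD (le_trans h1 h4) (le_trans h2 h3))).
  rewrite /K; move: (nrm b) (nrm b') n0 n0' => w w' w0 w'0; clearbody d.
  have := ler_wpM2l (ltW d0) d1; have := mulr_gt0 d0 M0; lra.
move=> v; rewrite (Cc_repM hp) // !bopME.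
have v0 := nrm_ge0 v.
apply: (le_trans (nrm_dist (S (p g v)) _ _)); rewrite -bopB.
have h1 := hM (T v - p g v); have h2 := hS _ hf (p g v).
have h3 := le_trans (hT _ hg v) (ler_wpM2r v0 (ltW bg)).
have h4 := le_trans (gcstar_bound v hg) (ler_wpM2r v0 gb).
have h5 := ler_pM (nrm_ge0 _) (nrm_ge0 _) (ltW bf) h4.
have h6 := ler_wpM2l (ltW M0) h3.
apply: (le_trans (lerD (le_trans h1 h6) (le_trans h2 h5))).
apply: le_trans (ler_wpM2r v0 dK).
rewrite !mulrA -mulrDl ler_wpM2r // /K.
move: (nrm b) (nrm b') n0 n0' => w w' w0 w'0; clearbody d.
have := ler_wpM2l (ltW d0) d1; have := mulr_ge0 (ltW d0) w0; lra.
Qed.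

Lemma Cc_rep_extends : exists2 rho : B -> bop H, is_cstar_rep rho &
  forall f, Cc f -> rho (iota f) = p f.
Proof.
have /choice[rho hrho] b := extends_exists b; exists rho; last first.
  by move=> f hf; exact: extends_unique (hrho _) (extends_Cc hf).
split.
- move=> a b b'; exact: extends_unique (hrho _) (extends_linear a (hrho _) (hrho _)).
- move=> b b'; exact: extends_unique (hrho _) (extendsM (hrho _) (hrho _)).
- move=> b; exact: extends_unique (hrho _) (extends_star (hrho _)).
apply/seteqP; split=> // w _; apply: subset_closure.
exists [:: (1 : bop H, w)]; last by rewrite big_seq1.
move=> q; rewrite inE => /eqP -> /=; exists (iota (theta [::] [::] (fun=> 1))) => //.
rewrite -(Cc_rep_unit hp).
exact: extends_unique (hrho _) (extends_Cc (theta_Cc _ _ c1)).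
Qed.

End Extension.

(** Contractivity shows that [rho b] and [sigma b] both extend, in the sense of [extends], the
    single representation of [Cc] obtained by restriction. *)
Lemma gcstar_rep_unique (H : hilbertSpace R) (rho sigma : B -> bop H) :
  is_cstar_rep rho -> is_cstar_rep sigma ->
  (forall i, rho (iota \1_(Sset A i)) = sigma (iota \1_(Sset A i))) ->
  rho = sigma.
Proof.
move=> hr hs e; apply/funext => b.
have hp := cstar_rep_Cc_rep hs.
apply: (@extends_unique H (fun f => sigma (iota f)) b) => f hf v.
  rewrite -(Cc_rep_unique (cstar_rep_Cc_rep hr) hp e hf) -bopBE -(cstar_repB hr).
  exact: cstar_rep_contract.
by rewrite -bopBE -(cstar_repB hs); exact: cstar_rep_contract.
Qed.

End GroupoidCstar.

Lemma bis_bisection (I : countType) (A : rel I) s t : bisection (@bis I A s t).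
Proof.
split=> c c' /set_mem[z a] /set_mem[z' a'] e.
  have ez : z = z'.
    by case: a a' e => dz _ -> _ _ [dz' _ -> _ _]; exact: prepend_inj.
  by apply: arr_rel_fun a _; rewrite ez.
have ez : z = z'.
  by case: a a' e => _ dz _ -> _ [_ dz' _ -> _]; exact: prepend_inj.
by apply: arr_rel_fun a _; rewrite ez.
Qed.

Theorem corollary4p6 (R : realType) (I : countType) (A : rel I)
    (B : cstarAlgType R) (iota : (drGroupoid (path_shift A) -> Cplx R) -> B)
    (hB : is_groupoid_cstar iota) :
  (* (i) *)
  [/\ forall i : I, [/\ compact (Sset A i), open (Sset A i) &
                        bisection (Sset A i)],
      forall i : I, @partial_isometry (cstar_ring B) star (iota \1_(Sset A i)),
      @cuntz_krieger (cstar_ring B) star I A (fun i => iota \1_(Sset A i)) &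
      forall (H : hilbertSpace R) (rho : B -> bop H), is_cstar_rep rho ->
        (forall i : I,
           partial_isometry (@adjoint R H) (rho (iota \1_(Sset A i)))) /\
        cuntz_krieger (@adjoint R H) A (fun i => rho (iota \1_(Sset A i)))]
  /\
  (* (ii) *)
  ((forall i : I, exists j : I, A i j) ->
   forall (H : hilbertSpace R) (u : I -> bop H),
     (forall i : I, u i != 0) ->
     (forall i : I, partial_isometry (@adjoint R H) (u i)) ->
     cuntz_krieger (@adjoint R H) A u ->
     exists! rho : B -> bop H,
       is_cstar_rep rho /\ forall i : I, rho (iota \1_(Sset A i)) = u i).
Proof.
split; first split.
- move=> i; rewrite -(@bis_Sset I A R).
  by split; [exact: bis_compact | exact: bis_open | exact: bis_bisection].
- exact: gcstar_partial_isometry hB.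
- exact: gcstar_cuntz_krieger hB.
- move=> H rho hrho; have hp := cstar_rep_Cc_rep hB hrho; split.
    exact: (@Phi_partial_isometry I A R (bop H) (@adjoint R H) _
      (Cc_repM hp) (Cc_rep_star hp)).
  exact: (@Phi_cuntz_krieger I A R (bop H) (@adjoint R H) _
    (Cc_repD hp) (Cc_repM hp) (Cc_rep_star hp) (Cc_rep_unit hp)).
move=> _ H u _ u_pi u_ck; have hp := rep_is_Cc_rep u_pi u_ck.
have [rho hrho e] := Cc_rep_extends hB hp.
have eS i : rho (iota \1_(Sset A i)) = u i.
  by rewrite e ?(rep_Sset u_pi u_ck) //; exact: theta_one.
exists rho; split; first by split.
move=> sigma [hs hS]; apply: (gcstar_rep_unique hB hrho hs) => i.
by rewrite eS hS.
Qed.
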